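(* Let $\mathfrak{F}$ be a subset of $\mathbb{N}\times\mathbb{N}$ containing a sequence $(\tilde p_n,\tilde q_n)\in\mathfrak{F}$, $n=1,2,\dots$, with $\tilde p_n\to+\infty$. Let $\Omega\subset\mathbb{C}$ be a simply connected domain and let $\zeta\in\Omega$ be fixed. Then there exists a holomorphic function $f\in\mathcal{H}(\Omega)$ such that, for every polynomial $h$ and every compact set $K\subset\mathbb{C}\setminus\Omega$ with connected complement, there exists a sequence $(p_n,q_n)\in\mathfrak{F}$, $n=1,2,\dots$, such that the following hold: 1. $f\in\mathfrak{D}_{p_n,q_n}(\zeta)$ for all $n$; 2. $\sup_{z\in K}\bigl|[p_n/q_n]_{f,\zeta}(z)-h(z)\bigr|\to0$ as $n\to+\infty$; 3. for every compact set $L'\subset\Omega$, $\sup_{z\in L'}\bigl|[p_n/q_n]_{f,\zeta}(z)-f(z)\bigr|\to0$ as $n\to+\infty$. Moreover, the set of all such functions $f\in\mathcal{H}(\Omega)$ is dense and $G_\delta$ in $\mathcal{H}(\Omega)$.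
   Context: $\mathbb{N}=\{0,1,2,\dots\}$. ''Connected complement'' of a compact set $K$ means that $\mathbb{C}\setminus K$ is connected. $\mathcal{H}(\Omega)$ is the space of holomorphic functions on $\Omega$ with the topology of uniform convergence on compact subsets of $\Omega$. Padé approximants: let $f$ be holomorphic near $\zeta\in\mathbb{C}$, with Taylor expansion $f(z)=\sum_{v\ge 0}a_v(z-\zeta)^v$, and put $a_i=0$ for $i<0$. For $p,q\in\mathbb{N}$, write $f\in\mathfrak{D}_{p,q}(\zeta)$ if the $q\times q$ Hankel determinant $\det\bigl(a_{p-q+i+j-1}\bigr)_{i,j=1}^{q}$ is nonzero (for $q=0$ the condition holds trivially). If $f\in\mathfrak{D}_{p,q}(\zeta)$, there are unique polynomials $A,B$ with $\deg A\le p$, $\deg B\le q$, $B(\zeta)=1$ such that the Taylor expansion $\sum_{v\ge0} b_v(z-\zeta)^v$ of $A/B$ at $\zeta$ satisfies $b_v=a_v$ for all $v=0,1,\dots,p+q$; the Padé approximant is $[p/q]_{f,\zeta}(z)=A(z)/B(z)$. For $q=0$ it is the Taylor partial sum $\sum_{v=0}^p a_v(z-\zeta)^v$. Padé approximants are regarded as rational functions; a supremum of differences over a set containing a pole is $+\infty$. *)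

(* Defs.v *)
From HB Require Import structures.
From mathcomp Require Import all_boot all_order all_algebra.
From mathcomp Require Import complex.
From mathcomp Require Import all_classical all_reals all_analysis.
From mathcomp Require Import borel_hierarchy.

Set Implicit Arguments.
Unset Strict Implicit.
Unset Printing Implicit Defensive.

Import Order.TTheory GRing.Theory Num.Theory.
Import numFieldNormedType.Exports.

Local Open Scope classical_set_scope.
Local Open Scope ring_scope.

(* [R[i]] packaged as a [numClosedFieldType]: its topology and its normed
   module structure over itself are those of [numFieldNormedType.Exports], so
   [derivable] below is complex differentiability.  On the bare carrier [R[i]]
   these instances are not found, and scaling is by [R]. *)
Definition Cplx (R : realType) : numClosedFieldType := R[i].

Section Defs.
Variable R : realType.
Local Notation C := (Cplx R).
Implicit Types (Omega K L : set C) (zeta : C) (f g : C -> C) (p q : nat).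

(* The modulus; the norm [`|z|] of a [numClosedFieldType] lives in [C]. *)
Definition cmod (z : C) : R := complex.Re `|z|.

Definition domain Omega := [/\ Omega !=set0, open Omega & connected Omega].

(* Every loop in [Omega] is homotopic in [Omega], with fixed base point, to a
   constant loop. Path-connectedness is left to [domain]. *)
Definition simply_connected Omega :=
  forall c : R -> C,
    {within `[0, 1], continuous c} ->
    (forall s, s \in `[0, 1] -> Omega (c s)) ->
    c 0 = c 1 ->
    exists H : R * R -> C,
      [/\ {within `[0, 1] `*` `[0, 1], continuous H},
          forall s t, s \in `[0, 1] -> t \in `[0, 1] -> Omega (H (s, t)),
          forall s, s \in `[0, 1] -> H (s, 0) = c s /\ H (s, 1) = c 0 &
          forall t, t \in `[0, 1] -> H (0, t) = c 0 /\ H (1, t) = c 0].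

Definition holomorphic_on Omega f := forall z, Omega z -> derivable f z 1.

(* A function on [Omega] is represented by its extension by [0], so that
   distinct elements are distinct functions on [Omega]. As a type,
   [hol_space Omega] carries the topology induced by
   [{family compactly_in Omega, C -> C}]: uniform convergence on the compact
   subsets of [Omega]. *)
Definition hol_space Omega : set {family compactly_in Omega, C -> C} :=
  [set f | holomorphic_on Omega f /\ forall z, ~ Omega z -> f z = 0].


Definition taylor_coef f zeta (v : int) : C :=
  match v with
  | Posz n => derive1n n f zeta / n`!%:R
  | Negz _ => 0
  end.

(* Rows and columns are numbered from 0, hence the shift in the index
   compared with [a_(p - q + i + j - 1)] for [i, j] in [1 .. q]. *)
Definition hankel f zeta p q : 'M[C]_q :=
  \matrix_(i < q, j < q)
    taylor_coef f zeta (p%:Z - q%:Z + (i : nat)%:Z + (j : nat)%:Z + 1).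

Definition pade_regular p q zeta f : Prop := \det (hankel f zeta p q) != 0.

Definition is_pade f zeta p q (AB : {poly C} * {poly C}) : Prop :=
  [/\ (size AB.1 <= p.+1)%N, (size AB.2 <= q.+1)%N, AB.2.[zeta] = 1 &
      forall v : nat, (v <= p + q)%N ->
        taylor_coef (fun z => AB.1.[z] / AB.2.[z]) zeta v
        = taylor_coef f zeta v].

(* Meaningful when [pade_regular p q zeta f], where [is_pade] has exactly one
   solution. *)
Definition pade f zeta p q : {poly C} * {poly C} :=
  xget (0, 1) [set AB | is_pade f zeta p q AB].

(* [sup_K |A/B - g|] in [[0, +oo]]; [0] is added so that the supremum over the
   empty set is [0] and not [-oo]. The zeros of [B] are the poles of [A/B] when
   [A] and [B] are coprime, which uniqueness forces on [pade f zeta p q]: a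
   common linear factor could be replaced by another one. *)
Definition sup_dist K (AB : {poly C} * {poly C}) g : \bar R :=
  ereal_sup (0%E |`
    [set (if root AB.2 z then +oo%E
          else (cmod (AB.1.[z] / AB.2.[z] - g z))%:E) | z in K]).

Definition pade_universal (F : set (nat * nat)) Omega zeta f :=
  forall (h : {poly C}) K,
    compact K -> K `<=` ~` Omega -> connected (~` K) ->
    exists p q : nat -> nat,
      [/\ forall n, F (p n, q n),
          forall n, pade_regular (p n) (q n) zeta f,
          sup_dist K (pade f zeta (p n) (q n)) (fun z => h.[z])
            @[n --> \oo] --> 0%E &
          forall L, compact L -> L `<=` Omega ->
            sup_dist L (pade f zeta (p n) (q n)) f @[n --> \oo] --> 0%E].

End Defs.

Arguments hol_space {R} Omega.

(* Main.v *)
(** A polynomial [P] approximates a holomorphic function [f] on a compact subset [L] of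
    [Omega] and a polynomial [h] on a compact set [K] off [Omega] at the same time, by
    Runge's theorem: for [a] off [Omega] the function [z - a] has a logarithm on
    [Omega], so the holes of [L] can be filled inside [Omega], and then [K `|` L] does
    not separate the plane.  For [p >= deg P] and small [e] the fraction
    [P / (1 - e (z - zeta)^q)] is irreducible of exact denominator degree [q], hence
    it is the regular [p/q] Pade approximant of a polynomial close to [P].  So the
    functions having a Pade approximant with index in [F] close to [h] on [K] and to
    the function itself on [L] are dense; they form an open set because Pade
    approximants depend continuously on finitely many Taylor coefficients.  Countably
    many triples [(K, h, L)] suffice, and Baire's argument concludes. *)

(* The main obstacle is regularity. A polynomial [P] of degree below [p] has a vanishing [p, q]
   Hankel determinant for every [q > 0], and the hypothesis on [F] gives no control of [q]; hence a
   denominator of exact degree [q], prime to [P], has to be created by a perturbation. The resulting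
   fraction need not be holomorphic on [Omega], but its Pade approximant depends only on the Taylor
   coefficients up to order [p + q], so a polynomial with the same jet replaces it. The topology of
   the plane enters only through continuous logarithms of [z - a] on a compact set [Z]: one exists
   when [a] lies off [Z] and the complement of [Z] is connected, and none exists when [a] lies in a
   bounded component of that complement. Logarithms on two disjoint compact sets glue, which settles
   the union; a null homotopy makes the logarithm along paths in [Omega] single-valued, which
   settles the holes. Complex analysis is done on rectangles, where all integrals run along
   segments, and of [2 pi i] it needs only that it is nonzero. *)
Require Import Defs.
From mathcomp Require Import all_boot all_order all_algebra.
From mathcomp Require Import complex.
From mathcomp Require Import all_classical all_reals all_analysis.
From mathcomp Require Import borel_hierarchy.
From mathcomp Require Import ring lra.

Set Implicit Arguments.
Unset Strict Implicit.
Unset Printing Implicit Defensive.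

Import Order.TTheory GRing.Theory Num.Theory.
Import numFieldNormedType.Exports.

Local Open Scope classical_set_scope.
Local Open Scope ring_scope.

(** * The complex plane with a real-valued modulus *)

Section ComplexPlane.
Variable R : realType.
Local Notation C := (Cplx R).
Local Notation Re := (@complex.Re R).
Local Notation Im := (@complex.Im R).
Implicit Types (z w a b : C) (x y r e : R).

Definition mkC x y : C := (x +i* y)%C.

Lemma mkC_eta z : mkC (Re z) (Im z) = z.
Proof. by case: z. Qed.

Lemma eq_ReIm z w : Re z = Re w -> Im z = Im w -> z = w.
Proof. by case: z w => [? ?] [? ?] /= -> ->. Qed.

Lemma ReD z w : Re (z + w) = Re z + Re w. Proof. by case: z w => [? ?] []. Qed.
Lemma ImD z w : Im (z + w) = Im z + Im w. Proof. by case: z w => [? ?] []. Qed.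
Lemma ReN z : Re (- z) = - Re z. Proof. by case: z. Qed.
Lemma ImN z : Im (- z) = - Im z. Proof. by case: z. Qed.
Lemma ReM z w : Re (z * w) = Re z * Re w - Im z * Im w.
Proof. by case: z w => [? ?] []. Qed.
Lemma ImM z w : Im (z * w) = Re z * Im w + Im z * Re w.
Proof. by case: z w => [? ?] []. Qed.
Lemma Re0 : Re (0 : C) = 0. Proof. by []. Qed.
Lemma Im0 : Im (0 : C) = 0. Proof. by []. Qed.
Lemma Re1 : Re (1 : C) = 1. Proof. by []. Qed.
Lemma Im1 : Im (1 : C) = 0. Proof. by []. Qed.
Lemma Re_mkC x y : Re (mkC x y) = x. Proof. by []. Qed.
Lemma Im_mkC x y : Im (mkC x y) = y. Proof. by []. Qed.
Definition ReImE := (ReD, ImD, ReN, ImN, ReM, ImM, Re0, Im0, Re1, Im1, Re_mkC, Im_mkC).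

Lemma cmod_normc z : cmod z = Normc.normc z.
Proof. by case: z => x y; rewrite /cmod normc_def. Qed.

Lemma normC_cmod z : `|z| = mkC (cmod z) 0.
Proof. by rewrite /cmod normc_def. Qed.

Lemma cmodE z : cmod z = Num.sqrt (Re z ^+ 2 + Im z ^+ 2).
Proof. by rewrite cmod_normc; case: z. Qed.

Lemma cmod_sqr z : cmod z ^+ 2 = Re z ^+ 2 + Im z ^+ 2.
Proof. by rewrite cmodE sqr_sqrtr// addr_ge0// sqr_ge0. Qed.

Lemma ltC_mkC x y : (mkC x 0 < mkC y 0) = (x < y).
Proof. by rewrite ltcE /= eqxx. Qed.
Lemma mkC00 : mkC 0 0 = 0. Proof. by []. Qed.

Lemma cmod_ge0 z : 0 <= cmod z. Proof. by rewrite cmodE sqrtr_ge0. Qed.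
Lemma cmod0 : cmod (0 : C) = 0. Proof. by rewrite /cmod normr0. Qed.
Lemma cmod1 : cmod (1 : C) = 1. Proof. by rewrite /cmod normr1. Qed.
Lemma cmod_eq0 z : (cmod z == 0) = (z == 0).
Proof.
apply/eqP/eqP => [|->]; last exact: cmod0.
by rewrite cmod_normc => /Normc.eq0_normc.
Qed.
Lemma cmod_gt0 z : (0 < cmod z) = (z != 0).
Proof. by rewrite lt_def cmod_ge0 andbT cmod_eq0. Qed.
Lemma cmodM z w : cmod (z * w) = cmod z * cmod w.
Proof. by rewrite !cmod_normc Normc.normcM. Qed.
Lemma cmodN z : cmod (- z) = cmod z. Proof. by rewrite /cmod normrN. Qed.
Lemma cmodBC z w : cmod (z - w) = cmod (w - z).
Proof. by rewrite /cmod distrC. Qed.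
Lemma cmodD z w : cmod (z + w) <= cmod z + cmod w.
Proof. by have := @ler_normD (Cplx R) (Cplx R) z w; rewrite !normC_cmod lecE /= => /andP[]. Qed.
Lemma cmodB z w : cmod (z - w) <= cmod z + cmod w.
Proof. by rewrite -(cmodN w) cmodD. Qed.
Lemma cmodV z : cmod z^-1 = (cmod z)^-1.
Proof. by rewrite !cmod_normc Normc.normcV. Qed.
Lemma cmodX z n : cmod (z ^+ n) = cmod z ^+ n.
Proof.
by elim: n => [|n IH]; rewrite ?expr0 ?cmod1// !exprS cmodM IH.
Qed.
Lemma cmod_div z w : cmod (z / w) = cmod z / cmod w.
Proof. by rewrite cmodM cmodV. Qed.
Lemma cmod_tri z w a : cmod (z - w) <= cmod (z - a) + cmod (a - w).
Proof. by rewrite -[z - w](subrKA a); exact: cmodD. Qed.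
Lemma cmod_ler_sub z w : cmod z - cmod w <= cmod (z - w).
Proof. by rewrite lerBlDr -{1}(subrK w z) cmodD. Qed.
Lemma cmod_sum I (s : seq I) (P : pred I) (F : I -> C) :
  cmod (\sum_(i <- s | P i) F i) <= \sum_(i <- s | P i) cmod (F i).
Proof.
apply: (big_ind2 (fun (z : C) (r : R) => cmod z <= r)) => //; first by rewrite cmod0.
by move=> ? ? ? ? h1 h2; apply: le_trans (cmodD _ _) _; apply: lerD.
Qed.

Lemma Re_le_cmod z : `|Re z| <= cmod z.
Proof.
by rewrite cmodE -sqrtr_sqr ler_wsqrtr// lerDl sqr_ge0.
Qed.
Lemma Im_le_cmod z : `|Im z| <= cmod z.
Proof.
by rewrite cmodE -sqrtr_sqr ler_wsqrtr// lerDr sqr_ge0.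
Qed.
Lemma cmod_mkC0 x : cmod (mkC x 0) = `|x|.
Proof. by rewrite cmodE /= expr0n addr0 sqrtr_sqr. Qed.
Lemma cmod_mk0C y : cmod (mkC 0 y) = `|y|.
Proof. by rewrite cmodE /= expr0n add0r sqrtr_sqr. Qed.
Lemma cmod_le_ReIm z : cmod z <= `|Re z| + `|Im z|.
Proof.
rewrite -{1}(mkC_eta z) (_ : mkC _ _ = mkC (Re z) 0 + mkC 0 (Im z)).
  by apply: le_trans (cmodD _ _) _; rewrite cmod_mkC0 cmod_mk0C.
by apply: eq_ReIm; rewrite !ReImE; rewrite ?addr0 ?add0r.
Qed.
Lemma cmod_nat n : cmod (n%:R : C) = n%:R.
Proof. by rewrite /cmod normr_nat; elim: n => [//|n IH]; rewrite -!natr1 ReD IH. Qed.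

(** Balls of [C] have their radii in [C], but a positive element of [C] is real; this lets every
    later estimate use radii and errors in [R]. *)
Lemma nbhs_cmodP z (A : set C) :
  nbhs z A <-> exists2 e, 0 < e & forall w, cmod (w - z) < e -> A w.
Proof.
split=> [/nbhs_ballP[e /= e0 H]|[e e0 H]].
  have eE : e = mkC (Re e) 0.
    by apply: eq_ReIm => //=; apply/ger0_Im/ltW.
  exists (Re e); first by move: e0; rewrite ltcE => /andP[].
  move=> w wz; apply: H; rewrite -ball_normE /ball_ /= eE.
  by rewrite normC_cmod ltC_mkC cmodBC.
apply/nbhs_ballP; exists (mkC e 0) => /=; first by rewrite -mkC00 ltC_mkC.
move=> w; rewrite -ball_normE /ball_ /= normC_cmod ltC_mkC cmodBC; exact: H.
Qed.

Lemma cvg_cmodP T (F : set_system T) {FF : Filter F} (f : T -> C) (l : C) :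
  f x @[x --> F] --> l <-> forall e, 0 < e -> \forall x \near F, cmod (f x - l) < e.
Proof.
split=> [H e e0|H].
  by apply: (H [set w | cmod (w - l) < e]); apply/nbhs_cmodP; exists e.
by move=> A /nbhs_cmodP[e e0 eA]; apply: filterS (H e e0) => x; exact: eA.
Qed.

Lemma continuous_cmodP (T : topologicalType) (f : T -> C) (t : T) :
  {for t, continuous f} <->
  forall e, 0 < e -> \forall x \near t, cmod (f x - f t) < e.
Proof. exact: (@cvg_cmodP T (nbhs t) _ f (f t)). Qed.

Lemma cont_cmodP (f : C -> C) z :
  {for z, continuous f} <->
  forall e, 0 < e -> exists2 d, 0 < d &
     forall w, cmod (w - z) < d -> cmod (f w - f z) < e.
Proof.
rewrite continuous_cmodP; split=> H e /H => [|[d d0 H']].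
  by move=> /nbhs_cmodP.
by apply/nbhs_cmodP; exists d.
Qed.

Lemma contD (T : topologicalType) (f g : T -> C) t :
  {for t, continuous f} -> {for t, continuous g} -> {for t, continuous (fun u => f u + g u)}.
Proof. by move=> cf cg; apply: (@cvgD _ _ _ (nbhs t)); [exact: cf|exact: cg]. Qed.
Lemma contN (T : topologicalType) (f : T -> C) t :
  {for t, continuous f} -> {for t, continuous (fun u => - f u)}.
Proof. by move=> cf; apply: (@cvgN _ _ _ (nbhs t)); exact: cf. Qed.
Lemma contM (T : topologicalType) (f g : T -> C) t :
  {for t, continuous f} -> {for t, continuous g} -> {for t, continuous (fun u => f u * g u)}.
Proof. by move=> cf cg; apply: (@cvgM _ _ (nbhs t)); [exact: cf|exact: cg]. Qed.
Lemma cont_cst (T : topologicalType) (k : C) (t : T) : {for t, continuous (fun=> k)}.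
Proof. exact: cvg_cst. Qed.
Lemma cont_id (z : C) : {for z, continuous (fun w : C => w)}.
Proof. exact: cvg_id. Qed.
Lemma contV (T : topologicalType) (f : T -> C) t : f t != 0 ->
  {for t, continuous f} -> {for t, continuous (fun u => (f u)^-1)}.
Proof. by move=> f0 cf; apply: (@cvgV _ _ _ _ f); [exact: f0|exact: cf]. Qed.
Lemma contX (T : topologicalType) (f : T -> C) t n :
  {for t, continuous f} -> {for t, continuous (fun u => f u ^+ n)}.
Proof.
move=> cf; elim: n => [|n IH]; first exact: cont_cst.
have -> : (fun u => f u ^+ n.+1) = (fun u => f u * f u ^+ n).
  by apply/funext => u; rewrite exprS.
exact: contM.
Qed.

Lemma openC_cmodP (A : set C) :

  open A <-> forall z, A z -> exists2 e, 0 < e & forall w, cmod (w - z) < e -> A w.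
Proof.
rewrite openE; split=> H z Az; have := H z Az; first by move=> /nbhs_cmodP.
by move=> ?; apply/nbhs_cmodP.
Qed.

Lemma continuous_Re : continuous (Re : C -> R).
Proof.
move=> z; apply/(@cvgrPdist_lt _ _ _ (nbhs z)) => e e0; apply/nbhs_cmodP; exists e => // w wz.
by apply: le_lt_trans wz; rewrite cmodBC -ReN -ReD; exact: Re_le_cmod.
Qed.
Lemma continuous_Im : continuous (Im : C -> R).
Proof.
move=> z; apply/(@cvgrPdist_lt _ _ _ (nbhs z)) => e e0; apply/nbhs_cmodP; exists e => // w wz.
by apply: le_lt_trans wz; rewrite cmodBC -ImN -ImD; exact: Im_le_cmod.
Qed.
Lemma continuous_cmod : continuous (@cmod R).
Proof.
move=> z; apply/(@cvgrPdist_lt _ _ _ (nbhs z)) => e e0; apply/nbhs_cmodP; exists e => // w wz.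
apply: le_lt_trans wz; rewrite ler_norml.
have := cmod_ler_sub w z; have := cmod_ler_sub z w; rewrite (cmodBC z w).
by move=> *; apply/andP; split; lra.
Qed.

Lemma cvg_mkC T (F : set_system T) {FF : Filter F} (f g : T -> R) (a b : R) :
  f x @[x --> F] --> a -> g x @[x --> F] --> b ->
  mkC (f x) (g x) @[x --> F] --> mkC a b.
Proof.
move=> /cvgrPdist_lt fa /cvgrPdist_lt gb; apply/cvg_cmodP => e e0.
have e2 : 0 < e / 2 by rewrite divr_gt0.
near=> x; apply: le_lt_trans (cmod_le_ReIm _) _; rewrite !ReImE (splitr e) ltrD//.
  by rewrite distrC; near: x; exact: fa.
by rewrite distrC; near: x; exact: gb.
Unshelve. all: by end_near. Qed.

Lemma compactC_bounded (A : set C) : compact A ->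
  exists M, forall z, A z -> cmod z <= M.
Proof.
move=> cA; have : compact (@cmod R @` A).
  by apply: continuous_compact cA; apply/continuous_subspaceT/continuous_cmod.
move=> /compact_bounded[M [_ HM]]; exists (M + 1) => z Az.
rewrite -[cmod z]ger0_norm ?cmod_ge0//; apply: (HM (M + 1)); last by exists z.
by rewrite ltrDl.
Qed.

Lemma hausdorffC : hausdorff_space C.
Proof. exact: norm_hausdorff. Qed.

Lemma compactC_closed (A : set C) : compact A -> closed A.
Proof. by apply: compact_closed; exact: hausdorffC. Qed.

Lemma compactC (A : set C) M : closed A -> (forall z, A z -> cmod z <= M) -> compact A.
Proof.
move=> clA AM.
have cI : compact (`[- M, M]%classic : set R) by exact: segment_compact.
have := compact_setX cI cI.
have cf : continuous (fun p : R * R => mkC p.1 p.2).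
  by move=> p; apply: cvg_mkC; [exact: cvg_fst|exact: cvg_snd].
move=> /(continuous_compact (f := fun p : R * R => mkC p.1 p.2)).
move=> /(_ (continuous_subspaceT cf)) cB.
apply: subclosed_compact clA cB _ => z Az.
exists (Re z, Im z); last exact: mkC_eta.
by split=> /=; rewrite in_itv /= -ler_norml; apply: le_trans (AM _ Az);
   [exact: Re_le_cmod|exact: Im_le_cmod].
Qed.

(** If no [d] works, there are pairs at distance below [1 / (n + 1)] for each [n]; a cluster point
    in [A] of their first components is then adherent to [B], hence in both sets. *)
Lemma compact_closed_dist (A B : set C) : compact A -> closed B -> A `&` B = set0 ->
  exists2 d, 0 < d & forall z w, A z -> B w -> d <= cmod (z - w).
Proof.
move=> cA clB AB.
have [[a0 Aa0]|/set0P/negP/negPn/eqP ->] := pselect (A !=set0); last first.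
  by exists 1 => // z w [].
apply: contrapT => /forall2NP H.
have H' n : exists z w, [/\ A z, B w & cmod (z - w) < n.+1%:R^-1].
  have [|nh] := H (n.+1%:R^-1); first by rewrite invr_gt0 ltr0n.
  move/existsNP: nh => [z /existsNP[w]]; rewrite !not_implyE => -[Az [Bw]].
  by move=> /negP; rewrite -ltNge => hlt; exists z, w.
have [f Hf] := choice H'; have {}[g Hg] := choice Hf.
have [z0 [Az0 clz]] : exists z, A z /\ cluster (f @ \oo) z.
  have h : (f @ \oo) A by exists 0 => // n _ /=; case: (Hg n).
  by have [z [Az cz]] := cA (f @ \oo) _ h; exists z.

have : B z0.
  apply: clB => U /nbhs_cmodP[e e0 eU].
  have e2 : 0 < e / 2 by rewrite divr_gt0.
  have [N _ HN] : \forall n \near \oo, n.+1%:R^-1 < e / 2.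
    have /cvgrPdist_lt /(_ _ e2) := @cvg_harmonic R.
    by apply: filterS => n; rewrite sub0r normrN ger0_norm// invr_ge0.
  have fN : (f @ \oo) [set f n | n in [set n | (N <= n)%N]].
    by exists N => // n Nn /=; exists n.
  have zU : nbhs z0 [set w | cmod (w - z0) < e / 2].
    by apply/nbhs_cmodP; exists (e / 2).
  have [z [/= [n Nn <-]]] := clz _ _ fN zU.
  move=> fnz; exists (g n); split; first by case: (Hg n).
  apply: eU; apply: le_lt_trans (cmod_tri _ _ (f n)) _; rewrite (splitr e) ltrD//.
  by rewrite cmodBC; case: (Hg n) => _ _ /lt_trans; apply; exact: HN.
by move=> Bz0; have : (A `&` B) z0 by []; rewrite AB.
Qed.

(** In this form there is no quotient, so [h = 0] is allowed and remainder estimates can be fed in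
    directly. *)
Lemma is_deriveC_cmodP (f : C -> C) z d :
  is_derive z (1 : C) f d <->
  forall e, 0 < e -> exists2 r, 0 < r & forall h, cmod h < r ->
    cmod (f (z + h) - f z - d * h) <= e * cmod h.
Proof.
split=> [[dfz <-] e e0|H].
  have : (fun h => h^-1 *: (f (h *: (1 : C) + z) - f z)) @ (0 : C)^' --> derive f z 1 by [].
  move=> /cvg_cmodP /(_ e e0) /nbhs_cmodP[r r0 Hr]; exists r => // h hr.
  have [->|h0] := eqVneq h 0.
    by rewrite addr0 mulr0 subr0 subrr cmod0 mulr0.
  have := Hr h; rewrite subr0 => /(_ hr h0) /ltW /=.
  rewrite -(ler_pM2r (x := cmod h)) ?cmod_gt0// -cmodM; congr (_ <= _).
  congr cmod; rewrite mulrBl -[LHS](@subrK _ 0) subr0 addr0.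
  congr (_ - _); rewrite /GRing.scale /= mulr1 mulrC mulrA mulfV// mul1r addrC.
  by rewrite (addrC h z) addrC.
have cv : (fun h => h^-1 *: (f (h *: (1 : C) + z) - f z)) @ (0 : C)^' --> d.
  apply/cvg_cmodP => e e0; have e2 : 0 < e / 2 by rewrite divr_gt0.
  have [r r0 Hr] := H _ e2; apply/nbhs_cmodP; exists r => // h.
  rewrite subr0 => hr h0; have {}Hr := Hr h hr.
  have h0' : 0 < cmod h by rewrite cmod_gt0.
  rewrite -(ltr_pM2r h0') -cmodM /=.
  apply: (@le_lt_trans _ _ (e / 2 * cmod h)); last first.
    by rewrite ltr_pM2r// ltr_pdivrMr// ltr_pMr// ltr1n.
  apply: le_trans Hr; rewrite le_eqVlt; apply/orP; left; apply/eqP; congr cmod.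
  rewrite mulrBl; congr (_ - _); rewrite /GRing.scale /= mulr1 mulrC mulrA mulfV//.
  by rewrite mul1r (addrC h z).
by split; [apply/cvg_ex; exists d|exact: cvg_lim].
Qed.

Lemma is_deriveC_cont (f : C -> C) z d : is_derive z (1 : C) f d -> {for z, continuous f}.
Proof.
by move=> [df _]; apply: differentiable_continuous; apply/derivable1_diffP.
Qed.

Lemma derivable_cont (f : C -> C) z : derivable f z 1 -> {for z, continuous f}.
Proof. by move=> df; apply: (@is_deriveC_cont _ _ (derive f z 1)); exact: derivableP. Qed.

Lemma is_deriveC_ext (f g : C -> C) z d :
  (\forall w \near z, f w = g w) -> is_derive z (1 : C) f d -> is_derive z (1 : C) g d.
Proof.
move=> /nbhs_cmodP[r r0 fg] /is_deriveC_cmodP H; apply/is_deriveC_cmodP => e e0.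
have [s s0 Hs] := H e e0; exists (Num.min r s); first by rewrite lt_min r0.
move=> h; rewrite lt_min => /andP[hr hs].
by rewrite -!fg ?subrr ?cmod0// ?(addrC z) ?addrK//; have := Hs h hs; rewrite addrC.
Qed.

End ComplexPlane.

(** An inverse produces the goal that its argument does not vanish. Leaf functions are looked up
    among the continuity hypotheses of the context, which is why proofs introduce these before the
    call. *)
Ltac ccont := lazymatch goal with
  | |- context [continuous ?F] => lazymatch F with
    | fun _ => ?c => exact: cont_cst
    | fun u => u => exact: cont_id
    | fun u => @?A u + @?B u => apply: (@contD _ _ A B); ccont
    | fun u => @?A u * @?B u => apply: (@contM _ _ A B); ccont
    | fun u => - @?A u => apply: (@contN _ _ A); ccont
    | fun u => (@?A u)^-1 => apply: (@contV _ _ A); [|ccont]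
    | fun u => @?A u ^+ ?n => apply: (@contX _ _ A); ccont
    | fun u => ?f u => try match goal with H : context [continuous f] |- _ => exact: H end
    | ?f => try match goal with H : context [continuous f] |- _ => exact: H end
    end
  end.

(** * Integrals of real and complex functions over a segment *)

Section Integration.
Variable R : realType.
Local Notation C := (Cplx R).
Local Notation Re := (@complex.Re R).
Local Notation Im := (@complex.Im R).
Local Notation mu := (@lebesgue_measure R).
Implicit Types (z w : C) (a b c d x y t r e M : R).

Definition rint a b (g : R -> R) : R := \int[mu]_(t in `[a, b]) g t.

(** Two-sided continuity at every point, endpoints included, rather than continuity within the
    interval: compositions and restrictions to subintervals then need no subspace topology. *)
Definition cont_on (V : topologicalType) a b (g : R -> V) :=
  forall t, a <= t <= b -> {for t, continuous g}.

Lemma cont_on_within a b (g : R -> R) : cont_on a b g -> {within `[a, b], continuous g}.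
Proof.
by move=> H; apply: continuous_in_subspaceT => t; rewrite inE /= in_itv; exact: H.
Qed.

Lemma cont_on_integrable a b (g : R -> R) : cont_on a b g ->
  mu.-integrable `[a, b] (EFin \o g).
Proof.
move=> /cont_on_within; apply: continuous_compact_integrable; exact: segment_compact.
Qed.

Lemma rintD a b (g h : R -> R) : cont_on a b g -> cont_on a b h ->
  rint a b (fun t => g t + h t) = rint a b g + rint a b h.
Proof. by move=> cg ch; apply: RintegralD => //; exact: cont_on_integrable. Qed.

Lemma rintZ a b k (g : R -> R) : cont_on a b g ->
  rint a b (fun t => k * g t) = k * rint a b g.
Proof. by move=> cg; apply: RintegralZl => //; exact: cont_on_integrable. Qed.

Lemma rint_ext a b (g h : R -> R) : (forall t, a <= t <= b -> g t = h t) ->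
  rint a b g = rint a b h.
Proof.
by move=> gh; apply: eq_Rintegral => t; rewrite inE /= in_itv; exact: gh.
Qed.

Lemma rint_cst a b k : a <= b -> rint a b (fun=> k) = k * (b - a).
Proof.
move=> ab; rewrite /rint Rintegral_cst//=; congr (_ * _).
rewrite (lebesgue_measure_itv (Interval (BLeft a) (BRight b))) /= lte_fin.
by have [_|ba] := ltP a b; [|rewrite (@le_anti _ _ a b) ?ab ?subrr].
Qed.

Lemma rint_le a b (g h : R -> R) : cont_on a b g -> cont_on a b h ->
  (forall t, a <= t <= b -> g t <= h t) -> rint a b g <= rint a b h.
Proof.
move=> cg ch gh; apply: le_Rintegral.
- exact: measurable_itv.
- exact: cont_on_integrable.
- exact: cont_on_integrable.
- by move=> t; rewrite /= in_itv; exact: gh.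
Qed.

Lemma rint_gt0 a b (g : R -> R) : a < b -> cont_on a b g ->
  (forall t, a <= t <= b -> 0 < g t) -> 0 < rint a b g.
Proof.
move=> ab cg g0.
have [c cab gc] : exists2 c, c \in `[a, b] & forall t, t \in `[a, b] -> g c <= g t.
  by apply: EVT_min; [exact: ltW|exact: cont_on_within].
have gc0 : 0 < g c by apply: g0; move: cab; rewrite in_itv.
apply: (@lt_le_trans _ _ (g c * (b - a))); first by rewrite mulr_gt0// subr_gt0.
rewrite -rint_cst; last exact: ltW.
apply: rint_le => [? _||t tab]; [exact: cvg_cst|exact: cg|].
by apply: gc; rewrite in_itv.
Qed.

Lemma rint_bound a b M (g : R -> R) : a <= b -> cont_on a b g ->
  (forall t, a <= t <= b -> `|g t| <= M) -> `|rint a b g| <= M * (b - a).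
Proof.
move=> ab cg gM; rewrite ler_norml -mulNr -!rint_cst//.
have gM' t : a <= t <= b -> - M <= g t <= M by move=> /gM; rewrite ler_norml.
apply/andP; split; apply: rint_le.
- by move=> ? _; exact: cvg_cst.
- exact: cg.
- by move=> t /gM' /andP[].
- exact: cg.
- by move=> ? _; exact: cvg_cst.
- by move=> t /gM' /andP[].
Qed.

Lemma rint_split a b c (g : R -> R) : a <= c -> c <= b -> cont_on a b g ->
  rint a b g = rint a c g + rint c b g.
Proof.
move=> ac cb cg; rewrite /rint.
have ig := cont_on_integrable cg.
have := @Rintegral_itvB _ g (BLeft a) (BRight b) c ig; rewrite !bnd_simp => /(_ ac cb).
move=> /(canRL (subrK _)) ->; rewrite addrC; congr (_ + _).
rewrite Rintegral_itv_obnd_cbnd//; apply: integrableS ig => //.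
by move=> t /=; rewrite !in_itv /= => /andP[ct ->]; rewrite (le_trans ac)// ltW.
Qed.

Lemma rint_FTC a b (G g : R -> R) : a <= b -> cont_on a b g ->
  (forall t, a <= t <= b -> is_derive t 1 G (g t)) -> rint a b g = G b - G a.
Proof.
rewrite le_eqVlt => /predU1P[<- cg dG|ab cg dG].
  by rewrite subrr /rint set_itv1 Rintegral_set1.
have cG t : a <= t <= b -> {for t, continuous G}.
  move=> /dG[dGt _]; apply: differentiable_continuous; exact/derivable1_diffP.
rewrite /rint /Rintegral (@continuous_FTC2 _ g G)//.
- exact: cont_on_within.
- split.
  + move=> t; rewrite in_itv /= => /andP[at_ tb].
    by have [] := dG t; [rewrite !ltW|].
  + by apply: cvg_at_right_filter; apply: cG; rewrite lexx ltW.
  + by apply: cvg_at_left_filter; apply: cG; rewrite lexx ltW.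
- move=> t; rewrite in_itv /= => /andP[at_ tb].
  have tab : a <= t <= b by rewrite !ltW.
  by rewrite derive1E; have [_ ->] := dG t tab.
Qed.

Definition cint a b (g : R -> C) : C := mkC (rint a b (Re \o g)) (rint a b (Im \o g)).

Lemma cont_on_Re a b (g : R -> C) : cont_on a b g -> cont_on a b (Re \o g).
Proof. by move=> cg t tab; apply: continuous_comp; [exact: cg|exact: continuous_Re]. Qed.
Lemma cont_on_Im a b (g : R -> C) : cont_on a b g -> cont_on a b (Im \o g).
Proof. by move=> cg t tab; apply: continuous_comp; [exact: cg|exact: continuous_Im]. Qed.
Lemma cont_onD a b (g h : R -> C) : cont_on a b g -> cont_on a b h ->
  cont_on a b (fun t => g t + h t).
Proof. by move=> cg ch t tab; apply: (@cvgD _ _ _ (nbhs t)); [exact: cg|exact: ch]. Qed.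
Lemma cont_onM a b (g h : R -> C) : cont_on a b g -> cont_on a b h ->
  cont_on a b (fun t => g t * h t).
Proof. by move=> cg ch t tab; apply: (@cvgM _ _ (nbhs t)); [exact: cg|exact: ch]. Qed.
Lemma cont_onZ a b k (g : R -> C) : cont_on a b g -> cont_on a b (fun t => k * g t).
Proof. by move=> cg t tab; apply: (@cvgM _ _ (nbhs t)); [exact: cvg_cst|exact: cg]. Qed.

Lemma cont_on_scale a b k (g : R -> R) : cont_on a b g -> cont_on a b (fun t => k * g t).
Proof. by move=> cg t tab; apply: (@cvgM _ _ (nbhs t)); [exact: cvg_cst|exact: cg]. Qed.

Lemma cintD a b (g h : R -> C) : cont_on a b g -> cont_on a b h ->
  cint a b (fun t => g t + h t) = cint a b g + cint a b h.
Proof.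
move=> cg ch; apply: eq_ReIm; rewrite !ReImE.
  rewrite -rintD; try exact: cont_on_Re.
  by apply: rint_ext => t _ /=; rewrite ReD.
rewrite -rintD; try exact: cont_on_Im.
by apply: rint_ext => t _ /=; rewrite ImD.
Qed.

Lemma cintZ a b k (g : R -> C) : cont_on a b g ->
  cint a b (fun t => k * g t) = k * cint a b g.
Proof.
move=> cg; have cR := cont_on_Re cg; have cI := cont_on_Im cg.
apply: eq_ReIm; rewrite !ReImE.
  rewrite -rintZ// -mulNr -rintZ// -rintD; try exact: cont_on_scale.
  by apply: rint_ext => t _ /=; rewrite ReM mulNr.
rewrite -rintZ// -rintZ// -rintD; try exact: cont_on_scale.
by apply: rint_ext => t _ /=; rewrite ImM.
Qed.

Lemma cint_ext a b (g h : R -> C) : (forall t, a <= t <= b -> g t = h t) ->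
  cint a b g = cint a b h.
Proof.
by move=> gh; congr mkC; apply: rint_ext => t /gh /= ->.
Qed.

(** The factor 2 is the price of bounding real and imaginary parts separately; no later argument
    depends on a sharp constant. *)
Lemma cint_bound a b M (g : R -> C) : a <= b -> cont_on a b g ->
  (forall t, a <= t <= b -> cmod (g t) <= M) -> cmod (cint a b g) <= 2 * M * (b - a).
Proof.
move=> ab cg gM; apply: le_trans (cmod_le_ReIm _) _; rewrite !ReImE mulrAC mulr_natl mulr2n mulrDl.
rewrite !(mulrC _ M); apply: lerD; apply: rint_bound => //.
- exact: cont_on_Re.
- by move=> t tab; apply: le_trans (gM t tab); exact: Re_le_cmod.
- exact: cont_on_Im.
- by move=> t tab; apply: le_trans (gM t tab); exact: Im_le_cmod.
Qed.

Lemma cint_split a b c (g : R -> C) : a <= c -> c <= b -> cont_on a b g ->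
  cint a b g = cint a c g + cint c b g.
Proof.
move=> ac cb cg; apply: eq_ReIm; rewrite !ReImE; apply: rint_split => //.
  exact: cont_on_Re.
exact: cont_on_Im.
Qed.

Lemma is_deriveR_P (g : R -> R) t d :
  (forall e, 0 < e -> exists2 r, 0 < r & forall h, `|h| < r ->
    `|g (t + h) - g t - d * h| <= e * `|h|) -> is_derive t (1 : R) g d.
Proof.
move=> H.
have cv : (fun h => h^-1 *: (g (h *: (1 : R) + t) - g t)) @ (0 : R)^' --> d.
  apply/cvgrPdist_le => e e0.
  have [r r0 Hr] := H _ e0; apply/nbhs_ballP; exists r => // h.
  rewrite /ball /= sub0r normrN => hr h0; have {}Hr := Hr h hr.
  have h0' : 0 < `|h| by rewrite normr_gt0.
  rewrite -(ler_pM2r h0') -normrM; apply: le_trans Hr.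
  rewrite le_eqVlt distrC; apply/orP; left; apply/eqP; congr `|_|.
  rewrite mulrBl; congr (_ - _); rewrite /GRing.scale /= mulr1 mulrC mulrA mulfV//.
  by rewrite mul1r (addrC h t).
by split; [apply/cvg_ex; exists d|exact: cvg_lim].
Qed.

Lemma is_derive_Re (F : C -> C) z (k d : C) t : is_derive z (1 : C) F d ->
  is_derive t 1 (fun s => Re (F (z + k * mkC (s - t) 0))) (Re (k * d)).
Proof.
move=> /is_deriveC_cmodP dF; apply: is_deriveR_P => e e0.
have k0 : 0 < cmod k + 1 by rewrite ltr_wpDl// cmod_ge0.
have e1 : 0 < e / (cmod k + 1) by rewrite divr_gt0.
have [r r0 Hr] := dF _ e1; exists (r / (cmod k + 1)); first by rewrite divr_gt0.
move=> h; rewrite ltr_pdivlMr// => hr.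
have hk : cmod (k * mkC h 0) <= `|h| * (cmod k + 1).
  by rewrite cmodM cmod_mkC0 mulrC ler_wpM2l// lerDl.
have := Hr (k * mkC h 0) (le_lt_trans hk hr).
rewrite (addrC t) addrK subrr mulr0 addr0 => H.
have -> : Re (F (z + k * mkC h 0)) - Re (F z) - Re (k * d) * h =
    Re (F (z + k * mkC h 0) - F z - d * (k * mkC h 0)).
  by rewrite !ReImE; ring.
apply: le_trans (Re_le_cmod _) _; apply: le_trans H _.
apply: (@le_trans _ _ (e / (cmod k + 1) * (`|h| * (cmod k + 1)))).
  by rewrite ler_wpM2l// ltW.
by rewrite (mulrC `|h|) mulrA divfK// gt_eqF.
Qed.

(** The direction [k] is [1] for horizontal edges and [i] for vertical ones. *)
Lemma cint_FTC a b z (k : C) (F f : C -> C) :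
 a <= b ->
  cont_on a b (fun t => f (z + k * mkC t 0)) ->
  (forall t, a <= t <= b -> is_derive (z + k * mkC t 0) (1 : C) F (f (z + k * mkC t 0))) ->
  k * cint a b (fun t => f (z + k * mkC t 0)) = F (z + k * mkC b 0) - F (z + k * mkC a 0).
Proof.
move=> ab cf dF; rewrite -cintZ//.
have eqt s t : z + k * mkC t 0 + k * mkC (s - t) 0 = z + k * mkC s 0.
  by rewrite -addrA -mulrDr; congr (_ + _ * _); apply: eq_ReIm; rewrite !ReImE; ring.
apply: eq_ReIm; rewrite [LHS]/= !ReImE.
  apply: (@rint_FTC a b (fun s => Re (F (z + k * mkC s 0)))) => //.
    by apply: cont_on_Re; exact: cont_onZ.
  move=> t /dF /(@is_derive_Re _ _ k _ t); rewrite /=.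
  by under eq_fun do rewrite eqt.
apply: (@rint_FTC a b (fun s => Im (F (z + k * mkC s 0)))) => //.
  by apply: cont_on_Im; exact: cont_onZ.
move=> t /dF dFt.
(* The imaginary part of [F] is the real part of [- i F], so [is_derive_Re] serves again. *)
have dF' : is_derive (z + k * mkC t 0) (1 : C) (fun w => mkC 0 (-1) * F w)
    (mkC 0 (-1) * f (z + k * mkC t 0)).
  by have := is_deriveZ (mkC 0 (-1)) dFt.
have := @is_derive_Re _ _ k _ t dF'; rewrite /=.
under eq_fun do rewrite eqt ReM /= mul0r mulN1r sub0r opprK.
by rewrite mulrCA ReM /= mul0r mulN1r sub0r opprK.
Qed.

End Integration.

(** * Boundary integrals of rectangles and Goursat's theorem *)

Section Rectangles.
Variable R : realType.
Local Notation C := (Cplx R).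
Local Notation Re := (@complex.Re R).
Local Notation Im := (@complex.Im R).
Implicit Types (z w : C) (a b c d x y t r e M : R) (f g : C -> C).

Definition hint y a b f : C := cint a b (fun t => f (mkC t y)).
Definition vint x c d f : C := mkC 0 1 * cint c d (fun t => f (mkC x t)).

Definition onR a b c d : set C := [set w | a <= Re w <= b /\ c <= Im w <= d].
Definition inR a b c d : set C := [set w | a < Re w < b /\ c < Im w < d].
Definition bdR a b c d : set C :=
  [set w | onR a b c d w /\ [\/ Re w = a, Re w = b, Im w = c | Im w = d]].

(** The contour integral of [f] along the boundary, counterclockwise. *)
Definition rect a b c d f : C :=
  hint c a b f + vint b c d f - hint d a b f - vint a c d f.

Definition cont_at (A : set C) f := forall w, A w -> {for w, continuous f}.

Lemma hline y t : mkC t y = mkC 0 y + 1 * mkC t 0 :> C.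
Proof. by apply: eq_ReIm; rewrite !ReImE; ring. Qed.
Lemma vline x t : mkC x t = mkC x 0 + mkC 0 1 * mkC t 0 :> C.
Proof. by apply: eq_ReIm; rewrite !ReImE; ring. Qed.

Lemma cont_hline y : continuous (fun t : R => mkC t y : C).
Proof. by move=> t; apply: (@cvg_mkC _ _ (nbhs t)); [exact: cvg_id|exact: cvg_cst]. Qed.
Lemma cont_vline x : continuous (fun t : R => mkC x t : C).
Proof. by move=> t; apply: (@cvg_mkC _ _ (nbhs t)); [exact: cvg_cst|exact: cvg_id]. Qed.

Lemma cont_on_hline y a b f :
  (forall t, a <= t <= b -> {for mkC t y, continuous f}) ->
  cont_on a b (fun t => f (mkC t y)).
Proof.
by move=> cf t tab; apply: (@continuous_comp _ _ _ (fun t => mkC t y) f);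
   [exact: cont_hline|exact: cf].
Qed.
Lemma cont_on_vline x c d f :
  (forall t, c <= t <= d -> {for mkC x t, continuous f}) ->
  cont_on c d (fun t => f (mkC x t)).
Proof.
by move=> cf t tab; apply: (@continuous_comp _ _ _ (fun t => mkC x t) f);
   [exact: cont_vline|exact: cf].
Qed.

Section one_rectangle.
Variables (a b c d : R).
Hypotheses (ab : a <= b) (cd : c <= d).

Lemma bdRP (P : C -> Prop) : (forall w, bdR a b c d w -> P w) ->
  [/\ forall t, a <= t <= b -> P (mkC t c), forall t, c <= t <= d -> P (mkC b t),
      forall t, a <= t <= b -> P (mkC t d) & forall t, c <= t <= d -> P (mkC a t)].
Proof.
move=> H; split=> t tab; apply: H; (split; first by split=> //=; rewrite ?lexx ?ab ?cd).
- exact: Or43.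
- exact: Or42.
- exact: Or44.
- exact: Or41.
Qed.

Lemma cont_at_edges f : cont_at (bdR a b c d) f ->
  [/\ cont_on a b (fun t => f (mkC t c)), cont_on c d (fun t => f (mkC b t)),
      cont_on a b (fun t => f (mkC t d)) & cont_on c d (fun t => f (mkC a t))].
Proof.
by move=> /bdRP[h1 h2 h3 h4]; split; [exact: cont_on_hline|exact: cont_on_vline|
  exact: cont_on_hline|exact: cont_on_vline].
Qed.

Lemma rectD f g : cont_at (bdR a b c d) f -> cont_at (bdR a b c d) g ->
  rect a b c d (fun w => f w + g w) = rect a b c d f + rect a b c d g.
Proof.
move=> /cont_at_edges[f1 f2 f3 f4] /cont_at_edges[g1 g2 g3 g4].
by rewrite /rect /hint /vint !cintD//; ring.
Qed.

Lemma rectZ k f : cont_at (bdR a b c d) f ->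
  rect a b c d (fun w => k * f w) = k * rect a b c d f.
Proof.
move=> /cont_at_edges[f1 f2 f3 f4].
by rewrite /rect /hint /vint !cintZ//; ring.
Qed.

Lemma rect_ext f g : (forall w, bdR a b c d w -> f w = g w) ->
  rect a b c d f = rect a b c d g.
Proof.
move=> /(@bdRP (fun w => f w = g w))[h1 h2 h3 h4].
by rewrite /rect /hint /vint (cint_ext h1) (cint_ext h2) (cint_ext h3) (cint_ext h4).
Qed.

Lemma rect_bound M f : cont_at (bdR a b c d) f ->
  (forall w, bdR a b c d w -> cmod (f w) <= M) ->
  cmod (rect a b c d f) <= 4 * M * ((b - a) + (d - c)).
Proof.
move=> /cont_at_edges[f1 f2 f3 f4] /(@bdRP (fun w => cmod (f w) <= M))[h1 h2 h3 h4].
have H1 := cint_bound ab f1 h1; have H2 := cint_bound cd f2 h2.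
have H3 := cint_bound ab f3 h3; have H4 := cint_bound cd f4 h4.
have ci : cmod (mkC 0 1 : C) = 1 by rewrite cmod_mk0C normr1.
apply: le_trans (cmodB _ _) _; apply: le_trans (lerD (cmodB _ _) (lexx _)) _.
apply: le_trans (lerD (lerD (cmodD _ _) (lexx _)) (lexx _)) _.
rewrite /hint /vint !cmodM ci !mul1r.
lra.
Qed.

Lemma rect_splitX m f : a <= m -> m <= b -> cont_at (bdR a b c d) f ->
  rect a b c d f = rect a m c d f + rect m b c d f.
Proof.
move=> am mb /cont_at_edges[f1 f2 f3 f4].
by rewrite /rect /hint (cint_split am mb f1) (cint_split am mb f3); ring.
Qed.

Lemma rect_splitY m f : c <= m -> m <= d -> cont_at (bdR a b c d) f ->
  rect a b c d f = rect a b c m f + rect a b m d f.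
Proof.
move=> am mb /cont_at_edges[f1 f2 f3 f4].
by rewrite /rect /vint (cint_split am mb f2) (cint_split am mb f4); ring.
Qed.

Lemma rect_FTC (F f : C -> C) : cont_at (bdR a b c d) f ->
  (forall w, bdR a b c d w -> is_derive w (1 : C) F (f w)) -> rect a b c d f = 0.
Proof.
move=> /cont_at_edges[f1 f2 f3 f4] /(@bdRP (fun w => is_derive w 1 F (f w)))[h1 h2 h3 h4].
have hE y : (forall t, a <= t <= b -> is_derive (mkC t y : C) 1 F (f (mkC t y))) ->
    cont_on a b (fun t => f (mkC t y)) -> hint y a b f = F (mkC b y) - F (mkC a y).
  rewrite /hint => h fc; rewrite -[cint _ _ _]mul1r.
  have := @cint_FTC _ a b (mkC 0 y) 1 F f ab; rewrite -!hline.
  by under [X in _ -> _ -> _ * cint _ _ X = _]eq_fun do rewrite -hline; apply;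
    [under eq_fun do rewrite -hline|move=> t; rewrite -hline; exact: h].
have vE x : (forall t, c <= t <= d -> is_derive (mkC x t : C) 1 F (f (mkC x t))) ->
    cont_on c d (fun t => f (mkC x t)) -> vint x c d f = F (mkC x d) - F (mkC x c).
  rewrite /vint => h fc.
  have := @cint_FTC _ c d (mkC x 0) (mkC 0 1) F f cd; rewrite -!vline.
  by under [X in _ -> _ -> _ * cint _ _ X = _]eq_fun do rewrite -vline; apply;
    [under eq_fun do rewrite -vline|move=> t; rewrite -vline; exact: h].
by rewrite /rect !hE// !vE//; ring.
Qed.

End one_rectangle.

Lemma bdR_on a b c d w : bdR a b c d w -> onR a b c d w. Proof. by case. Qed.

Lemma onRS a b c d a' b' c' d' : a <= a' -> b' <= b -> c <= c' -> d' <= d ->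
  onR a' b' c' d' `<=` onR a b c d.
Proof.
move=> h1 h2 h3 h4 w [/andP[? ?] /andP[? ?]]; split; apply/andP; split; lra.
Qed.

Definition holo_on (A : set C) f := forall w, A w -> derivable f w 1.

Lemma holo_cont A f : holo_on A f -> cont_at A f.
Proof. by move=> hf w /hf /derivable_cont. Qed.

Lemma cont_atS A B f : A `<=` B -> cont_at B f -> cont_at A f.
Proof. by move=> AB h w /AB /h. Qed.

(** The integral is the sum of those over the four quarters, so one of them has at least a quarter
    of the modulus. The tuple [q] lists the left, right, lower and upper sides of that quarter. *)
Lemma rect_quarter a b c d f : a <= b -> c <= d -> cont_at (onR a b c d) f ->
  exists q : R * R * R * R,
    [/\ a <= q.1.1.1, q.1.1.2 <= b, c <= q.1.2 & q.2 <= d] /\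
    [/\ q.1.1.2 - q.1.1.1 = (b - a) / 2, q.2 - q.1.2 = (d - c) / 2 &
    cmod (rect a b c d f) / 4 <= cmod (rect q.1.1.1 q.1.1.2 q.1.2 q.2 f)].
Proof.
move=> ab cd cf.
pose m := (a + b) / 2; pose n := (c + d) / 2.
have am : a <= m by rewrite /m; lra.
have mb : m <= b by rewrite /m; lra.
have cn : c <= n by rewrite /n; lra.
have nd : n <= d by rewrite /n; lra.
have sub a' b' c' d' : a <= a' -> b' <= b -> c <= c' -> d' <= d ->
    cont_at (bdR a' b' c' d') f.
  move=> h1 h2 h3 h4; apply: cont_atS cf => w /bdR_on; exact: onRS.
have -> : rect a b c d f = (rect a m c n f + rect a m n d f) +
    (rect m b c n f + rect m b n d f).
  rewrite (@rect_splitX a b c d ab cd m)//; last exact: sub.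
  by rewrite (@rect_splitY a m c d _ _ n)// ?(@rect_splitY m b c d _ _ n)//; exact: sub.
apply: contrapT => H.
have {}H q : [/\ a <= q.1.1.1, q.1.1.2 <= b, c <= q.1.2 & q.2 <= d] ->
    q.1.1.2 - q.1.1.1 = (b - a) / 2 -> q.2 - q.1.2 = (d - c) / 2 ->
    cmod (rect q.1.1.1 q.1.1.2 q.1.2 q.2 f) <
    cmod (rect a m c n f + rect a m n d f + (rect m b c n f + rect m b n d f)) / 4.
  by move=> h1 h2 h3; rewrite ltNge; apply/negP => h4; apply: H; exists q.
set S := cmod (_ + _ + _) in H.
have : S < S / 4 + S / 4 + (S / 4 + S / 4); last by lra.
apply: le_lt_trans (cmodD _ _) _.
apply: le_lt_trans (lerD (cmodD _ _) (cmodD _ _)) _.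
do 2 ?[apply: ltrD].
- by apply: (H (a, m, c, n)) => /=; rewrite ?lexx; first split; rewrite /m /n //; lra.
- by apply: (H (a, m, n, d)) => /=; rewrite ?lexx; first split; rewrite /m /n //; lra.
- by apply: (H (m, b, c, n)) => /=; rewrite ?lexx; first split; rewrite /m /n //; lra.
- by apply: (H (m, b, n, d)) => /=; rewrite ?lexx; first split; rewrite /m /n //; lra.
Qed.

Lemma rect_affine a b c d (k l : C) : a <= b -> c <= d -> rect a b c d (fun w => k + l * w) = 0.
Proof.
move=> ab cd.
have D w : is_derive w (1 : C) (fun w => k * w + l / 2 * (w * w)) (k + l * w).
  have h : is_derive w (1 : C) (fun w => k * w + l / 2 * (w * w))
     (k *: 1 + (l / 2) *: (w *: 1 + w *: 1)).
    exact: (is_deriveD (is_deriveZ k _) (is_deriveZ (l/2) (is_deriveM _ _))).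
  apply: is_derive_eq h _; rewrite /GRing.scale /= !mulr1 -mulr2n.
  by rewrite -(mulr_natl w) mulrA divfK// pnatr_eq0.
apply: (@rect_FTC _ _ _ _ ab cd (fun w => k * w + l / 2 * (w * w))) => // w _.
by ccont.
Qed.

Lemma cont_affine (k l : C) w : {for w, continuous (fun w : C => k + l * w)}.
Proof. by ccont. Qed.

Lemma rect_sub_affine a b c d (k l : C) f : a <= b -> c <= d -> cont_at (bdR a b c d) f ->
  rect a b c d f = rect a b c d (fun w => f w + (-1) * (k + l * w)).
Proof.
move=> ab cd cf; have cg : cont_at (bdR a b c d) (fun w => k + l * w).
  by move=> w _; exact: cont_affine.
rewrite rectD; [|exact: ab|exact: cd|exact: cf|].
  by rewrite rectZ; [|exact: ab|exact: cd|exact: cg]; rewrite rect_affine ?mulr0 ?addr0.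
by move=> w _; ccont.
Qed.

Lemma half_pow_small M e : 0 < e -> exists n : nat, M / 2 ^+ n < e.
Proof.
move=> e0; have [n hn] : exists n : nat, M / e < n%:R.
  exists (Num.bound `|M / e|); apply: le_lt_trans (ler_norm _) _.
  exact/archi_boundP/normr_ge0.

exists n; rewrite ltr_pdivrMr ?exprn_gt0// mulrC -ltr_pdivrMr//.
by apply: lt_le_trans hn _; rewrite -natrX ler_nat ltnW// ltn_expl.
Qed.

(** Repeated quartering gives nested rectangles shrinking to a point [p], with integrals of modulus
    at least [4 ^- n] times the original. Near [p] the function is affine, with zero integral, up to
    an error of at most [e * cmod (w - p)]; both this distance and the perimeter are of order
    [2 ^- n], so the powers of 4 cancel and [e] remains. *)
Theorem goursat a b c d f : a <= b -> c <= d -> holo_on (onR a b c d) f ->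
  rect a b c d f = 0.
Proof.
move=> ab cd hf; apply/eqP; rewrite -cmod_eq0 eq_le cmod_ge0 andbT.
pose ok (q : R * R * R * R) := [/\ q.1.1.1 <= q.1.1.2, q.1.2 <= q.2 &
  onR q.1.1.1 q.1.1.2 q.1.2 q.2 `<=` onR a b c d].
(* The hypothesis [ok q] stands inside the existential so that [choice] yields a total function to
   iterate. *)
have step (q : R * R * R * R) : exists q' : R * R * R * R, ok q ->
    [/\ q.1.1.1 <= q'.1.1.1, q'.1.1.2 <= q.1.1.2, q.1.2 <= q'.1.2 & q'.2 <= q.2] /\
    [/\ q'.1.1.2 - q'.1.1.1 = (q.1.1.2 - q.1.1.1) / 2, q'.2 - q'.1.2 = (q.2 - q.1.2) / 2 &
    cmod (rect q.1.1.1 q.1.1.2 q.1.2 q.2 f) / 4 <=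
    cmod (rect q'.1.1.1 q'.1.1.2 q'.1.2 q'.2 f)].
  have [okq|] := pselect (ok q); last by move=> nok; exists q.
  have [h1 h2 h3] := okq.
  have [|q' Hq'] := @rect_quarter _ _ _ _ f h1 h2; last by exists q'.
  by apply: cont_atS h3 _; exact: holo_cont.
have {step} [nx Hnx] := choice step.
pose Q n := iter n nx (a, b, c, d).
have okQ n : ok (Q n).
  elim: n => [|n IH]; first by split.
  have [[h1 h2 h3 h4] [h5 h6 _]] := Hnx _ IH; have [k1 k2 k3] := IH.
  rewrite /= in h1 h2 h3 h4 h5 h6 *.
  split; rewrite /=.
  - by move: h5 k1; rewrite -/(Q n); lra.
  - by move: h6 k2; rewrite -/(Q n); lra.
  - by apply: subset_trans k3; exact: onRS.
have nest n m : [/\ (Q n).1.1.1 <= (Q (n + m)%N).1.1.1, (Q (n + m)%N).1.1.2 <= (Q n).1.1.2,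
    (Q n).1.2 <= (Q (n + m)%N).1.2 & (Q (n + m)%N).2 <= (Q n).2].
  elim: m => [|m [i1 i2 i3 i4]]; first by rewrite addn0 !lexx.
  have [[h1 h2 h3 h4] _] := Hnx _ (okQ (n + m)%N).
  by rewrite addnS /=; split; [exact: le_trans h1|exact: le_trans i2|
    exact: le_trans h3|exact: le_trans i4].
pose s := (b - a) + (d - c).
have size n : (Q n).1.1.2 - (Q n).1.1.1 = (b - a) / 2 ^+ n /\
   (Q n).2 - (Q n).1.2 = (d - c) / 2 ^+ n.
  elim: n => [|n [i1 i2]]; first by rewrite expr0 !divr1.
  have [_ [h1 h2 _]] := Hnx _ (okQ n).
  by rewrite exprSr invfM !mulrA -i1 -i2 -h1 -h2.
have big n : cmod (rect a b c d f) / 4 ^+ n <=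
    cmod (rect (Q n).1.1.1 (Q n).1.1.2 (Q n).1.2 (Q n).2 f).
  elim: n => [|n IH]; first by rewrite expr0 divr1.
  have [_ [_ _ h]] := Hnx _ (okQ n).
  apply: le_trans h; rewrite exprSr invfM mulrA ler_pM2r ?invr_gt0 ?ltr0n//.
have crossx n m : (Q n).1.1.1 <= (Q m).1.1.2.
  have [h1 _ _ _] := nest n m; have [_ h2 _ _] := nest m n; have [h3 _ _] := okQ (n + m)%N.
  by apply: le_trans h1 (le_trans h3 _); rewrite addnC.
have crossy n m : (Q n).1.2 <= (Q m).2.
  have [_ _ h1 _] := nest n m; have [_ _ _ h2] := nest m n; have [_ h3 _] := okQ (n + m)%N.
  by apply: le_trans h1 (le_trans h3 _); rewrite addnC.
have meet (u v : nat -> R) : (forall n m, u n <= v m) -> exists x, forall n, u n <= x <= v n.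
  move=> uv; have hs : has_sup (range u).
    by split; [exists (u 0%N), 0%N|exists (v 0%N) => _ [n _ <-]].
  exists (sup (range u)) => n; apply/andP; split.
    by apply: ub_le_sup; [case: hs|exists n].
  by apply: ge_sup; [case: hs|move=> _ [m _ <-]].
have [x Hx] := meet _ _ crossx; have [y Hy] := meet _ _ crossy.
pose p : C := mkC x y.
have pQ n : onR (Q n).1.1.1 (Q n).1.1.2 (Q n).1.2 (Q n).2 p by split.
have dfp : derivable f p 1 by apply: hf; have := pQ 0%N.
have /is_deriveC_cmodP fp := derivableP dfp.
set l := derive f p 1 in fp.
have s0 : 0 <= s by rewrite addr_ge0 ?subr_ge0.
have main e : 0 < e -> cmod (rect a b c d f) <= e * (4 * s * s).
  move=> e0; have [r r0 Hr] := fp _ e0.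
  have [n hn] := half_pow_small s r0.
  have [q1 q2 q3] := okQ n; have [s1 s2] := size n.
  have cf : cont_at (bdR (Q n).1.1.1 (Q n).1.1.2 (Q n).1.2 (Q n).2) f.
    by move=> w /bdR_on /q3 /hf /derivable_cont.
  have cfg : cont_at (bdR (Q n).1.1.1 (Q n).1.1.2 (Q n).1.2 (Q n).2)
      (fun w => f w + (-1) * ((f p - l * p) + l * w)).
    by move=> w wQ; have cfw := cf w wQ; ccont.
  have Eq := rect_sub_affine (f p - l * p) l q1 q2 cf.
  have dist w : onR (Q n).1.1.1 (Q n).1.1.2 (Q n).1.2 (Q n).2 w -> cmod (w - p) <= s / 2 ^+ n.
    move=> [/andP[w1 w2] /andP[w3 w4]]; apply: le_trans (cmod_le_ReIm _) _.
    rewrite !ReImE /s mulrDl -s1 -s2; have [/andP[p1 p2] /andP[p3 p4]] := pQ n.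
    rewrite /p /= in p1 p2 p3 p4.
    by apply: lerD; rewrite ler_norml; apply/andP; split; lra.
  have bound : cmod (rect (Q n).1.1.1 (Q n).1.1.2 (Q n).1.2 (Q n).2 f) <=
     4 * (e * (s / 2 ^+ n)) * (s / 2 ^+ n).
    rewrite Eq; have := @rect_bound _ _ _ _ q1 q2 (e * (s / 2 ^+ n)) _ cfg.
    rewrite s1 s2 -mulrDl -/s; apply => w /bdR_on /dist dw.
    have := Hr (w - p) (le_lt_trans dw hn); rewrite (addrC p) subrK => H.

    apply: (@le_trans _ _ (e * cmod (w - p))); last by rewrite ler_wpM2l// ltW.
    by apply: le_trans H; rewrite le_eqVlt; apply/orP; left; apply/eqP; congr cmod; ring.

  have := le_trans (big n) bound; rewrite ler_pdivrMr ?exprn_gt0//.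
  suff -> : 4 * (e * (s / 2 ^+ n)) * (s / 2 ^+ n) * 4 ^+ n = e * (4 * s * s) by [].
  have -> : (4 : R) = 2 ^+ 2 by rewrite -natrX.
  rewrite -exprM mulnC exprM; field.
  by rewrite expf_neq0// pnatr_eq0.
rewrite leNgt; apply/negP => h.
have [ss0|ss0] := eqVneq s 0.
  by have := main 1 ltr01; rewrite ss0 mulr0 mulr0 leNgt h.
have sp : 0 < 4 * s * s by rewrite !mulr_gt0// lt_def ss0.
(* With this [e] the bound of [main] is half of the integral's own modulus. *)
have := main (cmod (rect a b c d f) / (8 * s * s)).
have -> : cmod (rect a b c d f) / (8 * s * s) * (4 * s * s) = cmod (rect a b c d f) / 2.
  by field.
move=> /(_ _); rewrite divr_gt0//; last by move: sp; lra.
by move=> /(_ isT); lra.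
Qed.

End Rectangles.

(** * Differentiation of Cauchy-type integrals with respect to the pole *)

Section CauchyKernel.
Variable R : realType.
Local Notation C := (Cplx R).
Local Notation Re := (@complex.Re R).
Local Notation Im := (@complex.Im R).
Implicit Types (z w : C) (a b c d x y t r e M : R) (f g : C -> C).

Lemma cont_on_bounded a b (g : R -> C) : cont_on a b g ->
  exists2 M, 0 <= M & forall t, a <= t <= b -> cmod (g t) <= M.
Proof.
move=> cg; have cw : {within `[a, b], continuous g}.
  by apply: continuous_in_subspaceT => t; rewrite inE /= in_itv; exact: cg.
have [M HM] := compactC_bounded (continuous_compact cw (@segment_compact _ a b)).
exists (Num.max M 0); first by rewrite le_max lexx orbT.
move=> t tab; rewrite le_max HM//; exists t => //.
Qed.

Lemma cont_on_dist a b (g : R -> C) z : cont_on a b g ->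
  (forall t, a <= t <= b -> g t != z) ->
  exists2 e, 0 < e & forall t, a <= t <= b -> e <= cmod (g t - z).
Proof.
move=> cg gz; have cw : {within `[a, b], continuous g}.
  by apply: continuous_in_subspaceT => t; rewrite inE /= in_itv; exact: cg.
have cA := continuous_compact cw (@segment_compact _ a b).
have clz : closed [set z] by apply: compactC_closed; exact: compact_set1.
have [|e e0 He] := compact_closed_dist cA clz.
  apply/eqP; apply: contrapT => /negP/set0P[w [[t]]]; rewrite /= in_itv /= => tab <- gtz.
  by have := gz t tab; rewrite gtz eqxx.
by exists e => // t tab; apply: He => //; exists t => //; rewrite /= in_itv.
Qed.

(** Meant for [A = 1 / (w - z)] and [B = 1 / (w - (z + h))], which satisfy this resolvent identity.
    Since [w] does not occur, the constant [K] is uniform along a contour that stays away from the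
    two poles. *)
Lemma inv_pow_taylor (N : R) k : 0 <= N -> exists2 K : R, 0 <= K &
  forall A B h : C, B - A = h * (A * B) -> cmod A <= N -> cmod B <= N ->
  cmod (B ^+ k - A ^+ k - k%:R * h * A ^+ k.+1) <= K * cmod h ^+ 2.
Proof.
move=> N0; elim: k => [|k [K K0 IH]].
  exists 0 => // A B h _ _ _.
  by rewrite !expr0 subrr !mul0r subr0 cmod0.
exists (N * K + k%:R * N ^+ k.+3 + N ^+ k.+3).
  have N3 : 0 <= N ^+ k.+3 by exact: exprn_ge0.
  apply: addr_ge0 => //; apply: addr_ge0; apply: mulr_ge0 => //; exact: ler0n.
move=> A B h E hA hB.
have -> : B ^+ k.+1 - A ^+ k.+1 - k.+1%:R * h * A ^+ k.+2 =
    B * (B ^+ k - A ^+ k - k%:R * h * A ^+ k.+1) + k%:R * h * A ^+ k.+1 * (B - A)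
    + A ^+ k * (B - A - h * A ^+ 2).
  rewrite !exprS -natr1; ring.
have -> : B - A - h * A ^+ 2 = h * A * (B - A) by rewrite {1}E; ring.
rewrite E; have pA j : cmod (A ^+ j) <= N ^+ j by rewrite cmodX lerXn2r ?nnegrE ?cmod_ge0.
have IH' := IH A B h E hA hB.
apply: le_trans (cmodD _ _) _; rewrite !mulrDl; apply: lerD; last first.
  have -> : A ^+ k * (h * A * (h * (A * B))) = A ^+ k.+2 * B * h ^+ 2.
    by rewrite !exprS; ring.
  rewrite cmodM (cmodX h) ler_wpM2r ?sqr_ge0// cmodM (exprSr N).
  by apply: ler_pM => //; exact: cmod_ge0.
apply: le_trans (cmodD _ _) _; apply: lerD.
  by rewrite cmodM -(mulrA N); apply: ler_pM => //; exact: cmod_ge0.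

have -> : k%:R * h * A ^+ k.+1 * (h * (A * B)) = k%:R * (A ^+ k.+2 * B) * h ^+ 2.
  by rewrite !exprS; ring.
rewrite cmodM (cmodX h) ler_wpM2r ?sqr_ge0// cmodM cmod_nat ler_wpM2l// cmodM (exprSr N).
by apply: ler_pM => //; exact: cmod_ge0.
Qed.

Lemma cont_kernel a b (g : R -> C) z n : cont_on a b g ->
  (forall t, a <= t <= b -> g t != z) -> cont_on a b (fun t => (g t - z)^-1 ^+ n).
Proof.
move=> cg gz t tab; have cgt := cg t tab; ccont.
by rewrite subr_eq0; exact: gz.
Qed.

Lemma cint_kernel_derive a b (g p : R -> C) z k : a <= b -> cont_on a b g -> cont_on a b p ->
  (forall t, a <= t <= b -> p t != z) ->
  is_derive z (1 : C) (fun v => cint a b (fun t => g t * (p t - v)^-1 ^+ k))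
    (cint a b (fun t => g t * (k%:R * (p t - z)^-1 ^+ k.+1))).
Proof.
move=> ab cg cp pz; have [M M0 gM] := cont_on_bounded cg.
have [de de0 Hde] := cont_on_dist cp pz.
have N0 : 0 <= 2 / de by rewrite divr_ge0// ltW.
have [K K0 HK] := inv_pow_taylor k N0.
apply/is_deriveC_cmodP => e e0.
pose L := 2 * (M * K) * (b - a) + 1.
have L0 : 0 < L by rewrite ltr_wpDl// !mulr_ge0// subr_ge0.
(* The first bound keeps [z + h] at distance at least [de / 2] from the path; the second absorbs one
   of the two factors [cmod h] of the quadratic error. *)
exists (Num.min (de / 2) (e / L)); first by rewrite lt_min !divr_gt0.
move=> h; rewrite lt_min => /andP[hd he].
have pzh t : a <= t <= b -> de / 2 <= cmod (p t - (z + h)).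
  move=> tab; have := Hde t tab; have := cmod_tri (p t) z (z + h).
  by rewrite [z + h]addrC addrK => h1 h2; lra.
have pzh' t : a <= t <= b -> p t != z + h.
  by move=> tab; rewrite -subr_eq0 -cmod_gt0; apply: lt_le_trans (pzh t tab); rewrite divr_gt0.
have ck := cont_kernel (n := k) cp pz; have ckh := cont_kernel (n := k) cp pzh'.
have ck1 := cont_kernel (n := k.+1) cp pz.
have c1 : cont_on a b (fun t => g t * (p t - (z + h))^-1 ^+ k) by exact: cont_onM.
have c2 : cont_on a b (fun t => g t * (p t - z)^-1 ^+ k) by exact: cont_onM.
have c3 : cont_on a b (fun t => g t * (k%:R * (p t - z)^-1 ^+ k.+1)).
  by apply: cont_onM; [exact: cg|apply: cont_onZ; exact: ck1].
have c4 : cont_on a b (fun t => g t * (p t - (z + h))^-1 ^+ k + (-1) * (g t * (p t - z)^-1 ^+ k)).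
  by apply: cont_onD; [exact: c1|apply: cont_onZ; exact: c2].
have c5 : cont_on a b (fun t => g t * (p t - (z + h))^-1 ^+ k + (-1) * (g t * (p t - z)^-1 ^+ k)
   + (- h) * (g t * (k%:R * (p t - z)^-1 ^+ k.+1))).
  by apply: cont_onD; [exact: c4|apply: cont_onZ; exact: c3].
set I1 := cint a b _; set I2 := cint a b _; set I3 := cint a b _.
have -> : I1 - I2 - I3 * h = cint a b (fun t => g t * (p t - (z + h))^-1 ^+ k
   + (-1) * (g t * (p t - z)^-1 ^+ k) + (- h) * (g t * (k%:R * (p t - z)^-1 ^+ k.+1))).
  rewrite (cintD c4); last by apply: cont_onZ; exact: c3.
  rewrite (cintD c1); last by apply: cont_onZ; exact: c2.
  by rewrite (cintZ _ c2) (cintZ _ c3) mulN1r mulNr (mulrC h).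
have bd t : a <= t <= b -> cmod (g t * (p t - (z + h))^-1 ^+ k
   + (-1) * (g t * (p t - z)^-1 ^+ k) + (- h) * (g t * (k%:R * (p t - z)^-1 ^+ k.+1)))
   <= M * K * cmod h ^+ 2.
  move=> tab.
  have -> : g t * (p t - (z + h))^-1 ^+ k + (-1) * (g t * (p t - z)^-1 ^+ k)
     + (- h) * (g t * (k%:R * (p t - z)^-1 ^+ k.+1)) =
     g t * ((p t - (z + h))^-1 ^+ k - (p t - z)^-1 ^+ k - k%:R * h * (p t - z)^-1 ^+ k.+1).
    by ring.
  rewrite cmodM -(mulrA M); apply: ler_pM; rewrite ?cmod_ge0 ?gM//.

  have n1 : p t - z != 0 by rewrite subr_eq0 pz.
  have n2 : p t - (z + h) != 0 by rewrite subr_eq0 pzh'.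
  have invle v : de / 2 <= cmod v -> cmod v^-1 <= 2 / de.
    move=> hv; rewrite cmodV -[2 / de]invf_div lef_pV2// posrE ?divr_gt0//.
    by apply: lt_le_trans hv; rewrite divr_gt0.
  apply: HK; last 2 first.
  - by apply: invle; apply: le_trans (Hde t tab); rewrite ler_pdivrMr// ler_pMr// ler1n.
  - by apply: invle; exact: pzh.
  have -> : (p t - (z + h))^-1 - (p t - z)^-1 =
     ((p t - z) - (p t - (z + h))) * ((p t - z)^-1 * (p t - (z + h))^-1).
    by field; rewrite n1 n2.

  by congr (_ * _); ring.
apply: le_trans (cint_bound ab c5 bd) _.
have -> : 2 * (M * K * cmod h ^+ 2) * (b - a) = (L - 1) * cmod h * cmod h.
  by rewrite /L addrK; ring.
rewrite ler_wpM2r ?cmod_ge0//; move: he; rewrite ltr_pdivlMr// => he.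
rewrite mulrBl mul1r mulrC; have := cmod_ge0 h; lra.
Qed.

Section rectangle_kernel.
Variables (a b c d : R).
Hypotheses (ab : a <= b) (cd : c <= d).

Lemma cont_at_kernel f z k : cont_at (bdR a b c d) f -> ~ bdR a b c d z ->
  cont_at (bdR a b c d) (fun w => f w * (w - z)^-1 ^+ k).
Proof.
move=> cf nz w wbd; have cfw := cf w wbd; ccont.
by rewrite subr_eq0; apply/eqP => wz; rewrite wz in wbd.
Qed.

Lemma rect_kernel_derive f z k : cont_at (bdR a b c d) f -> ~ bdR a b c d z ->
  is_derive z (1 : C) (fun v => rect a b c d (fun w => f w * (w - v)^-1 ^+ k))
    (rect a b c d (fun w => f w * (k%:R * (w - z)^-1 ^+ k.+1))).
Proof.
move=> /(cont_at_edges ab cd)[f1 f2 f3 f4] nz.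
have nz' w : bdR a b c d w -> w != z by move=> wbd; apply/eqP => wz; rewrite wz in wbd.
have [z1 z2 z3 z4] := bdRP ab cd nz'.
have D1 := cint_kernel_derive k ab f1 (fun t _ => @cont_hline R c t) z1.
have D2 := cint_kernel_derive k cd f2 (fun t _ => @cont_vline R b t) z2.
have D3 := cint_kernel_derive k ab f3 (fun t _ => @cont_hline R d t) z3.
have D4 := cint_kernel_derive k cd f4 (fun t _ => @cont_vline R a t) z4.
exact: (is_deriveB (is_deriveB (is_deriveD D1 (is_deriveZ (mkC 0 1) D2)) D3)
   (is_deriveZ (mkC 0 1) D4)).
Qed.

Lemma inR_nbd z : inR a b c d z -> ~ bdR a b c d z.
Proof.
by move=> [/andP[h1 h2] /andP[h3 h4]] [_ [|||] h]; lra.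
Qed.

Lemma bdR_neq z w : inR a b c d z -> bdR a b c d w -> w - z != 0.
Proof. by move=> /inR_nbd nz wbd; rewrite subr_eq0; apply/eqP => wz; rewrite wz in wbd. Qed.

End rectangle_kernel.

End CauchyKernel.

(** * Cauchy's integral formula on a rectangle *)

Section CauchyFormula.
Variable R : realType.
Local Notation C := (Cplx R).
Local Notation Re := (@complex.Re R).
Local Notation Im := (@complex.Im R).
Implicit Types (z w : C) (a b c d x y t r e M : R) (f g : C -> C).

Ltac rlra := match goal with |- is_true _ => lra | _ => idtac end.

Lemma inR_on a b c d : inR a b c d `<=` onR a b c d.
Proof. by move=> w [/andP[? ?] /andP[? ?]]; split; apply/andP; split; apply: ltW. Qed.

Lemma inR_le a b c d z : inR a b c d z -> a <= b /\ c <= d.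
Proof. by move=> [/andP[? ?] /andP[? ?]]; split; lra. Qed.

(** The four strips cut off one after the other avoid [z], so Goursat's theorem makes each of their
    integrals zero. *)
Lemma rect_shrink a b c d a' b' c' d' f z :
  a <= a' -> b' <= b -> c <= c' -> d' <= d -> inR a' b' c' d' z ->
  holo_on (onR a b c d `\ z) f -> rect a b c d f = rect a' b' c' d' f.
Proof.
move=> aa bb cc dd zin hf; have [/andP[z1 z2] /andP[z3 z4]] := zin.
have cR p q r s : a <= p -> q <= b -> c <= r -> s <= d -> ~ bdR p q r s z ->
    cont_at (bdR p q r s) f.
  move=> h1 h2 h3 h4 nz w wb; apply: derivable_cont; apply: hf; split.
    by apply: onRS (bdR_on wb).
  by move=> wz; rewrite wz in wb.
have G p q r s : a <= p -> p <= q -> q <= b -> c <= r -> r <= s -> s <= d ->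
    ~ onR p q r s z -> rect p q r s f = 0.
  move=> h1 h2 h3 h4 h5 h6 nz; apply: goursat => // w wR; apply: hf; split.
    by apply: onRS wR.
  by move=> wz; rewrite wz in wR.
have nb p q r s : [|| Re z < p, q < Re z, Im z < r | s < Im z] -> ~ onR p q r s z.
  by move=> h [/andP[k1 k2] /andP[k3 k4]]; case/or4P: h => h; lra.
have nb' p q r s : p < Re z -> Re z < q -> r < Im z -> Im z < s -> ~ bdR p q r s z.
  by move=> h1 h2 h3 h4 [_ [|||] h]; lra.
rewrite (@rect_splitX _ a b c d _ _ a'); try rlra; last by apply: cR; try rlra; apply: nb'; lra.
rewrite (G a a' c d); try rlra; last by apply: nb; apply/or4P/Or42; lra.
rewrite add0r (@rect_splitX _ a' b c d _ _ b'); try rlra; last by apply: cR; try rlra; apply: nb'; lra.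
rewrite (G b' b c d); try rlra; last by apply: nb; apply/or4P/Or41; lra.
rewrite addr0 (@rect_splitY _ a' b' c d _ _ c'); try rlra; last by apply: cR; try rlra; apply: nb'; lra.
rewrite (G a' b' c c'); try rlra; last by apply: nb; apply/or4P/Or44; lra.
rewrite add0r (@rect_splitY _ a' b' c' d _ _ d'); try rlra; last by apply: cR; try rlra; apply: nb'; lra.
rewrite (G a' b' d' d); try rlra; last by apply: nb; apply/or4P/Or43; lra.
by rewrite addr0.
Qed.

Lemma derivable_inv_sub z w : w != z -> derivable (fun v : C => (v - z)^-1) w 1.
Proof.
move=> wz; apply: derivableV; first by rewrite subr_eq0.
by apply: derivableB; [exact: derivable_id|exact: derivable_cst].
Qed.

Lemma is_derive_inv_sub z w : w != z ->
  is_derive w (1 : C) (fun v : C => - (v - z)^-1) ((w - z)^-1 ^+ 2).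
Proof.
move=> wz; have w0 : w - z != 0 by rewrite subr_eq0.
have dB : is_derive w (1 : C) (fun v : C => v - z) (1 - 0).
  exact: is_deriveB.
have dV : is_derive w (1 : C) (fun v : C => (v - z)^-1) (- (w - z) ^- 2 *: (1 - 0)).
  split; last by have [_ <-] := dB; exact: (@deriveV _ _ (fun v : C => v - z)).
  by apply: derivableV; [|case: dB].
have h : is_derive w (1 : C) (fun v : C => - (v - z)^-1) (- (- (w - z) ^- 2 *: (1 - 0))).
  exact: is_deriveN.
apply: is_derive_eq h _; by rewrite subr0 /GRing.scale /= mulr1 opprK exprVn.
Qed.

(* The common value of the integrals of [1 / (w - z)] around [z], i.e. [2 pi i]. *)
Definition wind : C := rect (- 1) 1 (- 1) 1 (fun w => (w - 0)^-1).

Lemma zero_derive_rect a b c d (F : C -> C) z w :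
  (forall v, inR a b c d v -> is_derive v (1 : C) F 0) ->
  inR a b c d z -> inR a b c d w -> F z = F w.
Proof.
move=> dF; have c0 p q : cint p q (fun=> 0) = 0 :> C.
  have -> : (fun _ : R => 0 : C) = fun _ => 0 * 0 by apply/funext => ?; rewrite mul0r.
  by rewrite cintZ ?mul0r// => t _; exact: cvg_cst.
have H y p q : c < y < d -> a < p -> p <= q -> q < b -> F (mkC p y) = F (mkC q y).
  move=> yc ap pq qb; apply/esym/eqP; rewrite -subr_eq0 (hline y p) (hline y q).
  have <- : 1 * cint p q (fun=> 0 : C) = F ((mkC 0 y) + 1 * mkC q 0) - F ((mkC 0 y) + 1 * mkC p 0).
    apply: (@cint_FTC _ p q (mkC 0 y) 1 F (fun=> 0)) => //.
      by move=> t _; exact: cvg_cst.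
    move=> t /andP[pt tq]; rewrite -hline; apply: dF; split => //=.
    by rewrite (lt_le_trans ap) ?(le_lt_trans tq).
  by rewrite c0 mulr0.
have V x p q : a < x < b -> c < p -> p <= q -> q < d -> F (mkC x p) = F (mkC x q).
  move=> yc ap pq qb; apply/esym/eqP; rewrite -subr_eq0 (vline x p) (vline x q).
  have <- : (mkC 0 1) * cint p q (fun=> 0 : C) = F ((mkC x 0) + (mkC 0 1) * mkC q 0) - F ((mkC x 0) + (mkC 0 1) * mkC p 0).
    apply: (@cint_FTC _ p q (mkC x 0) (mkC 0 1) F (fun=> 0)) => //.
      by move=> t _; exact: cvg_cst.
    move=> t /andP[pt tq]; rewrite -vline; apply: dF; split => //=.
    by rewrite (lt_le_trans ap) ?(le_lt_trans tq).
  by rewrite c0 mulr0.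
have H' y p q : c < y < d -> a < p < b -> a < q < b -> F (mkC p y) = F (mkC q y).
  move=> yc /andP[p1 p2] /andP[q1 q2]; have [pq|/ltW qp] := leP p q; first exact: H.
  by apply/esym; exact: H.
have V' x p q : a < x < b -> c < p < d -> c < q < d -> F (mkC x p) = F (mkC x q).
  move=> yc /andP[p1 p2] /andP[q1 q2]; have [pq|/ltW qp] := leP p q; first exact: V.
  by apply/esym; exact: V.
move=> [z1 z2] [w1 w2]; rewrite -(mkC_eta z) -(mkC_eta w).
by rewrite (H' _ _ (Re w))// (V' _ _ (Im w)).
Qed.

(** Both rectangles can be enlarged to one big square around the origin. There the integral, as a
    function of the pole, has as derivative the integral of [(w - v) ^- 2], which has a primitive on
    the boundary; so the pole can be moved to [0]. *)
Lemma rect_index a b c d z : inR a b c d z -> rect a b c d (fun w => (w - z)^-1) = wind.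
Proof.
move=> zin; have [ab cd] := inR_le zin.
have hk v A : ~ A v -> holo_on A (fun w => (w - v)^-1).
  by move=> nAv w Aw; apply: derivable_inv_sub; apply/eqP => wv; rewrite wv in Aw.
have hk' v A : holo_on (A `\ v) (fun w => (w - v)^-1) by apply: hk => -[_]; apply.
pose M := 2 + `|a| + `|b| + `|c| + `|d|.
have [aM bM cM dM] : [/\ `|a| <= M - 2, `|b| <= M - 2, `|c| <= M - 2 & `|d| <= M - 2].
  have := normr_ge0 a; have := normr_ge0 b; have := normr_ge0 c; have := normr_ge0 d.
  by rewrite /M => *; split; lra.
have M2 : 2 <= M by have := normr_ge0 a; lra.
move: aM bM cM dM; rewrite !ler_norml => /andP[a1 a2] /andP[b1 b2] /andP[c1 c2] /andP[d1 d2].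
have zM : inR (- M) M (- M) M z.
  by case: zin => /andP[? ?] /andP[? ?]; split; apply/andP; split; lra.
have oM : inR (- M) M (- M) M (0 : C) by split=> /=; apply/andP; split; lra.
rewrite -(@rect_shrink (- M) M (- M) M a b c d _ z)//; try rlra.
rewrite /wind -(@rect_shrink (- M) M (- M) M (- 1) 1 (- 1) 1 _ 0)//; try rlra; last first.
  by split=> /=; apply/andP; split; lra.
pose F v := rect (- M) M (- M) M (fun w => 1 * (w - v)^-1 ^+ 1).
have FE v : rect (- M) M (- M) M (fun w => (w - v)^-1) = F v.
  by congr rect; apply/funext => w; rewrite mul1r expr1.
rewrite !FE; have MM : - M <= M by lra.
apply: (@zero_derive_rect (- M) M (- M) M F z 0 _ zM oM) => v vin.
have cc : cont_at (bdR (- M) M (- M) M) (fun _ : C => 1 : C) by move=> ? _; exact: cont_cst.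
have h := rect_kernel_derive MM MM 1 cc (inR_nbd vin); apply: (is_derive_eq h).
apply: (@rect_FTC _ _ _ _ _ MM MM (fun w => - (w - v)^-1)).
- by move=> w wb; have := bdR_neq vin wb => wv; ccont.
- move=> w wb; have wv : w != v by rewrite -subr_eq0 (bdR_neq vin wb).
  by apply: (is_derive_eq (is_derive_inv_sub wv)); rewrite !mul1r.
Qed.

(** Each of the four edges, with its orientation, contributes a positive imaginary part, so no
    integral has to be evaluated. *)
Lemma wind_neq0 : wind != 0.
Proof.
have le11 : (-1 : R) <= 1 by lra.
have lt11 : (-1 : R) < 1 by lra.
have zin : inR (-1) 1 (-1) 1 (0 : C) by split=> /=; apply/andP; split; lra.
have cc : cont_at (bdR (- 1) 1 (- 1) 1) (fun w : C => (w - 0)^-1).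
  by move=> w /(bdR_neq zin) w0; ccont.
have [h1 h2 h3 h4] := cont_at_edges le11 le11 cc.
have ImV (v : C) : Im v^-1 = - Im v / (Re v ^+ 2 + Im v ^+ 2).
  by case: v => ? ? /=; rewrite mulNr.
have ReV (v : C) : Re v^-1 = Re v / (Re v ^+ 2 + Im v ^+ 2).
  by case: v => ? ?.
have D1 t : 0 < t ^+ 2 + 1 by rewrite ltr_wpDl ?sqr_ge0.
have E1 : 0 < Im (hint (-1) (-1) 1 (fun w => (w - 0)^-1)).
  apply: rint_gt0 lt11 (cont_on_Im h1) _.
  move=> t _; change (0 < Im ((mkC t (-1) - 0)^-1)).
  by rewrite subr0 ImV /= opprK sqrrN expr1n divr_gt0.
have E2 : 0 < Im (vint 1 (-1) 1 (fun w => (w - 0)^-1)).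
  rewrite /vint ImM /= mul0r add0r mul1r.
  apply: rint_gt0 lt11 (cont_on_Re h2) _.
  move=> t _; change (0 < Re ((mkC 1 t - 0)^-1)).
  by rewrite subr0 ReV /= expr1n divr_gt0// addrC.
have E3 : 0 < - Im (hint 1 (-1) 1 (fun w => (w - 0)^-1)).
  change (0 < - rint (-1) 1 (Im \o (fun t => (mkC t 1 - 0)^-1))).
  rewrite -[ltRHS]mulN1r -(rintZ _ (cont_on_Im h3)).
  apply: rint_gt0 lt11 (cont_on_scale (cont_on_Im h3)) _.
  move=> t _; change (0 < -1 * Im ((mkC t 1 - 0)^-1)).
  by rewrite subr0 ImV /= expr1n mulN1r mulNr opprK divr_gt0.
have E4 : 0 < - Im (vint (-1) (-1) 1 (fun w => (w - 0)^-1)).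
  rewrite /vint ImM /= mul0r add0r mul1r.
  change (0 < - rint (-1) 1 (Re \o (fun t => (mkC (-1) t - 0)^-1))).
  rewrite -[ltRHS]mulN1r -(rintZ _ (cont_on_Re h4)).

  apply: rint_gt0 lt11 (cont_on_scale (cont_on_Re h4)) _.
  move=> t _; change (0 < -1 * Re ((mkC (-1) t - 0)^-1)).
  by rewrite subr0 ReV /= sqrrN expr1n mulN1r mulNr opprK divr_gt0// addrC.
apply/eqP => /(congr1 Im); rewrite /wind /rect !ImD !ImN Im0; lra.
Qed.

Lemma derivable_bounded_slope f z : derivable f z 1 -> exists2 K, 0 <= K &
  exists2 r, 0 < r & forall w, cmod (w - z) < r -> cmod (f w - f z) <= K * cmod (w - z).
Proof.
move=> /derivableP; set l := derive f z 1 => /is_deriveC_cmodP /(_ 1 ltr01) [r r0 Hr].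
exists (cmod l + 1); first by rewrite addr_ge0 ?cmod_ge0.
exists r => // w wr; have := Hr _ wr; rewrite (addrC z) subrK mul1r => H.
have := cmodD (f w - f z - l * (w - z)) (l * (w - z)); rewrite subrK cmodM.
by move=> H2; rewrite mulrDl mul1r; lra.
Qed.

(** Split off the constant [f z]. The difference quotient [g] that remains is holomorphic except at
    [z] and bounded near it, so its integral can be moved to arbitrarily small squares and
    vanishes. *)
Theorem cauchy_formula a b c d f z : holo_on (onR a b c d) f -> inR a b c d z ->
  rect a b c d (fun w => f w * (w - z)^-1) = f z * wind.
Proof.
move=> hf zin; have [ab cd] := inR_le zin; have [z1 z2] := zin.
have cf : cont_at (bdR a b c d) f by apply: cont_atS (holo_cont hf) => w /bdR_on.
pose g w := (f w - f z) * (w - z)^-1.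
have cg : cont_at (bdR a b c d) g.
  by move=> w wb; have cfw := cf w wb; have w0 := bdR_neq zin wb; rewrite /g; ccont.
have ck : cont_at (bdR a b c d) (fun w => (w - z)^-1).
  by move=> w wb; have w0 := bdR_neq zin wb; ccont.
have ck2 : cont_at (bdR a b c d) (fun w => f z * (w - z)^-1).
  by move=> w wb; have w0 := bdR_neq zin wb; ccont.
have -> : rect a b c d (fun w => f w * (w - z)^-1) =
    rect a b c d g + f z * rect a b c d (fun w => (w - z)^-1).
  rewrite -(rectZ ab cd _ ck) -(rectD ab cd cg ck2).
  by apply: (rect_ext ab cd) => w _; rewrite /g; ring.

rewrite (rect_index zin) -[RHS]add0r; congr (_ + _).
have [K K0 [r r0 Hr]] : exists2 K, 0 <= K &
  exists2 r, 0 < r & forall w, cmod (w - z) < r -> cmod (f w - f z) <= K * cmod (w - z).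
  by apply: derivable_bounded_slope; apply: hf; exact: inR_on.
have hg : holo_on (onR a b c d `\ z) g.
  move=> w [wR /eqP wz]; apply: derivableM; last exact: derivable_inv_sub.
  by apply: derivableB; [exact: hf|exact: derivable_cst].
have [/andP[za zb] /andP[zc zd]] := zin.
have main s : 0 < s -> cmod (rect a b c d g) <= s.
  move=> s0.
  (* Half the side of the square around [z]: [r / 4] keeps it where [g] is bounded by [K], the
     second term makes the bound [4 * K * (2 * q + 2 * q)] at most [s], and the others keep the
     square inside the rectangle. *)
  pose q := Num.min (Num.min (r / 4) (s / (16 * K + 1)))
     (Num.min (Num.min (Re z - a) (b - Re z)) (Num.min (Im z - c) (d - Im z))).
  have K1 : 0 < 16 * K + 1 by lra.
  have q0 : 0 < q by rewrite !lt_min !subr_gt0 za zb zc zd !divr_gt0.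
  have : q <= q by []; rewrite {2}/q !le_min => /and3P[/andP[q1 q2] /andP[q3 q4] /andP[q5 q6]].
  rewrite (@rect_shrink a b c d (Re z - q) (Re z + q) (Im z - q) (Im z + q) g z)//; try rlra; last first.
    by split; apply/andP; split; lra.
  have zq : inR (Re z - q) (Re z + q) (Im z - q) (Im z + q) z.
    by split; apply/andP; split; lra.
  have qx : Re z - q <= Re z + q by lra.
  have qy : Im z - q <= Im z + q by lra.
  have cgq : cont_at (bdR (Re z - q) (Re z + q) (Im z - q) (Im z + q)) g.
    move=> w wb; apply: derivable_cont; apply: hg; split.
      by apply: onRS (bdR_on wb); lra.
    by move=> wz; have wz' : w = z := wz; rewrite wz' in wb; exact: (inR_nbd zq wb).

  have bg w : bdR (Re z - q) (Re z + q) (Im z - q) (Im z + q) w -> cmod (g w) <= K.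
    move=> wb; have w0 := bdR_neq zq wb; have [[/andP[w1 w2] /andP[w3 w4]] _] := wb.
    rewrite /g cmodM cmodV ler_pdivrMr ?cmod_gt0//; apply: Hr.
    apply: le_lt_trans (cmod_le_ReIm _) _; rewrite !ReImE.
    apply: (@le_lt_trans _ _ (q + q)); last by lra.
    by apply: lerD; rewrite ler_norml; apply/andP; split; lra.
  apply: le_trans (rect_bound qx qy cgq bg) _.
  move: q2; rewrite ler_pdivlMr//; lra.
apply/eqP; rewrite -cmod_eq0 eq_le cmod_ge0 andbT leNgt; apply/negP => h.
have := main (cmod (rect a b c d g) / 2); rewrite divr_gt0// => /(_ isT); lra.
Qed.

End CauchyFormula.

(** * Consequences: derivatives, Taylor expansion, Weierstrass' theorem *)

Section CauchyEstimates.
Variable R : realType.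
Local Notation C := (Cplx R).
Local Notation Re := (@complex.Re R).
Local Notation Im := (@complex.Im R).
Implicit Types (z w v h : C) (a b c d x y t r e M : R) (f g : C -> C).

Lemma rectB a b c d f g : a <= b -> c <= d ->
  cont_at (bdR a b c d) f -> cont_at (bdR a b c d) g ->
  rect a b c d (fun w => f w - g w) = rect a b c d f - rect a b c d g.
Proof.
move=> ab cd cf cg; have cg' : cont_at (bdR a b c d) (fun w => -1 * g w).
  by move=> w wb; have cgw := cg w wb; ccont.
rewrite -mulN1r -(rectZ ab cd (-1) cg) -(rectD ab cd cf cg').
by apply: (rect_ext ab cd) => w _; rewrite mulN1r.
Qed.

Lemma bdR_dist a b c d z : inR a b c d z ->
  exists2 e, 0 < e & forall w, bdR a b c d w -> e <= cmod (w - z).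
Proof.
move=> [/andP[z1 z2] /andP[z3 z4]].
exists (Num.min (Num.min (Re z - a) (b - Re z)) (Num.min (Im z - c) (d - Im z))).
  by rewrite !lt_min !subr_gt0 z1 z2 z3 z4.
move=> w [_ wb]; have hR := Re_le_cmod (w - z); have hI := Im_le_cmod (w - z).
rewrite !ReImE in hR hI; rewrite !ge_min.
have := ler_norm (Re w - Re z); have := ler_norm (Im w - Im z).
have := ler_norm (- (Re w - Re z)); have := ler_norm (- (Im w - Im z)).
rewrite !normrN => k1 k2 k3 k4.
case: wb => wE; apply/orP; [left|left|right|right]; apply/orP; [left|right|left|right]; lra.
Qed.

Lemma inv_sub_bound a b c d z : inR a b c d z ->
  exists2 N, 0 <= N & forall w, bdR a b c d w -> cmod (w - z)^-1 <= N.
Proof.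
move=> zin; have [e e0 He] := bdR_dist zin; exists e^-1; first by rewrite invr_ge0 ltW.
move=> w wb; have := He w wb => ew.
by rewrite cmodV lef_pV2// posrE; apply: lt_le_trans ew.
Qed.

Lemma inR_nbhs a b c d z : inR a b c d z -> \forall w \near z, inR a b c d w.
Proof.
move=> [/andP[z1 z2] /andP[z3 z4]]; apply/nbhs_cmodP.
exists (Num.min (Num.min (Re z - a) (b - Re z)) (Num.min (Im z - c) (d - Im z))).
  by rewrite !lt_min !subr_gt0 z1 z2 z3 z4.
move=> w; rewrite !lt_min => /andP[/andP[h1 h2] /andP[h3 h4]].
have hR := Re_le_cmod (w - z); have hI := Im_le_cmod (w - z).
rewrite !ReImE !ler_norml in hR hI.
move: hR hI => /andP[k1 k2] /andP[k3 k4].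
by split; apply/andP; split; lra.
Qed.

Section rectangle.
Variables (a b c d : R).

Lemma cauchy_kernel_cont f z k : cont_at (bdR a b c d) f -> inR a b c d z ->
  cont_at (bdR a b c d) (fun w => f w * (w - z)^-1 ^+ k).
Proof. by move=> cf zin; apply: cont_at_kernel cf _; exact: inR_nbd. Qed.

(** The integral formula for the [n]-th derivative holds on the whole open rectangle, so it may be
    differentiated under the integral sign, which gives the formula for [n + 1]. *)
Lemma derive1n_cauchy f n : holo_on (onR a b c d) f -> forall z, inR a b c d z ->
  is_derive z (1 : C) (derive1n n f)
    (n.+1`!%:R / wind R * rect a b c d (fun w => f w * (w - z)^-1 ^+ n.+2)) /\
  derive1n n f z = n`!%:R / wind R * rect a b c d (fun w => f w * (w - z)^-1 ^+ n.+1).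
Proof.
move=> hf; have cf : cont_at (bdR a b c d) f.
  by apply: cont_atS (holo_cont hf) => w /bdR_on.
suff H m : (forall z, inR a b c d z -> derive1n m f z =
       m`!%:R / wind R * rect a b c d (fun w => f w * (w - z)^-1 ^+ m.+1)) ->
    forall z, inR a b c d z -> is_derive z (1 : C) (derive1n m f)
      (m.+1`!%:R / wind R * rect a b c d (fun w => f w * (w - z)^-1 ^+ m.+2)).
  have H2 : forall z, inR a b c d z -> derive1n n f z =
       n`!%:R / wind R * rect a b c d (fun w => f w * (w - z)^-1 ^+ n.+1).
    elim: n => [|n IH] z zin.
      rewrite /= fact0 mul1r mulrC; apply: (canRL (mulfK (wind_neq0 R))).
      rewrite -(cauchy_formula hf zin); have [ab cd] := inR_le zin.
      by apply: (rect_ext ab cd) => w _; rewrite expr1.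
    by rewrite derive1nS derive1E; have [_ ->] := H n IH z zin.
  by move=> z zin; split; [exact: H|exact: H2].
move=> Hm z zin; have [ab cd] := inR_le zin.
have D := rect_kernel_derive ab cd m.+1 cf (inR_nbd zin).
have D2 := is_deriveZ (m`!%:R / wind R) D.
have D3 : is_derive z (1 : C) (derive1n m f) (m`!%:R / wind R *
    rect a b c d (fun w => f w * (m.+1%:R * (w - z)^-1 ^+ m.+2))).
  apply: is_deriveC_ext D2; have := inR_nbhs zin; apply: filterS => w win.
  by rewrite (Hm w win).
apply: (is_derive_eq D3).
have cz := cauchy_kernel_cont (k := m.+2) cf zin.
have -> : rect a b c d (fun w => f w * (m.+1%:R * (w - z)^-1 ^+ m.+2)) =
    m.+1%:R * rect a b c d (fun w => f w * (w - z)^-1 ^+ m.+2).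
  rewrite -(rectZ ab cd _ cz); apply: (rect_ext ab cd) => w _; ring.
by rewrite factS natrM; ring.
Qed.

Lemma taylor_coef_cauchy f z (n : nat) : holo_on (onR a b c d) f -> inR a b c d z ->
  taylor_coef f z n = (wind R)^-1 * rect a b c d (fun w => f w * (w - z)^-1 ^+ n.+1).
Proof.
move=> hf zin; rewrite /taylor_coef; have [_ ->] := derive1n_cauchy n hf zin.
have n0 : (n`!%:R : C) != 0 by rewrite pnatr_eq0 -lt0n fact_gt0.
by field; rewrite n0 wind_neq0.
Qed.

(** [K] is chosen before [f] and [g]: this is the continuity of the [n]-th Taylor coefficient for
    uniform convergence on a rectangle. *)
Lemma taylor_coef_dist z (n : nat) : inR a b c d z -> exists2 K, 0 <= K &
  forall f g e, holo_on (onR a b c d) f -> holo_on (onR a b c d) g ->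
    (forall w, onR a b c d w -> cmod (f w - g w) <= e) ->
    cmod (taylor_coef f z n - taylor_coef g z n) <= K * e.
Proof.
move=> zin; have [ab cd] := inR_le zin.
have [N N0 HN] := inv_sub_bound zin.
exists (cmod (wind R)^-1 * (4 * N ^+ n.+1 * ((b - a) + (d - c)))).
  rewrite mulr_ge0 ?cmod_ge0// mulr_ge0//; last by rewrite addr_ge0// subr_ge0.
  by rewrite mulr_ge0// exprn_ge0.
move=> f g e hf hg fg.
have cf : cont_at (bdR a b c d) f by apply: cont_atS (holo_cont hf) => w /bdR_on.
have cg : cont_at (bdR a b c d) g by apply: cont_atS (holo_cont hg) => w /bdR_on.
have cf' := cauchy_kernel_cont (k := n.+1) cf zin; have cg' := cauchy_kernel_cont (k := n.+1) cg zin.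
rewrite (taylor_coef_cauchy n hf zin) (taylor_coef_cauchy n hg zin) -mulrBr cmodM -[leRHS]mulrA.
rewrite ler_wpM2l ?cmod_ge0// -(rectB ab cd cf' cg').
have cfg : cont_at (bdR a b c d) (fun w => f w * (w - z)^-1 ^+ n.+1 - g w * (w - z)^-1 ^+ n.+1).
  move=> w wb; have h1 := cf w wb; have h2 := cg w wb; have w0 := bdR_neq zin wb.
  by ccont.
have bd w : bdR a b c d w ->
    cmod (f w * (w - z)^-1 ^+ n.+1 - g w * (w - z)^-1 ^+ n.+1) <= e * N ^+ n.+1.
  move=> wb; rewrite -mulrBl cmodM; apply: ler_pM; rewrite ?cmod_ge0//.
    by apply: fg; exact: bdR_on.
  by rewrite cmodX lerXn2r ?nnegrE ?cmod_ge0// HN.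
apply: le_trans (rect_bound ab cd cfg bd) _.
by rewrite le_eqVlt; apply/orP; left; apply/eqP; ring.
Qed.

(** Expanding the kernel [1 / (w - (z + h))] to order [n] at [h = 0] leaves an exact remainder,
    [h ^+ n] times a contour integral that is bounded for small [h]. *)
Lemma taylor_remainder f z (n : nat) : holo_on (onR a b c d) f -> inR a b c d z ->
  exists K r, [/\ 0 <= K, 0 < r & forall h, cmod h < r ->
    cmod (f (z + h) - \sum_(k < n) taylor_coef f z k * h ^+ k) <= K * cmod h ^+ n].
Proof.
move=> hf zin; have [ab cd] := inR_le zin.
have cf : cont_at (bdR a b c d) f by apply: cont_atS (holo_cont hf) => w /bdR_on.
have main h : inR a b c d (z + h) ->
    (f (z + h) - \sum_(k < n) taylor_coef f z k * h ^+ k) * wind R =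
    h ^+ n * rect a b c d (fun w => f w * (w - z)^-1 ^+ n * (w - (z + h))^-1).
  move=> hin; elim: n => [|n IH].
    rewrite big_ord0 subr0 expr0 mul1r -(cauchy_formula hf hin).
    by apply: (rect_ext ab cd) => w _; rewrite expr0 mulr1.
  have -> : \sum_(k < n.+1) taylor_coef f z k * h ^+ k =
      \sum_(k < n) taylor_coef f z k * h ^+ k + taylor_coef f z n * h ^+ n.
    by rewrite big_ord_recr.
  rewrite opprD addrA mulrBl IH (taylor_coef_cauchy n hf zin).

  have c1 : cont_at (bdR a b c d) (fun w => f w * (w - z)^-1 ^+ n * (w - (z + h))^-1).
    move=> w wb; have h1 := cf w wb; have w0 := bdR_neq zin wb; have w1 := bdR_neq hin wb.
    by ccont.
  have c2 := cauchy_kernel_cont (k := n.+1) cf zin.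
  have -> : (wind R)^-1 * rect a b c d (fun w => f w * (w - z)^-1 ^+ n.+1) * h ^+ n * wind R =
      h ^+ n * rect a b c d (fun w => f w * (w - z)^-1 ^+ n.+1).
    by field; exact: wind_neq0.
  rewrite -mulrBr exprSr -mulrA; congr (_ * _); rewrite -(rectB ab cd c1 c2).
  have c3 : cont_at (bdR a b c d) (fun w => f w * (w - z)^-1 ^+ n.+1 * (w - (z + h))^-1).
    move=> w wb; have h1 := cf w wb; have w0 := bdR_neq zin wb; have w1 := bdR_neq hin wb.
    by ccont.
  rewrite -(rectZ ab cd h c3); apply: (rect_ext ab cd) => w wb.
  have w0 := bdR_neq zin wb; have w1 := bdR_neq hin wb.
  rewrite exprSr.
  have E : (w - (z + h))^-1 - (w - z)^-1 = h * ((w - z)^-1 * (w - (z + h))^-1).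
    by field; rewrite w0 w1.
  transitivity (f w * (w - z)^-1 ^+ n * ((w - (z + h))^-1 - (w - z)^-1)); first by ring.
  by rewrite E; ring.
have [M M0 fM] : exists2 M, 0 <= M & forall w, bdR a b c d w -> cmod (f w) <= M.
  have [f1 f2 f3 f4] := cont_at_edges ab cd cf.
  have [M1 M10 H1] := cont_on_bounded f1; have [M2 M20 H2] := cont_on_bounded f2.
  have [M3 M30 H3] := cont_on_bounded f3; have [M4 M40 H4] := cont_on_bounded f4.
  exists (M1 + M2 + M3 + M4); first by rewrite !addr_ge0.
  move=> w [[wx wy] wb]; rewrite -(mkC_eta w); case: wb => ->.
  - by have := H4 _ wy => /=; lra.
  - by have := H2 _ wy => /=; lra.
  - by have := H1 _ wx => /=; lra.
  - by have := H3 _ wx => /=; lra.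
have [e e0 He] := bdR_dist zin.
have /nbhs_cmodP[r1 r10 Hr1] := inR_nbhs zin.
(* On the boundary [M] bounds [f], [e^-1] bounds [1 / (w - z)], and [2 / e] bounds
   [1 / (w - (z + h))] as long as [cmod h < e / 2]. *)
pose L := 4 * (M * e^-1 ^+ n * (2 / e)) * ((b - a) + (d - c)).
exists (cmod (wind R)^-1 * L), (Num.min r1 (e / 2)).
have ei : 0 <= e^-1 by rewrite invr_ge0 ltW.
have ei2 : 0 <= 2 / e by rewrite divr_ge0// ltW.
split.
- rewrite mulr_ge0 ?cmod_ge0// mulr_ge0//; last by rewrite addr_ge0// subr_ge0.
  by rewrite mulr_ge0// mulr_ge0// mulr_ge0// exprn_ge0.
- by rewrite lt_min r10 divr_gt0.
move=> h; rewrite lt_min => /andP[hr he].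
have hin : inR a b c d (z + h) by apply: Hr1; rewrite (addrC z) addrK.
have -> : f (z + h) - \sum_(k < n) taylor_coef f z k * h ^+ k =
   (wind R)^-1 * (h ^+ n * rect a b c d (fun w => f w * (w - z)^-1 ^+ n * (w - (z + h))^-1)).
  by rewrite -(main h hin) mulrC mulfK// wind_neq0.
rewrite !cmodM mulrCA mulrC (cmodX h) ler_wpM2r ?exprn_ge0 ?cmod_ge0//.
rewrite ler_wpM2l ?cmod_ge0//.
have c1 : cont_at (bdR a b c d) (fun w => f w * (w - z)^-1 ^+ n * (w - (z + h))^-1).
  move=> w wb; have h1 := cf w wb; have w0 := bdR_neq zin wb; have w1 := bdR_neq hin wb.
  by ccont.
apply: (rect_bound ab cd c1) => w wb.
rewrite cmodM cmodM; apply: ler_pM; rewrite ?mulr_ge0 ?cmod_ge0//.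
  apply: ler_pM; rewrite ?cmod_ge0//; first exact: fM.
  rewrite cmodX lerXn2r ?nnegrE ?cmod_ge0// cmodV lef_pV2 ?posrE//; first exact: He.
  by rewrite cmod_gt0; exact: bdR_neq zin wb.
rewrite cmodV -[2 / e]invf_div lef_pV2 ?posrE ?divr_gt0//; last first.
  by rewrite cmod_gt0; exact: bdR_neq hin wb.
have := He w wb; have := cmod_tri w z (z + h).
by rewrite [z + h]addrC addrK => k1 k2; lra.
Qed.

End rectangle.

Lemma square_in z r : 0 < r -> inR (Re z - r) (Re z + r) (Im z - r) (Im z + r) z.
Proof. by move=> r0; split; apply/andP; split; lra. Qed.

Lemma square_cmod z r w : onR (Re z - r) (Re z + r) (Im z - r) (Im z + r) w ->
  cmod (w - z) <= 2 * r.
Proof.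
move=> [/andP[w1 w2] /andP[w3 w4]]; apply: le_trans (cmod_le_ReIm _) _; rewrite !ReImE.
have -> : 2 * r = r + r by ring.
by apply: lerD; rewrite ler_norml; apply/andP; split; lra.
Qed.

(** Cauchy's formula survives uniform limits, and a function represented by it can be differentiated
    under the integral sign. Taken with a constant approximation, the lemma also says that
    derivability is local. *)
Lemma holo_uniform_limit (A : set C) f z r : 0 < r ->
  (forall w, cmod (w - z) < r -> A w) ->
  (forall e, 0 < e -> exists2 g, holo_on A g &
     forall w, cmod (w - z) < r -> cmod (f w - g w) <= e) -> derivable f z 1.
Proof.
move=> r0 rA lim.
pose s := r / 4; have s0 : 0 < s by rewrite divr_gt0.
have zin := square_in z s0.
set a := Re z - s in zin *; set b := Re z + s in zin *.
set c := Im z - s in zin *; set d := Im z + s in zin *.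
have [ab cd] := inR_le zin.
have onr w : onR a b c d w -> cmod (w - z) < r.
  by move=> /square_cmod ws; apply: le_lt_trans ws _; rewrite /s; lra.
have cf w : cmod (w - z) < r -> {for w, continuous f}.
  move=> wr; apply/cont_cmodP => e e0; have e3 : 0 < e / 3 by rewrite divr_gt0.
  have [g hg fg] := lim _ e3.
  have /cont_cmodP /(_ _ e3) [de de0 Hde] := derivable_cont (hg w (rA _ wr)).
  exists (Num.min de (r - cmod (w - z))); first by rewrite lt_min de0 subr_gt0.
  move=> v; rewrite lt_min => /andP[vd vr].
  have vz : cmod (v - z) < r by have := cmod_tri v z w; lra.
  have := fg v vz; have := fg w wr; have := Hde v vd; rewrite (cmodBC (f w)).
  have := cmod_tri (f v) (f w) (g v); have := cmod_tri (g v) (f w) (g w); lra.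
have cfb : cont_at (bdR a b c d) f by move=> w /bdR_on /onr; exact: cf.
have key v : inR a b c d v -> rect a b c d (fun w => f w * (w - v)^-1 ^+ 1) = f v * wind R.
  move=> vin; have [N N0 HN] := inv_sub_bound vin.
  have ck := cauchy_kernel_cont (k := 1) cfb vin.
  pose L := 4 * N * ((b - a) + (d - c)) + cmod (wind R).
  have L0 : 0 <= L by rewrite addr_ge0 ?cmod_ge0// mulr_ge0 ?mulr_ge0// addr_ge0// subr_ge0.
  have main e : 0 < e ->
      cmod (rect a b c d (fun w => f w * (w - v)^-1 ^+ 1) - f v * wind R) <= e * L.
    move=> e0; have [g hg fg] := lim _ e0.
    have hgR : holo_on (onR a b c d) g by move=> w /onr /rA; exact: hg.
    have cg : cont_at (bdR a b c d) g by apply: cont_atS (holo_cont hgR) => w /bdR_on.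
    have ckg := cauchy_kernel_cont (k := 1) cg vin.
    have E : rect a b c d (fun w => g w * (w - v)^-1 ^+ 1) = g v * wind R.
      by rewrite -(cauchy_formula hgR vin); apply: (rect_ext ab cd) => w _; rewrite expr1.
    have cc : cont_at (bdR a b c d) (fun w => f w * (w - v)^-1 ^+ 1 - g w * (w - v)^-1 ^+ 1).
      move=> w wb; have h1 := cfb w wb; have h2 := cg w wb; have w0 := bdR_neq vin wb.
      by ccont.
    have B : cmod (rect a b c d (fun w => f w * (w - v)^-1 ^+ 1)
       - rect a b c d (fun w => g w * (w - v)^-1 ^+ 1)) <= 4 * (e * N) * ((b - a) + (d - c)).
      rewrite -(rectB ab cd ck ckg); apply: (rect_bound ab cd cc) => w wb.
      rewrite -mulrBl expr1 cmodM; apply: ler_pM; rewrite ?cmod_ge0//.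
        by apply: fg; apply: onr; exact: bdR_on.
      exact: HN.
    apply: le_trans (cmod_tri _ _ (rect a b c d (fun w => g w * (w - v)^-1 ^+ 1))) _.
    rewrite {2}E -mulrBl cmodM.
    have := fg v (onr _ (inR_on vin)); rewrite cmodBC => hv.
    have -> : e * L = 4 * (e * N) * (b - a + (d - c)) + e * cmod (wind R) by rewrite /L; ring.
    by apply: lerD => //; rewrite ler_wpM2r ?cmod_ge0.
  apply/eqP; rewrite -subr_eq0 -cmod_eq0 eq_le cmod_ge0 andbT leNgt; apply/negP => h.
  have L1 : 0 < L + 1 by lra.
  have := main _ (divr_gt0 h L1); rewrite mulrAC ler_pdivlMr// ler_pM2l//; lra.
have D := rect_kernel_derive ab cd 1 cfb (inR_nbd zin).
have D2 := is_deriveZ (wind R)^-1 D.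
suff [] : is_derive z (1 : C) f ((wind R)^-1 *: rect a b c d (fun w => f w * (1%:R * (w - z)^-1 ^+ 2))).
  by [].
apply: is_deriveC_ext D2; have := inR_nbhs zin; apply: filterS => v vin.
by rewrite /= (key v vin) /GRing.scale /= mulrC mulfK// wind_neq0.
Qed.

End CauchyEstimates.

(** * Uniform approximation by polynomials and pole pushing *)

Section PolynomialApproximation.
Variable R : realType.
Local Notation C := (Cplx R).
Implicit Types (z w a b u : C) (r e M : R) (f g : C -> C) (Z : set C).

Definition papprox Z g := forall e, 0 < e -> exists P : {poly C},
  forall z, Z z -> cmod (P.[z] - g z) <= e.

Lemma poly_bounded (P : {poly C}) M : exists2 N, 0 <= N &
  forall z, cmod z <= M -> cmod P.[z] <= N.
Proof.
exists (\sum_(i < size P) cmod P`_i * `|M| ^+ i).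
  by apply: sumr_ge0 => i _; rewrite mulr_ge0 ?cmod_ge0// exprn_ge0.
move=> z zM; rewrite horner_coef; apply: le_trans (cmod_sum _ _ _) _.
apply: ler_sum => i _; rewrite cmodM cmodX ler_wpM2l ?cmod_ge0//.
by rewrite lerXn2r ?nnegrE ?cmod_ge0// (le_trans zM) ?ler_norm.
Qed.

Section fixed_set.
Variables (Z : set C) (M : R).
Hypothesis ZM : forall z, Z z -> cmod z <= M.

Lemma papprox_ext f g : (forall z, Z z -> f z = g z) -> papprox Z f -> papprox Z g.
Proof.
by move=> fg hf e e0; have [P HP] := hf e e0; exists P => z Zz; rewrite -fg//; exact: HP.
Qed.

Lemma papprox_poly (P : {poly C}) : papprox Z (fun z => P.[z]).
Proof. by move=> e e0; exists P => z _; rewrite subrr cmod0 ltW. Qed.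

Lemma papprox_cst (k : C) : papprox Z (fun=> k).
Proof.
by apply: papprox_ext (papprox_poly k%:P) => z _; rewrite hornerC.
Qed.

Lemma papproxD f g : papprox Z f -> papprox Z g -> papprox Z (fun z => f z + g z).
Proof.
move=> hf hg e e0; have e2 : 0 < e / 2 by rewrite divr_gt0.
have [P HP] := hf _ e2; have [Q HQ] := hg _ e2; exists (P + Q) => z Zz.
rewrite hornerD opprD addrACA; apply: le_trans (cmodD _ _) _.
by rewrite (splitr e); apply: lerD; [exact: HP|exact: HQ].
Qed.

Lemma papprox_bounded f : papprox Z f -> exists2 N, 0 <= N & forall z, Z z -> cmod (f z) <= N.
Proof.
move=> /(_ 1 ltr01)[P HP]; have [N N0 HN] := poly_bounded P M.
exists (N + 1); first by rewrite addr_ge0.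
move=> z Zz; have := HP z Zz; have := HN z (ZM Zz).
by have := cmod_ler_sub (f z) P.[z]; rewrite (cmodBC (f z)); lra.
Qed.

Lemma papproxM f g : papprox Z f -> papprox Z g -> papprox Z (fun z => f z * g z).
Proof.
move=> hf hg e e0; have [N N0 HN] := papprox_bounded hf.
have N1 : 0 < N + 1 by lra.
have [Q HQ] := hg _ (divr_gt0 (divr_gt0 e0 (@ltr0n R 2)) N1).
have [N' N0' HN'] := poly_bounded Q M; have N1' : 0 < N' + 1 by lra.
have [P HP] := hf _ (divr_gt0 (divr_gt0 e0 (@ltr0n R 2)) N1').
exists (P * Q) => z Zz; rewrite hornerM.
have -> : P.[z] * Q.[z] - f z * g z = (P.[z] - f z) * Q.[z] + f z * (Q.[z] - g z) by ring.
apply: le_trans (cmodD _ _) _; rewrite !cmodM (splitr e).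
apply: lerD.
  apply: (@le_trans _ _ (e / 2 / (N' + 1) * (N' + 1))); last by rewrite divfK// gt_eqF.
  apply: ler_pM; rewrite ?cmod_ge0 ?HP//.
  by have := HN' z (ZM Zz); lra.
rewrite mulrC; apply: (@le_trans _ _ (e / 2 / (N + 1) * (N + 1))); last by rewrite divfK// gt_eqF.
apply: ler_pM; rewrite ?cmod_ge0 ?HQ//.
by have := HN z Zz; lra.
Qed.

Lemma papproxZ (k : C) f : papprox Z f -> papprox Z (fun z => k * f z).
Proof. exact: papproxM (papprox_cst k). Qed.

Lemma papproxX n f : papprox Z f -> papprox Z (fun z => f z ^+ n).
Proof.
move=> hf; elim: n => [|n IH].
  by apply: papprox_ext (papprox_cst 1) => z _; rewrite expr0.
by apply: papprox_ext (papproxM hf IH) => z _; rewrite exprS.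
Qed.

Lemma papprox_sum n (F : 'I_n -> C -> C) : (forall i, papprox Z (F i)) ->
  papprox Z (fun z => \sum_(i < n) F i z).
Proof.
elim: n F => [|n IH] F hF.
  by apply: papprox_ext (papprox_cst 0) => z _; rewrite big_ord0.
apply: papprox_ext (papproxD (IH (fun i => F (widen_ord (leqnSn n) i)) _) (hF ord_max)) => [z _|i].
  by rewrite big_ord_recr.
exact: hF.
Qed.

Lemma papprox_lim f :
  (forall e, 0 < e -> exists2 g, papprox Z g & forall z, Z z -> cmod (g z - f z) <= e) ->
  papprox Z f.
Proof.
move=> H e e0; have e2 : 0 < e / 2 by rewrite divr_gt0.
have [g hg gf] := H _ e2; have [P HP] := hg _ e2; exists P => z Zz.
apply: le_trans (cmod_tri _ _ (g z)) _; rewrite (splitr e).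
by apply: lerD; [exact: HP|exact: gf].
Qed.

Lemma geometric_remainder (x u : C) n : x != 0 -> x - u != 0 ->
  (x - u)^-1 = \sum_(k < n) u ^+ k * x^-1 ^+ k.+1 + u ^+ n * x^-1 ^+ n * (x - u)^-1.
Proof.
move=> x0 xu0; elim: n => [|n IH]; first by rewrite big_ord0 add0r !expr0 !mul1r.
rewrite big_ord_recr /= {1}IH -addrA; congr (_ + _).
by rewrite !exprS; field; rewrite x0 xu0.
Qed.

(* The geometric series for [1 / (x - u)] converges when [|u| <= |x| / 2]. *)
Lemma geometric_remainder_bound (x u : C) n r : 0 < r -> r <= cmod x -> cmod u <= r / 2 ->
  cmod (u ^+ n * x^-1 ^+ n * (x - u)^-1) <= (2 / r) / 2 ^+ n.
Proof.
move=> r0 rx ur.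
have x0 : 0 < cmod x by apply: lt_le_trans rx.
have xur : r / 2 <= cmod (x - u) by have := cmod_ler_sub x u; lra.
rewrite cmodM -exprMn cmodX mulrC; apply: ler_pM; rewrite ?exprn_ge0 ?cmod_ge0//.
  rewrite cmodV -[2 / r]invf_div lef_pV2 ?posrE ?divr_gt0//.
  by apply: lt_le_trans xur; rewrite divr_gt0.
rewrite -exprVn lerXn2r ?nnegrE ?cmod_ge0 ?invr_ge0//.
by rewrite cmodM cmodV ler_pdivrMr//; lra.
Qed.

(** [1 / (z - b)] is a geometric series in [(b - a) / (z - a)], whose modulus on [Z] is at most
    [1 / 2]. *)
Lemma pole_push a b r : 0 < r -> (forall z, Z z -> r <= cmod (z - a)) ->
  cmod (b - a) <= r / 2 -> papprox Z (fun z => (z - a)^-1) -> papprox Z (fun z => (z - b)^-1).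
Proof.
move=> r0 Zr ba ha; apply: papprox_lim => e e0.
have [n hn] := half_pow_small (2 / r) e0.
exists (fun z => \sum_(k < n) (b - a) ^+ k * (z - a)^-1 ^+ k.+1).
  by apply: papprox_sum => i; apply: papproxZ; exact: papproxX.
move=> z Zz; have za := Zr z Zz.
have x0 : z - a != 0 by rewrite -cmod_gt0; exact: lt_le_trans za.
have xu0 : z - a - (b - a) != 0.
  by rewrite -cmod_gt0; have := cmod_ler_sub (z - a) (b - a); lra.
have := geometric_remainder n x0 xu0; have -> : z - a - (b - a) = z - b by ring.
move=> ->; rewrite opprD addrA subrr sub0r cmodN.
have -> : z - b = z - a - (b - a) by ring.
exact: le_trans (geometric_remainder_bound n r0 za ba) (ltW hn).
Qed.

(** Here the series runs in powers of [z / a], so its partial sums are polynomials. The added [1]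
    keeps the threshold positive when [M = 0]. *)
Lemma pole_far a : cmod a >= 2 * M + 1 -> papprox Z (fun z => (z - a)^-1).
Proof.
move=> aM; have [[z0 Zz0]|nZ] := pselect (Z !=set0); last first.
  by move=> e e0; exists 0 => z Zz; exfalso; apply: nZ; exists z.
have M0 : 0 <= M by apply: le_trans (ZM Zz0); exact: cmod_ge0.
have r0 : 0 < 2 * M + 1 by lra.
apply: papprox_lim => e e0; have [n hn] := half_pow_small (2 / (2 * M + 1)) e0.
have h : papprox Z (fun z => -1 * \sum_(k < n) 'X.[z] ^+ k * a^-1 ^+ k.+1).
  apply: papproxZ; apply: papprox_sum => i; apply: papproxM; last exact: papprox_cst.
  by apply: papproxX; exact: papprox_poly.
exists (fun z => -1 * \sum_(k < n) z ^+ k * a^-1 ^+ k.+1).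
  by apply: papprox_ext h => z _; rewrite hornerX.
move=> z Zz; have zM := ZM Zz.
have a0 : a != 0 by rewrite -cmod_gt0; exact: lt_le_trans aM.
have az0 : a - z != 0 by rewrite -cmod_gt0; have := cmod_ler_sub a z; lra.
have -> : (z - a)^-1 = - (a - z)^-1 by rewrite -invrN opprB.
rewrite (geometric_remainder n a0 az0) mulN1r opprK addKr; apply: le_trans (geometric_remainder_bound n r0 aM _) (ltW hn).
by lra.
Qed.

(** The set of admissible poles contains all distant points and is open and closed in the complement
    of [Z], hence equals it. *)
Lemma papprox_pole a : compact Z -> connected (~` Z) -> ~ Z a -> papprox Z (fun z => (z - a)^-1).
Proof.
move=> cZ connZ nZa; have clZ := compactC_closed cZ.
have distZ b : ~ Z b -> exists2 r, 0 < r & forall z, Z z -> r <= cmod (z - b).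
  move=> nZb; have [|r r0 Hr] := compact_closed_dist (@compact_set1 _ b) clZ.
    by rewrite -subset0 => z [/= -> /nZb].
  by exists r => // z Zz; rewrite cmodBC; exact: Hr.
pose S := [set b | ~ Z b /\ papprox Z (fun z => (z - b)^-1)].
(* With [r / 3] the pole can also be pushed back: [c] is still at distance [2 * r / 3] from [Z], and
   half of that is [r / 3]. *)
have near b c r : 0 < r -> (forall z, Z z -> r <= cmod (z - b)) -> cmod (c - b) <= r / 3 ->
    papprox Z (fun z => (z - b)^-1) <-> papprox Z (fun z => (z - c)^-1).
  move=> r0 Hr cb; split; first by apply: (pole_push r0 Hr); lra.
  have r2 : 0 < 2 * r / 3 by rewrite !mulr_gt0.
  apply: (pole_push r2); last by rewrite cmodBC; lra.
  move=> z Zz; have := Hr z Zz; have := cmod_tri z b c; lra.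
suff E : S = ~` Z by have [] : S a by rewrite E. 
apply: connZ.
- exists (mkC (2 * `|M| + 1) 0).
  have h : cmod (mkC (2 * `|M| + 1) 0 : C) = 2 * `|M| + 1.
    by rewrite cmod_mkC0 ger0_norm// addr_ge0// mulr_ge0.
  split.
    move=> /ZM; rewrite h; have := ler_norm M; have := normr_ge0 M; lra.
  by apply: pole_far; rewrite h; have := ler_norm M; lra.
- exists S; last by rewrite setIC; apply/esym/setIidl => b [].
  apply/openC_cmodP => b [nZb hb]; have [r r0 Hr] := distZ b nZb.
  exists (r / 3); first by rewrite divr_gt0.
  move=> c cb; split; last by apply/(near b c r r0 Hr) => //; exact: ltW.
  by move=> Zc; have := Hr c Zc; lra.
- exists (closure S); first exact: closed_closure.
  rewrite predeqE => b; split; first by move=> Sb; split; [case: Sb|exact: subset_closure].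
  move=> [nZb clb]; split => //; have [r r0 Hr] := distZ b nZb.
  have r3 : 0 < r / 3 by rewrite divr_gt0.
  have [|c [[nZc hc] /= cb]] := clb [set c | cmod (c - b) < r / 3].
    by apply/nbhs_cmodP; exists (r / 3).
  by apply/(near b c r r0 Hr) => //; exact: ltW.
Qed.

(* An integral of the Cauchy kernel over a short arc has, away from the arc, a
   convergent expansion in powers of [1 / (z - a)] for a centre [a] near the arc. *)
Lemma papprox_edge (s t : R) (g p : R -> C) a r : s <= t -> cont_on s t g -> cont_on s t p ->
  0 < r -> (forall x, s <= x <= t -> cmod (p x - a) <= r / 2) ->
  (forall z, Z z -> r <= cmod (z - a)) -> papprox Z (fun z => (z - a)^-1) ->
  papprox Z (fun z => cint s t (fun x => g x * (p x - z)^-1)).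
Proof.
move=> st cg cp r0 pa Zr ha.
have pz z x : Z z -> s <= x <= t -> p x - z != 0.
  move=> Zz xst; rewrite -cmod_gt0; have := Zr z Zz; have := pa x xst.
  by have := cmod_tri z a (p x); rewrite (cmodBC z (p x)); lra.

have za z : Z z -> z - a != 0.
  by move=> Zz; rewrite -cmod_gt0; apply: lt_le_trans (Zr z Zz).
pose T n z := cint s t (fun x => g x * (p x - a) ^+ n * (p x - z)^-1).
have cT n z : Z z -> cont_on s t (fun x => g x * (p x - a) ^+ n * (p x - z)^-1).
  by move=> Zz x xst; have h1 := cg x xst; have h2 := cp x xst; have h3 := pz z x Zz xst; ccont.
have cI n : cont_on s t (fun x => g x * (p x - a) ^+ n).
  by move=> x xst; have h1 := cg x xst; have h2 := cp x xst; ccont.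
(* From [1 / (p - z) = (-1 + (p - a) / (p - z)) / (z - a)]: each use splits off one power of
   [1 / (z - a)] whose coefficient does not depend on [z]. *)
have step n z : Z z -> (z - a)^-1 ^+ n * T n z =
    - cint s t (fun x => g x * (p x - a) ^+ n) * (z - a)^-1 ^+ n.+1 + (z - a)^-1 ^+ n.+1 * T n.+1 z.
  move=> Zz; suff -> : T n z = (z - a)^-1 * (-1 * cint s t (fun x => g x * (p x - a) ^+ n) + T n.+1 z).
    by rewrite exprSr; ring.
  rewrite /T -(cintZ (-1) (cI n)) -cintD; last 2 first.
  - by move=> x xst; have h1 := cg x xst; have h2 := cp x xst; ccont.
  - exact: (cT n.+1 z Zz).
  rewrite -cintZ; last first.
    by move=> x xst; have h1 := cg x xst; have h2 := cp x xst; have h3 := pz z x Zz xst; ccont.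
  apply: cint_ext => x xst; have h3 := pz z x Zz xst; have h4 := za z Zz.
  by rewrite exprSr; field; rewrite h3 h4.
have expand n : exists2 G, papprox Z G & forall z, Z z -> T 0%N z = G z + (z - a)^-1 ^+ n * T n z.
  elim: n => [|n [G hG E]].
    exists (fun=> 0); first exact: papprox_cst.
    by move=> z _; rewrite add0r expr0 mul1r.
  exists (fun z => G z + - cint s t (fun x => g x * (p x - a) ^+ n) * (z - a)^-1 ^+ n.+1).
    by apply: papproxD hG _; apply: papproxZ; exact: papproxX.
  by move=> z Zz; rewrite (E z Zz) (step n z Zz) addrA.
have [N N0 HN] := cont_on_bounded cg.
apply: papprox_lim => e e0.
pose W := 2 * N * (2 / r) * (t - s) + 1.
have W0 : 0 <= 2 * N * (2 / r) * (t - s).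
  have r2 : 0 <= 2 / r by rewrite divr_ge0// ltW.
  by apply: mulr_ge0; [apply: mulr_ge0 => //; exact: mulr_ge0|rewrite subr_ge0].

have [n hn] := half_pow_small W e0.
have [G hG E] := expand n; exists G => // z Zz.
have -> : cint s t (fun x => g x * (p x - z)^-1) = T 0%N z.
  by apply: cint_ext => x _; rewrite expr0 mulr1.
rewrite (E z Zz) opprD addrA subrr sub0r cmodN /T -cintZ; last exact: cT.
have b x : s <= x <= t -> cmod ((z - a)^-1 ^+ n * (g x * (p x - a) ^+ n * (p x - z)^-1)) <=
    N * (2 / r / 2 ^+ n).
  move=> xst.
  have -> : (z - a)^-1 ^+ n * (g x * (p x - a) ^+ n * (p x - z)^-1) =
     g x * - ((p x - a) ^+ n * (z - a)^-1 ^+ n * ((z - a) - (p x - a))^-1).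
    have -> : (z - a) - (p x - a) = - (p x - z) by ring.
    by rewrite invrN; ring.
  rewrite cmodM cmodN; apply: ler_pM; rewrite ?cmod_ge0 ?HN//.
  by apply: geometric_remainder_bound; [exact: r0|exact: Zr|exact: pa].
have cc : cont_on s t (fun x => (z - a)^-1 ^+ n * (g x * (p x - a) ^+ n * (p x - z)^-1)).
  by apply: cont_onZ; exact: cT.
apply: le_trans (cint_bound st cc b) _; apply: le_trans (ltW hn).
have -> : 2 * (N * (2 / r / 2 ^+ n)) * (t - s) = (2 * N * (2 / r) * (t - s)) / 2 ^+ n by ring.
by rewrite ler_wpM2r ?invr_ge0 ?exprn_ge0// /W lerDl.
Qed.

End fixed_set.

End PolynomialApproximation.

(** * Runge's theorem by Cauchy integrals over a grid *)

Section Runge.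
Variable R : realType.
Local Notation C := (Cplx R).
Local Notation Re := (@complex.Re R).
Local Notation Im := (@complex.Im R).
Implicit Types (z w v : C) (x y t r e M : R) (f g : C -> C) (K L : set C).

Lemma sum_telescope (s h : nat -> C) n : s 0%N = 0 -> s n = 0 ->
  \sum_(j < n) s j * (h j - h j.+1) = \sum_(j < n) (s j.+1 - s j) * h j.+1.
Proof.
move=> s0 sn; apply/eqP; rewrite -subr_eq0 -sumrB.
have -> : \sum_(j < n) (s j * (h j - h j.+1) - (s j.+1 - s j) * h j.+1) =
    \sum_(0 <= j < n) - (s j.+1 * h j.+1 - s j * h j).
  by rewrite big_mkord; apply: eq_bigr => j _; ring.
by rewrite sumrN telescope_sumr// sn s0 !mul0r subrr oppr0.
Qed.

Lemma contC_sum n (F : 'I_n -> C -> C) z : (forall i, {for z, continuous (F i)}) ->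
  {for z, continuous (fun v => \sum_(i < n) F i v)}.
Proof.
elim: n F => [|n IH] F cF.
  have -> : (fun v => \sum_(i < 0) F i v) = fun=> 0 by apply/funext => v; rewrite big_ord0.
  exact: cont_cst.
have -> : (fun v => \sum_(i < n.+1) F i v) =
    (fun v => \sum_(i < n) F (widen_ord (leqnSn n) i) v + F ord_max v).
  by apply/funext => v; rewrite big_ord_recr.
by apply: contD; [apply: IH => i; exact: cF|exact: cF].
Qed.

Section grid.
Variables (A s : R) (n : nat).
Hypotheses (s0 : 0 < s) (As : A <= - A + n%:R * s).

Definition grid (i : nat) : R := - A + i%:R * s.

Lemma grid_mono i j : (i <= j)%N -> grid i <= grid j.
Proof. by move=> ij; rewrite /grid lerD2l ler_pM2r// ler_nat. Qed.

Lemma gridS i : grid i.+1 = grid i + s.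
Proof. by rewrite /grid -natr1; ring. Qed.

Definition cell i j : set C := onR (grid i) (grid i.+1) (grid j) (grid j.+1).

Lemma grid_le i : grid i <= grid i.+1. Proof. exact: grid_mono. Qed.

Lemma grid_floor x : - A <= x -> x < A ->
  exists2 i, (i < n)%N & grid i <= x < grid i.+1.
Proof.
move=> Ax xA; have h0 : 0 <= (x + A) / s by apply: divr_ge0; [lra|exact: ltW].
have /andP[h1 h2] := truncn_itv h0.
move: h1 h2; rewrite ler_pdivlMr// ltr_pdivrMr// => h1 h2.
exists (Num.truncn ((x + A) / s)); last by rewrite /grid; apply/andP; split; lra.
rewrite -(ltr_nat R) -(ltr_pM2r s0); apply: le_lt_trans h1 _.
have As' : A + A <= n%:R * s by move: As; lra.
by apply: lt_le_trans As'; lra.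
Qed.

Lemma cell_dist i j w w' : cell i j w -> cell i j w' -> cmod (w - w') <= 2 * s.
Proof.
move=> [/andP[a1 a2] /andP[a3 a4]] [/andP[b1 b2] /andP[b3 b4]].
rewrite !gridS in a2 a4 b2 b4; apply: le_trans (cmod_le_ReIm _) _; rewrite !ReImE.
have -> : 2 * s = s + s by ring.
by apply: lerD; rewrite ler_norml; apply/andP; split; lra.
Qed.

Lemma inR_cell_uniq i j i' j' z : inR (grid i) (grid i.+1) (grid j) (grid j.+1) z ->
  cell i' j' z -> i' = i /\ j' = j.
Proof.
have H p q x : grid p < x -> x < grid p.+1 -> grid q <= x -> x <= grid q.+1 -> q = p.
  move=> h1 h2 h3 h4; apply/eqP; rewrite eqn_leq; apply/andP; split; rewrite leqNgt;
    apply/negP => /grid_mono h; lra.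
move=> [/andP[a1 a2] /andP[a3 a4]] [/andP[b1 b2] /andP[b3 b4]].
by split; [apply: H b1 b2|apply: H b3 b4].
Qed.

Variable S : nat -> nat -> bool.
Hypotheses (S0l : forall j, S 0%N j = false) (S0r : forall j, S n j = false)
  (Sl0 : forall i, S i 0%N = false) (Sr0 : forall i, S i n = false).

Local Notation b2C b := ((nat_of_bool b)%:R : C).

Definition cell_sum g : C :=
  \sum_(i < n) \sum_(j < n) b2C (S i j) * rect (grid i) (grid i.+1) (grid j) (grid j.+1) g.

(** Each edge is weighted by the difference of the indicators [S] of its two neighbouring cells, so
    only edges between a selected and an unselected cell count. *)
Definition edge_sum g : C :=
  \sum_(i < n) \sum_(j < n) (b2C (S i j.+1) - b2C (S i j)) * hint (grid j.+1) (grid i) (grid i.+1) g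
  - \sum_(j < n) \sum_(i < n) (b2C (S i.+1 j) - b2C (S i j)) * vint (grid i.+1) (grid j) (grid j.+1) g.

(* Interior edges cancel in the sum of the boundary integrals. *)
Lemma cell_sumE g : cell_sum g = edge_sum g.
Proof.
rewrite /cell_sum /edge_sum.
have -> : \sum_(i < n) \sum_(j < n) b2C (S i j) * rect (grid i) (grid i.+1) (grid j) (grid j.+1) g =
   \sum_(i < n) \sum_(j < n) b2C (S i j) * (hint (grid j) (grid i) (grid i.+1) g
      - hint (grid j.+1) (grid i) (grid i.+1) g)
   - \sum_(i < n) \sum_(j < n) b2C (S i j) * (vint (grid i) (grid j) (grid j.+1) g
      - vint (grid i.+1) (grid j) (grid j.+1) g).
  rewrite -sumrB; apply: eq_bigr => i _; rewrite -sumrB; apply: eq_bigr => j _.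
  by rewrite /rect; ring.
congr (_ - _).
  apply: eq_bigr => i _.
  apply: (sum_telescope (s := fun j => b2C (S i j))
     (fun j => hint (grid j) (grid i) (grid i.+1) g)); by rewrite ?Sl0 ?Sr0.
rewrite exchange_big; apply: eq_bigr => j _.
apply: (sum_telescope (s := fun i => b2C (S i j))
     (fun i => vint (grid i) (grid j) (grid j.+1) g)); by rewrite ?S0l ?S0r.
Qed.

End grid.

(** The cells near [L] are selected and the Cauchy integrals over their boundaries added: the sum
    [T] is [f z * wind R] on [L] and [0] on [K], although no function defined near both sets is
    given. After cancellation only edges away from both [K] and [L] remain, and on such edges [T] is
    approximable by polynomials. *)
Theorem runge (Omega : set C) K L f e : compact K -> compact L -> open Omega ->
  K `<=` ~` Omega -> L `<=` Omega -> connected (~` (K `|` L)) -> holo_on Omega f -> 0 < e ->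
  exists P : {poly C}, (forall z, L z -> cmod (P.[z] - f z) <= e) /\
    (forall z, K z -> cmod P.[z] <= e).
Proof.
move=> cK cL oO KO LO conn hf e0.
have [D D0 HD] : exists2 D, 0 < D & forall z w, L z -> (~` Omega) w -> D <= cmod (z - w).
  apply: compact_closed_dist => //; first exact: open_closedC.
  by rewrite -subset0 => z [/LO].
have cZ : compact (K `|` L) by exact: compactU.
have [M' HM'] := compactC_bounded cZ; pose M := `|M'|.
have HM z : (K `|` L) z -> cmod z <= M by move=> /HM' h; apply: le_trans h (ler_norm _).
have M0 : 0 <= M by exact: normr_ge0.
(* [A] leaves a margin that keeps selected cells off the border of the grid. Points of one cell are
   at most [2 * s = D / 10] apart: a cell within [D / 4] of [L] then stays [D / 2] away from the
   complement of [Omega], and an edge fits the radius [(D / 4) / 2] required by [papprox_edge]. *)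
pose A := M + D; pose s := D / 20; have s0 : 0 < s by rewrite divr_gt0.
pose n := Num.truncn (2 * A / s); pose nn := n.+1.
have As : A <= - A + nn%:R * s.
  have h0 : 0 <= 2 * A / s by rewrite divr_ge0 ?mulr_ge0 ?addr_ge0// ltW.
  have /andP[_] := truncn_itv h0; rewrite ltr_pdivrMr// -/n -/nn; lra.
pose gr := grid A s.
pose S i j := `[< exists w l, [/\ cell A s i j w, L l & cmod (w - l) <= D / 4] >].
have SP i j : reflect (exists w l, [/\ cell A s i j w, L l & cmod (w - l) <= D / 4]) (S i j).
  exact: asboolP.
have ReL l : L l -> - M <= Re l <= M.
  by move=> Ll; rewrite -ler_norml; apply: le_trans (Re_le_cmod _) _; apply: HM; right.
have ImL l : L l -> - M <= Im l <= M.
  by move=> Ll; rewrite -ler_norml; apply: le_trans (Im_le_cmod _) _; apply: HM; right.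
have far1 x y : `|x - y| <= D / 4 -> - M <= y <= M -> - A + D / 2 < x /\ x < A - D / 2.
  by rewrite ler_norml /A => /andP[? ?] /andP[? ?]; split; lra.
have S0l j : S 0%N j = false.
  apply/negbTE/negP => /SP[w [l [[/andP[w1 w2] _] Ll wl]]].
  have [] := far1 (Re w) (Re l) _ (ReL l Ll).
    by have := Re_le_cmod (w - l); rewrite !ReImE; lra.
  by move: w2; rewrite gridS /grid mul0r /s; lra.
have S0r j : S nn j = false.
  apply/negbTE/negP => /SP[w [l [[/andP[w1 w2] _] Ll wl]]].
  have [] := far1 (Re w) (Re l) _ (ReL l Ll).
    by have := Re_le_cmod (w - l); rewrite !ReImE; lra.
  by move: w1; rewrite /grid; lra.
have Sl0 i : S i 0%N = false.
  apply/negbTE/negP => /SP[w [l [[_ /andP[w1 w2]] Ll wl]]].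
  have [] := far1 (Im w) (Im l) _ (ImL l Ll).
    by have := Im_le_cmod (w - l); rewrite !ReImE; lra.
  by move: w2; rewrite gridS /grid mul0r /s; lra.
have Sr0 i : S i nn = false.
  apply/negbTE/negP => /SP[w [l [[_ /andP[w1 w2]] Ll wl]]].
  have [] := far1 (Im w) (Im l) _ (ImL l Ll).
    by have := Im_le_cmod (w - l); rewrite !ReImE; lra.
  by move: w1; rewrite /grid; lra.
have Sfar i j w v : S i j -> cell A s i j w -> ~ Omega v -> D / 2 <= cmod (w - v).
  move=> /SP[w' [l [cw' Ll wl]]] cw nv; have := HD l v Ll nv.
  have := cell_dist cw cw'; have := cmod_tri w' l w; have := cmod_tri l v w'.
  by have := cmod_tri w' v w; rewrite (cmodBC w' w) (cmodBC l w') /s; lra.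
have SO i j : S i j -> cell A s i j `<=` Omega.
  move=> Sij w cw; apply: contrapT => nw; have := Sfar i j w w Sij cw nw.
  by rewrite subrr cmod0; lra.
have nSfar i j w l : ~~ S i j -> cell A s i j w -> L l -> D / 4 <= cmod (w - l).
  move=> /SP nS cw Ll; rewrite leNgt; apply/negP => h; apply: nS; exists w, l.
  by split => //; exact: ltW.
(* A surviving edge lies in a selected cell, hence is far from [K], and in an unselected one, hence
   is far from [L]. *)
have edge_far i j i' j' w z : S i j != S i' j' -> cell A s i j w -> cell A s i' j' w ->
    (K `|` L) z -> D / 4 <= cmod (w - z).
  move=> SS cw cw'; case=> [/KO nz|Lz].
    apply: (@le_trans _ _ (D / 2)); first by lra.
    by case Sij : (S i j) SS => SS; [apply: Sfar Sij cw nz|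
      case Sij' : (S i' j') SS => // _; apply: Sfar Sij' cw' nz].
  case Sij : (S i j) SS => SS.
    by apply: (nSfar i' j' w z) cw' Lz; case: (S i' j') SS.
  by apply: (nSfar i j w z) cw Lz; rewrite Sij.
have edge_O i j i' j' w : S i j != S i' j' -> cell A s i j w -> cell A s i' j' w -> Omega w.
  move=> SS cw cw'; case Sij : (S i j) SS => SS; first exact: SO Sij _ cw.
  by case Sij' : (S i' j') SS => // _; exact: SO Sij' _ cw'.
have hcell1 i j x : gr i <= x <= gr i.+1 -> cell A s i j (mkC x (gr j.+1)).
  by move=> xi; split=> //=; rewrite lexx andbT; exact: grid_le.
have hcell2 i j x : gr i <= x <= gr i.+1 -> cell A s i j.+1 (mkC x (gr j.+1)).
  by move=> xi; split=> //=; rewrite lexx; exact: grid_le.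
have vcell1 i j x : gr j <= x <= gr j.+1 -> cell A s i j (mkC (gr i.+1) x).
  by move=> xi; split=> //=; rewrite lexx andbT; exact: grid_le.
have vcell2 i j x : gr j <= x <= gr j.+1 -> cell A s i.+1 j (mkC (gr i.+1) x).
  by move=> xi; split=> //=; rewrite lexx; exact: grid_le.
have gle i : gr i <= gr i.+1 by exact: grid_le.
have gin i : gr i <= gr i <= gr i.+1 by rewrite lexx gle.
have D8 : 0 < D / 4 by rewrite divr_gt0.
pose T z := edge_sum A s nn S (fun w => f w * (w - z)^-1).
have pT : papprox (K `|` L) T.
  have pH i j : papprox (K `|` L) (fun z => ((nat_of_bool (S i j.+1))%:R - (nat_of_bool (S i j))%:R)
      * hint (gr j.+1) (gr i) (gr i.+1) (fun w => f w * (w - z)^-1)).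
    have [->|SS] := eqVneq (S i j.+1) (S i j).
      apply: (papprox_ext (f := fun=> 0)) => [z _|]; last exact: papprox_cst.
      by rewrite subrr mul0r.
    apply: (papproxZ HM); set a := mkC (gr i) (gr j.+1).
    have fa z : (K `|` L) z -> D / 4 <= cmod (z - a).
      by move=> Zz; rewrite cmodBC; exact: edge_far SS (hcell2 _ _ _ (gin i)) (hcell1 _ _ _ (gin i)) Zz.
    have na : ~ (K `|` L) a by move=> /fa; rewrite subrr cmod0; lra.
    apply: (papprox_edge HM (gle i) (g := fun t => f (mkC t (gr j.+1)))
      (p := fun t => mkC t (gr j.+1)) _ _ D8 _ fa (papprox_pole HM cZ conn na)).
    - apply: cont_on_hline => t tt; apply: derivable_cont; apply: hf.
      by apply: (edge_O _ _ _ _ _ SS); [exact: hcell2|exact: hcell1].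
    - by move=> t _; exact: cont_hline.
    - move=> t tt; apply: (@le_trans _ _ (2 * s)); last by rewrite /s; lra.
      exact: cell_dist (hcell1 i j _ tt) (hcell1 i j _ (gin i)).
  have pV i j : papprox (K `|` L) (fun z => ((nat_of_bool (S i.+1 j))%:R - (nat_of_bool (S i j))%:R)
      * vint (gr i.+1) (gr j) (gr j.+1) (fun w => f w * (w - z)^-1)).
    have [->|SS] := eqVneq (S i.+1 j) (S i j).
      apply: (papprox_ext (f := fun=> 0)) => [z _|]; last exact: papprox_cst.
      by rewrite subrr mul0r.
    do 2 apply: (papproxZ HM); set a := mkC (gr i.+1) (gr j).
    have fa z : (K `|` L) z -> D / 4 <= cmod (z - a).
      by move=> Zz; rewrite cmodBC; exact: edge_far SS (vcell2 _ _ _ (gin j)) (vcell1 _ _ _ (gin j)) Zz.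
    have na : ~ (K `|` L) a by move=> /fa; rewrite subrr cmod0; lra.
    apply: (papprox_edge HM (gle j) (g := fun t => f (mkC (gr i.+1) t))
      (p := fun t => mkC (gr i.+1) t) _ _ D8 _ fa (papprox_pole HM cZ conn na)).
    - apply: cont_on_vline => t tt; apply: derivable_cont; apply: hf.
      by apply: (edge_O _ _ _ _ _ SS); [exact: vcell2|exact: vcell1].
    - by move=> t _; exact: cont_vline.
    - move=> t tt; apply: (@le_trans _ _ (2 * s)); last by rewrite /s; lra.
      exact: cell_dist (vcell1 i j _ tt) (vcell1 i j _ (gin j)).
  have -> : T = fun z => edge_sum A s nn S (fun w => f w * (w - z)^-1) by [].
  rewrite /edge_sum.
  apply: (papprox_ext (f := fun z => (\sum_(i < nn) \sum_(j < nn) (((nat_of_bool (S i j.+1))%:R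
      - (nat_of_bool (S i j))%:R) * hint (gr j.+1) (gr i) (gr i.+1) (fun w => f w * (w - z)^-1)))
    + -1 * (\sum_(j < nn) \sum_(i < nn) (((nat_of_bool (S i.+1 j))%:R - (nat_of_bool (S i j))%:R)
      * vint (gr i.+1) (gr j) (gr j.+1) (fun w => f w * (w - z)^-1))))).
    by move=> z _; rewrite mulN1r.
  apply: papproxD; first by do 2 (apply: papprox_sum => ?); exact: pH.
  by apply: (papproxZ HM); do 2 (apply: papprox_sum => ?); exact: pV.
have cell0 i j z : S i j -> ~ cell A s i j z ->
    rect (gr i) (gr i.+1) (gr j) (gr j.+1) (fun w => f w * (w - z)^-1) = 0.
  move=> Sij nz; apply: goursat => // w cw; apply: derivableM.
    exact: hf (SO _ _ Sij _ cw).
  by apply: derivable_inv_sub; apply/eqP => wz; apply: nz; rewrite -wz.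
have TK z : K z -> T z = 0.
  move=> Kz; rewrite /T -(cell_sumE _ _ S0l S0r Sl0 Sr0) /cell_sum.
  rewrite big1// => i _; rewrite big1// => j _.
  case Sij : (S i j); last by rewrite mul0r.
  by rewrite cell0 ?mulr0// => cz; apply: (KO _ Kz); exact: SO Sij _ cz.
have Toff i0 j0 z : (i0 < nn)%N -> (j0 < nn)%N -> S i0 j0 ->
    inR (gr i0) (gr i0.+1) (gr j0) (gr j0.+1) z -> T z = f z * wind R.
  move=> i0n j0n S00 zin; rewrite /T -(cell_sumE _ _ S0l S0r Sl0 Sr0) /cell_sum.
  rewrite (bigD1 (Ordinal i0n))//= (bigD1 (Ordinal j0n))//=.
  rewrite S00 mul1r big1 ?addr0; last first.
    move=> j jj; case Sij : (S i0 j); last by rewrite mul0r.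
    rewrite cell0 ?mulr0// => cz; have [_ jE] := inR_cell_uniq s0 zin cz.
    by move: jj; rewrite -val_eqE /= jE eqxx.
  rewrite big1 ?addr0; last first.
    move=> i ii; rewrite big1// => j _; case Sij : (S i j); last by rewrite mul0r.
    rewrite cell0 ?mulr0// => cz; have [iE _] := inR_cell_uniq s0 zin cz.
    by move: ii; rewrite -val_eqE /= iE eqxx.
  apply: cauchy_formula zin => w cw; exact: hf (SO _ _ S00 _ cw).
have cT z : L z -> {for z, continuous T}.
  move=> Lz; have Zz : (K `|` L) z by right.
  have cH i j : {for z, continuous (fun z => ((nat_of_bool (S i j.+1))%:R - (nat_of_bool (S i j))%:R : C)
      * hint (gr j.+1) (gr i) (gr i.+1) (fun w => f w * (w - z)^-1))}.
    have [->|SS] := eqVneq (S i j.+1) (S i j).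
      have -> : (fun z => ((nat_of_bool (S i j))%:R - (nat_of_bool (S i j))%:R : C)
        * hint (gr j.+1) (gr i) (gr i.+1) (fun w => f w * (w - z)^-1)) = fun=> 0.
        by apply/funext => v; rewrite subrr mul0r.
      exact: cont_cst.
    apply: contM; first exact: cont_cst.
    have ne t : gr i <= t <= gr i.+1 -> mkC t (gr j.+1) != z.
      move=> tt; rewrite -subr_eq0 -cmod_gt0.
      by apply: lt_le_trans D8 (edge_far _ _ _ _ _ _ SS (hcell2 _ _ _ tt) (hcell1 _ _ _ tt) Zz).
    have cf : cont_on (gr i) (gr i.+1) (fun t => f (mkC t (gr j.+1))).
      apply: cont_on_hline => t tt; apply: derivable_cont; apply: hf.
      by apply: (edge_O _ _ _ _ _ SS); [exact: hcell2|exact: hcell1].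
    have := is_deriveC_cont (cint_kernel_derive 1 (gle i) cf (fun t _ => @cont_hline R (gr j.+1) t) ne).
    by [].
  have cV i j : {for z, continuous (fun z => ((nat_of_bool (S i.+1 j))%:R - (nat_of_bool (S i j))%:R : C)
      * vint (gr i.+1) (gr j) (gr j.+1) (fun w => f w * (w - z)^-1))}.
    have [->|SS] := eqVneq (S i.+1 j) (S i j).
      have -> : (fun z => ((nat_of_bool (S i j))%:R - (nat_of_bool (S i j))%:R : C)
        * vint (gr i.+1) (gr j) (gr j.+1) (fun w => f w * (w - z)^-1)) = fun=> 0.
        by apply/funext => v; rewrite subrr mul0r.
      exact: cont_cst.
    apply: contM; first exact: cont_cst.
    have ne t : gr j <= t <= gr j.+1 -> mkC (gr i.+1) t != z.
      move=> tt; rewrite -subr_eq0 -cmod_gt0.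
      by apply: lt_le_trans D8 (edge_far _ _ _ _ _ _ SS (vcell2 _ _ _ tt) (vcell1 _ _ _ tt) Zz).
    have cf : cont_on (gr j) (gr j.+1) (fun t => f (mkC (gr i.+1) t)).
      apply: cont_on_vline => t tt; apply: derivable_cont; apply: hf.
      by apply: (edge_O _ _ _ _ _ SS); [exact: vcell2|exact: vcell1].
    have := is_deriveC_cont (cint_kernel_derive 1 (gle j) cf (fun t _ => @cont_vline R (gr i.+1) t) ne).
    by move=> h; apply: contM; [exact: cont_cst|exact: h].
  rewrite /T /edge_sum; apply: contD; first by do 2 (apply: contC_sum => ?); exact: cH.
  by apply: contN; do 2 (apply: contC_sum => ?); exact: cV.
(* Cauchy's formula covers only points inside a cell. A point on a grid line is the limit of the
   points [z + mkC q q], which lie inside the cell up and to the right, and [T] is continuous on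
   [L]. *)
have TL z : L z -> T z = f z * wind R.
  move=> Lz; have /andP[rz1 rz2] := ReL z Lz; have /andP[iz1 iz2] := ImL z Lz.
  have [i0 i0n /andP[zi1 zi2]] : exists2 i, (i < nn)%N & gr i <= Re z < gr i.+1.
    by apply: (grid_floor s0 As); rewrite /A; lra.
  have [j0 j0n /andP[zj1 zj2]] : exists2 j, (j < nn)%N & gr j <= Im z < gr j.+1.
    by apply: (grid_floor s0 As); rewrite /A; lra.
  have S00 : S i0 j0.
    apply/SP; exists z, z; split => //; last by rewrite subrr cmod0 ltW.
    by split; apply/andP; split => //; exact: ltW.
  apply/eqP; rewrite -subr_eq0 -cmod_eq0 eq_le cmod_ge0 andbT leNgt; apply/negP => h.
  have cfz : {for z, continuous f} by apply: derivable_cont; apply: hf; exact: LO.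
  have cTz := cT z Lz.
  have cc : {for z, continuous (fun v => T v - f v * wind R)} by ccont.
  have /cont_cmodP /(_ _ h) [d d0 Hd] := cc.
  pose q := Num.min (d / 3) (Num.min ((gr i0.+1 - Re z) / 2) ((gr j0.+1 - Im z) / 2)).
  have q0 : 0 < q by rewrite !lt_min !divr_gt0// subr_gt0.
  have : q <= q by []; rewrite {2}/q !le_min => /and3P[q1 q2 q3].
  have := Hd (z + mkC q q); rewrite (addrC z) addrK.
  have dq : cmod (mkC q q : C) < d.
    by apply: le_lt_trans (cmod_le_ReIm _) _; rewrite !ReImE gtr0_norm//; lra.
  move=> /(_ dq); rewrite (Toff i0 j0 (mkC q q + z))//; last first.
    by split; rewrite !ReImE; apply/andP; split; lra.
  by rewrite subrr sub0r cmodN ltxx.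
have w0 : 0 < cmod (wind R) by rewrite cmod_gt0 wind_neq0.
have [P HP] := papproxZ HM (wind R)^-1 pT e0.
exists P; split=> z Zz.
  have := HP z (or_intror Zz); rewrite TL// mulrC mulfK//; exact: wind_neq0.
by have := HP z (or_introl Zz); rewrite TK// mulr0 subr0.
Qed.

End Runge.

(** * Continuity rules for maps into the line and the plane *)

Section Continuity.
Variable R : realType.

Lemma cont_comp (T U V : topologicalType) (f : T -> U) (g : U -> V) (p : T) :
  {for p, continuous f} -> {for f p, continuous g} -> {for p, continuous (fun u => g (f u))}.
Proof. exact: continuous_comp. Qed.

Lemma cont_mkC (T : topologicalType) (f g : T -> R) (p : T) :
  {for p, continuous f} -> {for p, continuous g} -> {for p, continuous (fun u => mkC (f u) (g u))}.
Proof. by move=> cf cg; apply: (@cvg_mkC _ _ (nbhs p)); [exact: cf|exact: cg]. Qed.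

Lemma cont_addr (T : topologicalType) (f g : T -> R) (p : T) :
  {for p, continuous f} -> {for p, continuous g} -> {for p, continuous (fun u => f u + g u)}.
Proof. by move=> cf cg; apply: (@cvgD _ _ _ (nbhs p)); [exact: cf|exact: cg]. Qed.
Lemma cont_mulr (T : topologicalType) (f g : T -> R) (p : T) :
  {for p, continuous f} -> {for p, continuous g} -> {for p, continuous (fun u => f u * g u)}.
Proof. by move=> cf cg; apply: (@cvgM _ _ (nbhs p)); [exact: cf|exact: cg]. Qed.
Lemma cont_norm (T : topologicalType) (f : T -> R) (p : T) :
  {for p, continuous f} -> {for p, continuous (fun u => `|f u|)}.
Proof. by move=> cf; apply: (@cvg_norm _ _ _ (nbhs p)); exact: cf. Qed.
Lemma cont_cstr (T : topologicalType) (k : R) (p : T) : {for p, continuous (fun=> k)}.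
Proof. exact: cvg_cst. Qed.
Lemma cont_idr (t : R) : {for t, continuous (fun u : R => u)}.
Proof. exact: cvg_id. Qed.
Lemma cont_oppr (T : topologicalType) (f : T -> R) (p : T) :
  {for p, continuous f} -> {for p, continuous (fun u => - f u)}.
Proof. by move=> cf; apply: (@cvgN _ _ _ (nbhs p)); exact: cf. Qed.

End Continuity.

Ltac rcont := lazymatch goal with
  | |- context [continuous ?F] => lazymatch F with
    | fun _ => ?c => exact: cont_cstr
    | fun u => u => exact: cont_idr
    | fun u => @?A u + @?B u => apply: (@cont_addr _ _ A B); rcont
    | fun u => @?A u * @?B u => apply: (@cont_mulr _ _ A B); rcont
    | fun u => - @?A u => apply: (@cont_oppr _ _ A); rcont
    | fun u => `|@?A u| => apply: (@cont_norm _ _ A); rcont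
    | _ => idtac
    end
  end.

(** * The complex exponential and continuous logarithms on the unit square *)

Section Logarithms.
Variable R : realType.
Local Notation C := (Cplx R).
Local Notation Re := (@complex.Re R).
Local Notation Im := (@complex.Im R).
Implicit Types (z w v a b : C) (x y s t r e M : R) (f g : C -> C).

Definition cexp z : C := mkC (expR (Re z) * cos (Im z)) (expR (Re z) * sin (Im z)).

Lemma cexp0 : cexp 0 = 1.
Proof. by apply: eq_ReIm; rewrite !ReImE expR0 ?cos0 ?sin0 mul1r. Qed.

Lemma cexpD z w : cexp (z + w) = cexp z * cexp w.
Proof. by apply: eq_ReIm; rewrite !ReImE expRD ?cosD ?sinD; ring. Qed.

Lemma cexp_neq0 z : cexp z != 0.
Proof.
apply/eqP => h; have := cexpD z (- z); rewrite subrr cexp0 h mul0r.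
by move=> /eqP; rewrite oner_eq0.
Qed.

Lemma cexpB z w : cexp (z - w) = cexp z / cexp w.
Proof.
apply: (canRL (mulfK (cexp_neq0 w))).
by rewrite -cexpD subrK.
Qed.

Lemma continuous_cexp : continuous cexp.
Proof.
move=> z.
have ce : {for z, continuous (fun z : C => expR (Re z))}.
  by apply: (@cont_comp _ _ _ (fun v : C => Re v) (@expR R)); [exact: continuous_Re|exact: continuous_expR].
have cc : {for z, continuous (fun z : C => cos (Im z))}.
  by apply: (@cont_comp _ _ _ (fun v : C => Im v) (@cos R)); [exact: continuous_Im|exact: continuous_cos].
have cs : {for z, continuous (fun z : C => sin (Im z))}.
  by apply: (@cont_comp _ _ _ (fun v : C => Im v) (@sin R)); [exact: continuous_Im|exact: continuous_sin].
exact: cont_mkC (cont_mulr ce cc) (cont_mulr ce cs).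
Qed.

Lemma cmod_cexp z : cmod (cexp z) = expR (Re z).
Proof.
by rewrite cmodE !ReImE !exprMn -mulrDr cos2Dsin2 mulr1 sqrtr_sqr ger0_norm// expR_ge0.
Qed.

(** The real part vanishes because the modulus is 1; the sine of the imaginary part vanishes, and
    [0] is the only zero of the sine between [-1] and [1] since [1 < pi]. *)
Lemma cexp_kernel_discrete z : cexp z = 1 -> cmod z < 1 -> z = 0.
Proof.
move=> ez z1; have Re0' : Re z = 0.
  have := cmod_cexp z; rewrite ez cmod1 -[X in X = _]expR0 => h.
  by apply/esym; exact: expR_inj.
have := congr1 Im ez; rewrite !ReImE Re0' expR0 mul1r => s0.
have Iz := le_lt_trans (Im_le_cmod z) z1.
have p2 := @pi_ge2 R.
apply: eq_ReIm; rewrite ?Re0'//; case: (ltgtP (Im z) 0) => // h.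
- have : 0 < sin (- Im z).
    apply: sin_gt0_pi; rewrite oppr_gt0 h /=; move: Iz; rewrite ltr0_norm//; lra.
  by rewrite sinN s0 oppr0 ltxx.
- have : 0 < sin (Im z).
    by apply: sin_gt0_pi; rewrite h /=; move: Iz; rewrite gtr0_norm//; lra.
  by rewrite s0 ltxx.
Qed.

(* A logarithm only for [0 < Re z]. *)
Definition clog z : C := mkC (ln (cmod z)) (atan (Im z / Re z)).

Lemma clogK z : 0 < Re z -> cexp (clog z) = z.
Proof.
move=> z0; have m0 : 0 < cmod z by apply: lt_le_trans z0 (le_trans (ler_norm _) (Re_le_cmod z)).
have E : Num.sqrt (1 + (Im z / Re z) ^+ 2) = cmod z / Re z.
  have -> : cmod z / Re z = Num.sqrt ((cmod z / Re z) ^+ 2).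
    by rewrite sqrtr_sqr ger0_norm// divr_ge0 ?cmod_ge0// ltW.
  by congr Num.sqrt; rewrite [in RHS]expr_div_n cmod_sqr; field; rewrite gt_eqF.
have cE : cos (atan (Im z / Re z)) = Re z / cmod z.
  have -> : cos (atan (Im z / Re z)) = (Num.sqrt (1 + (Im z / Re z) ^+ 2))^-1 by exact: cos_atan.
  by rewrite E invf_div.
have c0 : cos (atan (Im z / Re z)) != 0 by rewrite cE gt_eqF// divr_gt0.
have sE : sin (atan (Im z / Re z)) = Im z / cmod z.
  have := atanK (Im z / Re z); rewrite /tan => /(canRL (divfK c0)) ->.
  by rewrite cE; field; rewrite !gt_eqF.
have lE : expR (ln (cmod z)) = cmod z by apply: lnK; rewrite posrE.
by apply: eq_ReIm; rewrite !ReImE lE ?cE ?sE; field; rewrite gt_eqF.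
Qed.

Lemma clog1 : clog 1 = 0.
Proof. by apply: eq_ReIm; rewrite !ReImE ?cmod1 ?ln1 ?mul0r ?atan0. Qed.

Lemma cont_clog z : 0 < Re z -> {for z, continuous clog}.
Proof.
move=> z0; have m0 : 0 < cmod z by apply: lt_le_trans z0 (le_trans (ler_norm _) (Re_le_cmod z)).
apply: cont_mkC.
  apply: (@cont_comp _ _ _ (@cmod R) (@ln R)); first exact: continuous_cmod.
  exact: continuous_ln.
apply: (@cont_comp _ _ _ (fun v : C => Im v / Re v) (@atan R)); last exact: continuous_atan.
apply: (@cvgM _ _ (nbhs z)); first exact: continuous_Im.
by apply: (@cvgV _ _ _ _ Re); [rewrite gt_eqF|exact: continuous_Re].
Qed.

Lemma cexp_surj z : z != 0 -> exists w, cexp w = z.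
Proof.
move=> z0; have [zp|zn|z0'] := ltgtP 0 (Re z).
- by exists (clog z); exact: clogK.
- exists (clog (- z) + mkC 0 pi); rewrite cexpD clogK; last by rewrite ReN oppr_gt0.
  have -> : cexp (mkC 0 pi) = -1.
    by apply: eq_ReIm; rewrite !ReImE expR0 mul1r ?cospi ?sinpi ?oppr0.
  by rewrite mulrN1 opprK.
- have Iz : Im z != 0.
    by apply: contra_neq z0 => Iz; apply: eq_ReIm; rewrite ?Iz -?z0'.
  have [zp|zn] := ltP 0 (Im z).
    exists (mkC (ln (Im z)) (pi / 2)); apply: eq_ReIm; rewrite !ReImE.
      by rewrite cos_pihalf mulr0 -z0'.
    by rewrite sin_pihalf mulr1 lnK// posrE.
  have zn' : 0 < - Im z by rewrite oppr_gt0 lt_neqAle Iz.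
  exists (mkC (ln (- Im z)) (- (pi / 2))); apply: eq_ReIm; rewrite !ReImE.
    by rewrite cosN cos_pihalf mulr0 -z0'.
  by rewrite sinN sin_pihalf mulrN1 lnK ?posrE// opprK.
Qed.

Lemma near1_Re z : cmod (z - 1) < 1 -> 0 < Re z.
Proof.
move=> /(le_lt_trans (Re_le_cmod _)); rewrite !ReImE ltr_norml => /andP[h _]; lra.
Qed.

(** The retraction of the line onto the unit interval. Composing with it turns paths and homotopies
    on the interval into maps that are continuous everywhere. *)
Definition clamp t : R := (`|t| - `|t - 1| + 1) / 2.

Lemma clamp_id t : 0 <= t <= 1 -> clamp t = t.
Proof. by move=> /andP[t0 t1]; rewrite /clamp ger0_norm// ler0_norm; lra. Qed.
Lemma clamp_le0 t : t <= 0 -> clamp t = 0.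
Proof. by move=> t0; rewrite /clamp ler0_norm// ler0_norm; lra. Qed.
Lemma clamp_ge1 t : 1 <= t -> clamp t = 1.
Proof. by move=> t0; rewrite /clamp ger0_norm ?ger0_norm; lra. Qed.
Lemma clamp01 t : 0 <= clamp t <= 1.
Proof.
have [t0|t0] := leP t 0; first by rewrite clamp_le0// lexx ler01.
have [t1|t1] := leP t 1; first by rewrite clamp_id (ltW t0) t1.
by rewrite clamp_ge1 ?ler01 ?lexx// ltW.
Qed.
Lemma clampK t : clamp (clamp t) = clamp t.
Proof. by rewrite clamp_id// clamp01. Qed.

Lemma cont_clamp t : {for t, continuous clamp}.
Proof. by rewrite /clamp; rcont. Qed.

(** The continuous function [1 / f] is bounded on [A]. *)
Lemma compact_pos_lower (T : topologicalType) (A : set T) (f : T -> R) :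
  compact A -> (forall p, A p -> {for p, continuous f}) -> (forall p, A p -> 0 < f p) ->
  exists2 e, 0 < e & forall p, A p -> e <= f p.
Proof.
move=> cA cf f0.
have ci : {within A, continuous (fun p => (f p)^-1)}.
  apply: continuous_in_subspaceT => p; rewrite inE => Ap.
  by apply: (@cvgV _ _ _ _ f); [rewrite gt_eqF// f0|exact: cf].
have [M [_ HM]] := compact_bounded (continuous_compact ci cA).
exists (`|M| + 1)^-1; first by rewrite invr_gt0 ltr_wpDl.
move=> p Ap; have fp := f0 p Ap.
have := HM (`|M| + 1); rewrite ltr_pwDr ?ler_norm// => /(_ isT (f p)^-1).
move=> /(_ (ex_intro2 _ _ p Ap erefl)) h.
have {}h : (f p)^-1 <= `|M| + 1 by move: h; rewrite /= ger0_norm// invr_ge0 ltW.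
by rewrite -[leRHS]invrK lef_pV2 ?posrE ?invr_gt0// ltr_wpDl.
Qed.

Definition usq : set (R * R) := [set p | 0 <= p.1 <= 1 /\ 0 <= p.2 <= 1].

Lemma compact_usq : compact usq.
Proof.
have -> : usq = `[0, 1]%classic `*` `[0, 1]%classic.
  by rewrite predeqE => p; split=> -[h1 h2]; split; move: h1 h2; rewrite /= !in_itv.
by apply: compact_setX; exact: segment_compact.
Qed.

(** The pairs of points whose values differ by at least [e] form a compact set off the diagonal, so
    the distance of the two points has a positive lower bound there. *)
Lemma usq_heine (G : R * R -> C) e : continuous G -> 0 < e ->
  exists2 d, 0 < d & forall p q, usq p -> usq q -> `|p.1 - q.1| < d -> `|p.2 - q.2| < d ->
    cmod (G p - G q) < e.
Proof.
move=> cG e0.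
pose D (u : (R * R) * (R * R)) := cmod (G u.1 - G u.2).
have cD : continuous D.
  move=> u; apply: (@cont_comp _ _ _ (fun u => G u.1 - G u.2) (@cmod R)); last exact: continuous_cmod.
  have c1 : {for u, continuous (fun u : (R * R) * (R * R) => G u.1)}.
    by apply: (@cont_comp _ _ _ fst G); [exact: cvg_fst|exact: cG].
  have c2 : {for u, continuous (fun u : (R * R) * (R * R) => G u.2)}.
    by apply: (@cont_comp _ _ _ snd G); [exact: cvg_snd|exact: cG].
  exact: contD c1 (contN c2).
pose B := (usq `*` usq) `&` [set u | e <= D u].
have cB : compact B.
  have cU := compact_setX compact_usq compact_usq.
  apply: compact_closedI => //.
  have -> : [set u | e <= D u] = D @^-1` [set x | e <= x] by [].
  by apply: closed_comp; [move=> u _; exact: cD|exact: closed_ge].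
pose dd (u : (R * R) * (R * R)) := `|u.1.1 - u.2.1| + `|u.1.2 - u.2.2|.
have [||d d0 Hd] := @compact_pos_lower _ B dd cB.
- move=> u _; rewrite /dd.
  have c11 : {for u, continuous (fun u : (R * R) * (R * R) => u.1.1)}.
    by apply: (@cont_comp _ _ _ fst fst); exact: cvg_fst.
  have c12 : {for u, continuous (fun u : (R * R) * (R * R) => u.1.2)}.
    by apply: (@cont_comp _ _ _ fst snd); [exact: cvg_fst|exact: cvg_snd].
  have c21 : {for u, continuous (fun u : (R * R) * (R * R) => u.2.1)}.
    by apply: (@cont_comp _ _ _ snd fst); [exact: cvg_snd|exact: cvg_fst].
  have c22 : {for u, continuous (fun u : (R * R) * (R * R) => u.2.2)}.
    by apply: (@cont_comp _ _ _ snd snd); exact: cvg_snd.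
  apply: cont_addr; apply: cont_norm; apply: cont_addr; by [exact: c11|exact: c12|
    apply: cont_oppr; exact: c21|apply: cont_oppr; exact: c22].
- move=> [[p1 p2] [q1 q2]] [_ /= eD]; rewrite /dd /= lt_def addr_ge0// andbT.
  apply/eqP => h; move: eD; rewrite /D /=.
  have /eqP : `|p1 - q1| = 0 by have := normr_ge0 (p1 - q1); have := normr_ge0 (p2 - q2); lra.
  have /eqP : `|p2 - q2| = 0 by have := normr_ge0 (p1 - q1); have := normr_ge0 (p2 - q2); lra.
  rewrite !normr_eq0 !subr_eq0 => /eqP -> /eqP ->.
  by rewrite subrr cmod0 leNgt e0.
exists (d / 2); first by rewrite divr_gt0.
move=> p q up uq h1 h2; rewrite ltNge; apply/negP => h.
have := Hd (p, q) (conj (conj up uq) h); rewrite /dd /=; lra.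
Qed.

(* The ratios of the values of [G] at consecutive points of a fine subdivision of a
   ray lie near [1]. *)
Lemma square_log (G : R * R -> C) : continuous G -> (forall p, usq p -> G p != 0) ->
  exists2 l : R * R -> C, continuous l &
    forall p, cexp (l p) * G (0, 0) = G (clamp p.1, clamp p.2).
Proof.
move=> cG G0.
have [m m0 Hm] : exists2 e, 0 < e & forall p, usq p -> e <= cmod (G p).
  apply: compact_pos_lower; first exact: compact_usq.
    move=> p _; apply: (@cont_comp _ _ _ G (@cmod R)); [exact: cG|exact: continuous_cmod].
  by move=> p up; rewrite cmod_gt0 G0.
(* The tolerance is the lower bound [m] of the modulus of [G]: steps shorter than [d] then have
   ratios at distance less than 1 from 1, where [clog] is a logarithm. *)
have [d d0 Hd] := usq_heine cG m0.
pose n := (Num.truncn d^-1).+1.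
have n0 : (0 : R) < n%:R by rewrite ltr0n.
have nd : n%:R^-1 < d.
  have /andP[_] := truncn_itv (ltW (ltac:(by rewrite invr_gt0) : 0 < d^-1)).
  by rewrite -/n => h; rewrite -(invrK d) ltf_pV2 ?posrE ?invr_gt0.
pose pt (k : nat) (p : R * R) : R * R := (k%:R / n%:R * clamp p.1, k%:R / n%:R * clamp p.2).
have ptu k p : (k <= n)%N -> usq (pt k p).
  move=> kn; have /andP[c1 c2] := clamp01 p.1; have /andP[c3 c4] := clamp01 p.2.
  have k0 : 0 <= k%:R / n%:R :> R by rewrite divr_ge0 ?ler0n.
  have k1 : k%:R / n%:R <= 1 :> R by rewrite ler_pdivrMr// mul1r ler_nat.
  by split; rewrite /= mulr_ge0//= mulr_ile1.
pose rho k p := G (pt k.+1 p) / G (pt k p).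
have rho1 k p : (k < n)%N -> cmod (rho k p - 1) < 1.
  move=> kn; have g0 := G0 _ (ptu k p (ltnW kn)); have gm := Hm _ (ptu k p (ltnW kn)).
  have -> : rho k p - 1 = (G (pt k.+1 p) - G (pt k p)) / G (pt k p) by rewrite /rho; field.
  rewrite cmod_div ltr_pdivrMr ?cmod_gt0// mul1r; apply: lt_le_trans gm.
  have h c : 0 <= c <= 1 -> `|k.+1%:R / n%:R * c - k%:R / n%:R * c| < d.
    move=> /andP[c0 c1]; rewrite -mulrBl -mulrBl -natr1 addrAC subrr add0r mul1r.
    rewrite ger0_norm; last by rewrite mulr_ge0// invr_ge0 ltW.
    by apply: le_lt_trans nd; rewrite ler_piMr// invr_ge0 ltW.
  by apply: Hd; [exact: ptu|apply: ptu; exact: ltnW|apply: h; exact: clamp01|apply: h; exact: clamp01].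
pose lg (j : nat) p := \sum_(k < j) clog (rho k p).
have lgE j p : (j <= n)%N -> cexp (lg j p) * G (0, 0) = G (pt j p).
  elim: j => [|j IH] jn.
    rewrite /lg big_ord0 cexp0 mul1r; congr G; rewrite /pt !mul0r.
    by [].
  rewrite /lg big_ord_recr /= cexpD mulrAC IH ?(ltnW jn)// clogK; last exact/near1_Re/rho1.
  by rewrite /rho mulrC divfK// G0//; apply: ptu; exact: ltnW.
have ptc k p : {for p, continuous (pt k)}.
  have c1 : {for p, continuous (fun u : R * R => k%:R / n%:R * clamp u.1)}.
    apply: cont_mulr; first exact: cont_cstr.
    by apply: (@cont_comp _ _ _ fst clamp); [exact: cvg_fst|exact: cont_clamp].
  have c2 : {for p, continuous (fun u : R * R => k%:R / n%:R * clamp u.2)}.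
    apply: cont_mulr; first exact: cont_cstr.
    by apply: (@cont_comp _ _ _ snd clamp); [exact: cvg_snd|exact: cont_clamp].
  exact: (cvg_pair c1 c2).
have lgc j p : (j <= n)%N -> {for p, continuous (lg j)}.
  elim: j => [|j IH] jn.
    have -> : lg 0%N = fun=> 0 by apply/funext => q; rewrite /lg big_ord0.
    exact: cont_cst.
  have -> : lg j.+1 = fun q => lg j q + clog (rho j q).
    by apply/funext => q; rewrite /lg big_ord_recr.
  apply: contD; first by apply: IH; exact: ltnW.
  apply: (@cont_comp _ _ _ (rho j) clog); last by apply: cont_clog; exact/near1_Re/rho1.
  apply: contM; first by apply: (@cont_comp _ _ _ (pt j.+1) G); [exact: ptc|exact: cG].
  apply: contV; first by apply: G0; apply: ptu; exact: ltnW.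
  by apply: (@cont_comp _ _ _ (pt j) G); [exact: ptc|exact: cG].
exists (lg n); first by move=> p; exact: lgc.
move=> p; rewrite lgE//; congr G; rewrite /pt mulfV ?gt_eqF// !mul1r.
by [].
Qed.

(** The kernel of [cexp] is discrete, so [k] is locally constant, and the line is connected. *)
Lemma cexp_kernel_cst (k : R -> C) : continuous k -> (forall t, cexp (k t) = 1) ->
  forall s t, k s = k t.
Proof.
move=> ck k1 s t; pose B := [set u | k u = k s].
have near1 x y : cmod (k x - k y) < 1 -> k x = k y.
  move=> h; apply/eqP; rewrite -subr_eq0; apply/eqP; apply: cexp_kernel_discrete => //.
  by rewrite cexpB !k1 divr1.
have : B = [set: R].
  have conT : connected [set: R] by apply/connected_intervalP => ? ? _ _ ? _.
  apply: conT; first by exists s.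
  - exists B; last by rewrite setTI.
    rewrite openE => x /= Bx; have /continuous_cmodP /(_ 1 ltr01) := ck x.
    by apply: filterS => y /near1 yx; rewrite /B /= yx.
  - exists B; last by rewrite setTI.
    have -> : B = k @^-1` [set k s] by [].
    apply: closed_comp; first by move=> ? _; exact: ck.
    by apply: compactC_closed; exact: compact_set1.
move=> E; have Bt : B t by rewrite E.
by rewrite Bt.
Qed.

End Logarithms.

(** * Separation of the plane by compact sets, through logarithms *)

Section PlaneTopology.
Variable R : realType.
Local Notation C := (Cplx R).
Local Notation Re := (@complex.Re R).
Local Notation Im := (@complex.Im R).
Implicit Types (z w v a b : C) (x y s t r e M : R) (f g : C -> C) (K L Z O Omega : set C).

(** A continuous logarithm of [z - a] on [Z]. The function is total and continuous at the points of
    [Z] as a map of the plane, not only relative to [Z]. *)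
Definition logat Z a := exists u : C -> C,
  (forall z, Z z -> {for z, continuous u}) /\ (forall z, Z z -> cexp (u z) = z - a).

Lemma logatS L Z a : L `<=` Z -> logat Z a -> logat L a.
Proof. by move=> LZ [u [cu eu]]; exists u; split=> z /LZ; [exact: cu|exact: eu]. Qed.

Lemma cont_near_eq (T : topologicalType) (f g : T -> C) (p : T) :
  (\forall q \near p, f q = g q) -> {for p, continuous f} -> {for p, continuous g}.
Proof.
move=> fg /continuous_cmodP cf; apply/continuous_cmodP => e e0.
have gp := nbhs_singleton fg.
by move: (cf e e0); apply: filterS2 fg => q <-; rewrite gp.
Qed.

(** The two sets have positive distance [d], so the logarithms are glued along the [d / 2]
    neighbourhood of [K]; near each point of the union the result is one of the two. *)
Lemma logatU K L a : compact K -> closed L -> K `&` L = set0 ->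
  logat K a -> logat L a -> logat (K `|` L) a.
Proof.
move=> cK clL KL [u [cu eu]] [v [cv ev]].
have [d d0 Hd] := compact_closed_dist cK clL KL.
pose P z := exists2 k, K k & cmod (z - k) < d / 2.
pose h z := if pselect (P z) then u z else v z.
have d2 : 0 < d / 2 by rewrite divr_gt0.
have hK z : K z -> \forall w \near z, u w = h w.
  move=> Kz; apply/nbhs_cmodP; exists (d / 2) => // w wz.
  by rewrite /h; case: pselect => // -[]; exists z.
have hL z : L z -> \forall w \near z, v w = h w.
  move=> Lz; apply/nbhs_cmodP; exists (d / 2) => // w wz.
  rewrite /h; case: pselect => // -[k Kk wk].
  have := Hd k z Kk Lz; have := cmod_tri k z w; rewrite (cmodBC k w) => k1 k2.
  have : d < d by lra.
  by rewrite ltxx.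
exists h; split=> z [Kz|Lz].
- by apply: cont_near_eq (hK z Kz) _; exact: cu.
- by apply: cont_near_eq (hL z Lz) _; exact: cv.
- by rewrite -(nbhs_singleton (hK z Kz)); exact: eu.
- by rewrite -(nbhs_singleton (hL z Lz)); exact: ev.
Qed.

(* Multiplying by [(z - b) / (z - a)], which stays near [1] on [Z]. *)
Lemma logat_near Z a b r : 0 < r -> (forall z, Z z -> r <= cmod (z - a)) -> cmod (b - a) < r ->
  logat Z a -> logat Z b.
Proof.
move=> r0 Zr ba [u [cu eu]]; exists (fun z => u z + clog ((z - b) / (z - a))).
have za z : Z z -> z - a != 0.
  by move=> Zz; rewrite -cmod_gt0; exact: lt_le_trans (Zr z Zz).
have near z : Z z -> 0 < Re ((z - b) / (z - a)).
  move=> Zz; apply: near1_Re; have -> : (z - b) / (z - a) - 1 = (a - b) / (z - a).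
    by field; exact: za.
  rewrite cmod_div ltr_pdivrMr ?cmod_gt0 ?za// mul1r cmodBC.
  exact: lt_le_trans (Zr z Zz).
split=> z Zz.
  apply: contD; first exact: cu.
  apply: (@cont_comp _ _ _ (fun z : C => (z - b) / (z - a)) (@clog R)); last exact/cont_clog/near.
  by ccont; exact: za.
by rewrite cexpD eu// clogK ?near// mulrC divfK// za.
Qed.

Lemma logat_far Z b M : (forall z, Z z -> cmod z <= M) -> 0 <= M -> logat Z (mkC (- (M + 1)) 0).
Proof.
move=> ZM M0; have p0 : 0 < M + 1 by lra.
pose m : C := mkC (M + 1) 0.
have near z : Z z -> 0 < Re ((z + m) / m).
  move=> Zz; have m0 : m != 0 by rewrite -cmod_gt0 cmod_mkC0 gtr0_norm.
  apply: near1_Re; have -> : (z + m) / m - 1 = z / m by field.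
  rewrite cmod_div ltr_pdivrMr ?cmod_gt0// mul1r cmod_mkC0 gtr0_norm//.
  by have := ZM z Zz; lra.
have m0 : m != 0 by rewrite -cmod_gt0 cmod_mkC0 gtr0_norm.
have mE z : z - mkC (- (M + 1)) 0 = z + m.
  by congr (_ + _); apply: eq_ReIm; rewrite !ReImE ?opprK ?oppr0.
exists (fun z => mkC (ln (M + 1)) 0 + clog ((z + m) / m)); split=> z Zz.
  apply: contD; first exact: cont_cst.
  apply: (@cont_comp _ _ _ (fun z : C => (z + m) / m) (@clog R)); last exact/cont_clog/near.
  by ccont.
rewrite cexpD clogK ?near// mE.
have -> : cexp (mkC (ln (M + 1)) 0) = m.
  apply: eq_ReIm; rewrite !ReImE ?cos0 ?sin0 ?mulr1 ?mulr0//.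
  by apply: lnK; rewrite posrE.
by rewrite mulrC divfK.
Qed.

Lemma compactC_dist Z a : compact Z -> ~ Z a ->
  exists2 r, 0 < r & forall z, Z z -> r <= cmod (z - a).
Proof.
move=> cZ nZa; have [|r r0 Hr] := compact_closed_dist (@compact_set1 _ a) (compactC_closed cZ).
  by rewrite -subset0 => z [/= -> /nZa].
by exists r => // z Zz; rewrite cmodBC; exact: Hr.
Qed.

(* The easy half of Eilenberg's separation criterion. *)
Lemma logat_connected Z a : compact Z -> connected (~` Z) -> ~ Z a -> logat Z a.
Proof.
move=> cZ conn nZa; have [M' HM'] := compactC_bounded cZ.
have M0 : 0 <= `|M'| by exact: normr_ge0.
have HM z : Z z -> cmod z <= `|M'| by move=> /HM' h; apply: le_trans h (ler_norm _).
pose S := [set b | ~ Z b /\ logat Z b].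
suff E : S = ~` Z by have [] : S a by rewrite E.
apply: conn.
- exists (mkC (- (`|M'| + 1)) 0); split; last by apply: logat_far.
  by move=> /HM; rewrite cmod_mkC0 normrN ger0_norm; lra.
- exists S; last by rewrite setIC; apply/esym/setIidl => b [].
  apply/openC_cmodP => b [nZb hb]; have [r r0 Hr] := compactC_dist cZ nZb.
  exists r => // c cb; split; last exact: logat_near Hr cb hb.
  by move=> Zc; have := Hr c Zc; lra.
- exists (closure S); first exact: closed_closure.
  rewrite predeqE => b; split; first by move=> Sb; split; [case: Sb|exact: subset_closure].
  move=> [nZb clb]; split => //; have [r r0 Hr] := compactC_dist cZ nZb.
  have r2 : 0 < r / 2 by rewrite divr_gt0.
  have [|c [[nZc hc] /= cb]] := clb [set c | cmod (c - b) < r / 2].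
    by apply/nbhs_cmodP; exists (r / 2).
  have Hc z : Z z -> r / 2 <= cmod (z - c).
    by move=> Zz; have := Hr z Zz; have := cmod_tri z b c; lra.
  by apply: (logat_near r2 Hc) hc; rewrite cmodBC.
Qed.

(** The extension takes place on [R * R], a metric space over [R], and is carried back through the
    coordinates. *)
Lemma tietzeR (L : set C) (f : C -> R) M : closed L -> (forall z, L z -> {for z, continuous f}) ->
  (forall z, L z -> `|f z| <= M) -> exists2 g : C -> R, continuous g & forall z, L z -> g z = f z.
Proof.
move=> clL cf fM; pose i (p : R * R) : C := mkC p.1 p.2.
have ci : continuous i.
  by move=> p; apply: cont_mkC; [exact: cvg_fst|exact: cvg_snd].
have clA : closed (i @^-1` L) by apply: closed_comp => // p _; exact: ci.
have cfi : {within i @^-1` L, continuous (f \o i)}.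
  apply: continuous_in_subspaceT => p; rewrite inE /= => Lp.
  by apply: (@cont_comp _ _ _ i f); [exact: ci|exact: cf].
have M1 : 0 < `|M| + 1 by rewrite ltr_wpDl.
have fM' p : (i @^-1` L) p -> `|(f \o i) p| <= `|M| + 1.
  by move=> Lp; apply: le_trans (fM _ Lp) _; apply: le_trans (ler_norm _) _; rewrite lerDl.
have [g [fg cg _]] := continuous_bounded_extension (@pseudometric_normal R _) clA M1 cfi fM'.
exists (fun z => g (Re z, Im z)).
  move=> z; apply: (@cont_comp _ _ _ (fun z : C => (Re z, Im z)) g); last exact: cg.
  exact: (cvg_pair (@continuous_Re R z) (@continuous_Im R z)).
by move=> z Lz; rewrite -fg ?inE /= /i /= mkC_eta.
Qed.

(** In polar coordinates around [a] a large disc becomes the unit square, first coordinate radius,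
    second coordinate angle. A logarithm of [F] on the square would gain [2 pi i] along the right
    side and nothing along the rest of the boundary. *)
Lemma no_log_nonzero_winding (F : C -> C) a M : continuous F -> (forall z, F z != 0) ->
  (forall z, M < cmod (z - a) -> F z = z - a) -> False.
Proof.
move=> cF F0 FE; pose rr := `|M| + 1; have r0 : 0 < rr by rewrite ltr_wpDl.
pose p1 (p : R * R) : C := mkC (rr * p.1) 0 * cexp (mkC 0 (2 * pi * p.2)).
pose G (p : R * R) := F (a + p1 p).
have cp1 : continuous p1.
  move=> p.
  change {for p, continuous (fun p : R * R => mkC (rr * p.1) 0 * cexp (mkC 0 (2 * pi * p.2)))}.
  apply: contM.
    apply: cont_mkC; last exact: cont_cstr.
    by apply: cont_mulr; [exact: cont_cstr|exact: cvg_fst].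
  apply: (@cont_comp _ _ _ (fun p : R * R => mkC 0 (2 * pi * p.2) : C) (@cexp R)); last exact: continuous_cexp.
  apply: cont_mkC; first exact: cont_cstr.
  by apply: cont_mulr; [exact: cont_cstr|exact: cvg_snd].
have cG : continuous G.
  move=> p; apply: (@cont_comp _ _ _ (fun p => a + p1 p) F); last exact: cF.
  by apply: contD; [exact: cont_cst|exact: cp1].
have [l cl lE] := square_log cG (fun p _ => F0 _).
have g0 : G (0, 0) != 0 by exact: F0.
(* Along a path on which [G] is known as [c * cexp k], the logarithm [l] differs from [k] by a
   constant, so the increment of [l] can be read off. *)
have lift (u : R -> R * R) (k : R -> C) : continuous u -> continuous k ->
    (forall t, usq (u t)) -> (exists c, c != 0 /\ forall t, G (u t) = c * cexp (k t)) ->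
    forall s t, l (u s) - k s = l (u t) - k t.
  move=> cu ck uu [c [c0 hc]] s t.
  pose h x := l (u x) - k x - (l (u s) - k s).
  have ch : continuous h.
    move=> x; have c1 : {for x, continuous (fun x => l (u x))}.
      by apply: (@cont_comp _ _ _ u l); [exact: cu|exact: cl].
    have c2 := ck x.
    change {for x, continuous (fun x => l (u x) - k x - (l (u s) - k s))}.
    by apply: contD; [apply: contD; [exact: c1|apply: contN; exact: c2]|exact: cont_cst].
  have h1 x : cexp (h x) = 1.
    have E y : cexp (l (u y) - k y) = c / G (0, 0).
      rewrite cexpB; have := lE (u y); have [h1 h2] := uu y; rewrite !clamp_id//.
      rewrite -surjective_pairing hc => h3.
      have k0 := cexp_neq0 (k y).
      have -> : c = cexp (l (u y)) * G (0, 0) / cexp (k y) by rewrite h3 mulfK.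
      by field; rewrite g0 k0.
    by rewrite /h cexpB !E divff// mulf_neq0 ?invr_neq0.
  have := cexp_kernel_cst ch h1 t s; rewrite /h => /eqP.
  by rewrite [X in _ == X]subrr subr_eq0 => /eqP ->.
have c01 t : continuous (fun s : R => (clamp s, t)).
  by move=> s; exact: (cvg_pair (@cont_clamp R s) (@cont_cstr R _ t s)).
have c10 s : continuous (fun t : R => (s, clamp t)).
  by move=> t; exact: (cvg_pair (@cont_cstr R _ s t) (@cont_clamp R t)).
have u0 : 0 <= (0 : R) <= 1 by rewrite lexx ler01.
have u1 : 0 <= (1 : R) <= 1 by rewrite lexx ler01.
have cl0 : clamp (0 : R) = 0 by rewrite clamp_id.
have cl1 : clamp (1 : R) = 1 by rewrite clamp_id.
(* the left side of the square is mapped to [F a] *)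
have L0 : l (0, 1) = l (0, 0).
  have := lift (fun t => (0, clamp t)) (fun=> 0) (c10 0) _ _ _ 1 0; rewrite !subr0 cl0 cl1; apply.
  - by move=> ?; exact: cont_cst.
  - by move=> t; split=> //=; exact: clamp01.
  - exists (F a); split; first exact: F0.
    by move=> t; rewrite cexp0 mulr1 /G /p1 /= mulr0 mul0r addr0.
(* the right side winds once around [a] *)
have L1 : l (1, 1) - l (1, 0) = mkC 0 (2 * pi).
  have := lift (fun t => (1, clamp t)) (fun t => mkC 0 (2 * pi * clamp t)) (c10 1) _ _ _ 1 0.
  rewrite !cl0 !cl1 mulr1 mulr0 subr0 => h.
  have -> : l (1, 1) = l (1, 0) + mkC 0 (2 * pi).
    apply/eqP; rewrite -subr_eq; apply/eqP; apply: h.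
    - move=> t; change {for t, continuous (fun t : R => mkC 0 (2 * pi * clamp t) : C)}.
      apply: cont_mkC; first exact: cont_cstr.
      by apply: cont_mulr; [exact: cont_cstr|exact: cont_clamp].
    - by move=> t; split=> //=; exact: clamp01.
    - exists (mkC rr 0); split; first by rewrite -cmod_gt0 cmod_mkC0 gtr0_norm.
      move=> t; rewrite /G FE /p1 /= mulr1 addrC addKr//.
      by rewrite cmodM cmod_mkC0 cmod_cexp expR0 mulr1 gtr0_norm// /rr ltr_pwDr// ler_norm.
  by rewrite addrC addKr.
(* the horizontal sides are mapped to the same path *)
have LH : l (1, 1) - l (1, 0) = l (0, 1) - l (0, 0).
  have := lift (fun s => (clamp s, 1)) (fun s => l (clamp s, 0)) (c01 1) _ _ _ 1 0.
  rewrite !cl0 !cl1; apply.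
  - by move=> s; apply: (@cont_comp _ _ _ (fun s => (clamp s, 0)) l); [exact: c01|exact: cl].
  - by move=> s; split=> //=; exact: clamp01.
  - exists (G (0, 0)); split; first exact: F0.
    move=> s; rewrite mulrC lE /= cl0 clampK /G /p1 /= mulr0 mulr1.
    congr (F (a + _ * _)); apply: eq_ReIm; rewrite !ReImE ?expR0 ?cos0 ?sin0 ?mul1r.
      by rewrite mulr_natl cos2pi.
    by rewrite mulr_natl sin2pi.
have := L1; rewrite LH L0 subrr => /(congr1 Im) /=.
by have := @pi_gt0 R; lra.
Qed.

(* A logarithm [u] of [z - a] on [L] extends continuously by Tietze's theorem;
   replacing [z - a] by [cexp u] on [O] gives a nonvanishing map of the plane that
   winds once around [a] near infinity. *)
Lemma borsuk L O a M : compact L -> open O -> O a -> (forall z, O z -> cmod z <= M) ->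
  closure O `<=` O `|` L -> L `&` O = set0 -> ~ logat L a.
Proof.
move=> cL oO Oa OM clO LO [u [cu eu]].
have clL := compactC_closed cL.
have cuw : {within L, continuous u}.
  by apply: continuous_in_subspaceT => z; rewrite inE; exact: cu.
have [N HN] := compactC_bounded (continuous_compact cuw cL).
have HN' z : L z -> cmod (u z) <= N by move=> Lz; apply: HN; exists z.
have [gR cgR gRE] : exists2 g : C -> R, continuous g & forall z, L z -> g z = Re (u z).
  apply: (@tietzeR L (fun z => Re (u z)) N clL).
    by move=> z Lz; apply: (@cont_comp _ _ _ u (fun v : C => Re v)); [exact: cu|exact: continuous_Re].
  by move=> z Lz; apply: le_trans (Re_le_cmod _) (HN' z Lz).
have [gI cgI gIE] : exists2 g : C -> R, continuous g & forall z, L z -> g z = Im (u z).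
  apply: (@tietzeR L (fun z => Im (u z)) N clL).
    by move=> z Lz; apply: (@cont_comp _ _ _ u (fun v : C => Im v)); [exact: cu|exact: continuous_Im].
  by move=> z Lz; apply: le_trans (Im_le_cmod _) (HN' z Lz).
pose h z := cexp (mkC (gR z) (gI z)).
have ch z : {for z, continuous h}.
  apply: (@cont_comp _ _ _ (fun z : C => mkC (gR z) (gI z)) (@cexp R)); last exact: continuous_cexp.
  by apply: cont_mkC; [exact: cgR|exact: cgI].
have hL z : L z -> h z = z - a.
  by move=> Lz; rewrite /h gRE// gIE// mkC_eta eu.
pose F z := if pselect (O z) then h z else z - a.
have cs z : {for z, continuous (fun z : C => z - a)} by ccont.
have cF : continuous F.
  move=> z; have [Oz|nOz] := pselect (O z).
    apply: cont_near_eq (ch z); have : nbhs z O by apply: open_nbhs_nbhs; split.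
    by apply: filterS => w Ow; rewrite /F; case: pselect.
  (* Boundary points of [O] lie in [L], where the two formulas for [F] take the same value; this is
     the only place where they meet. *)
  have [clz|nclz] := pselect (closure O z).
    have Lz : L z by case: (clO z clz).
    apply/continuous_cmodP => e e0.
    have /continuous_cmodP /(_ e e0) c1 := ch z; have /continuous_cmodP /(_ e e0) c2 := cs z.
    have FzE : F z = z - a by rewrite /F; case: pselect.
    move: c1 c2; apply: filterS2 => w; rewrite FzE (hL z Lz) /F.
    by case: pselect.
  apply: cont_near_eq (cs z).
  have : nbhs z (~` closure O) by apply: open_nbhs_nbhs; split => //; exact/closed_openC/closed_closure.
  apply: filterS => w nw; rewrite /F; case: pselect => // Ow.
  by exfalso; apply: nw; exact: subset_closure.
apply: (@no_log_nonzero_winding F a (M + cmod a)) => //.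
  move=> z; rewrite /F; case: pselect => [Oz|nOz]; first exact: cexp_neq0.
  by rewrite subr_eq0; apply/eqP => za; rewrite za in nOz.
move=> z hz; rewrite /F; case: pselect => // Oz.
have h1 := OM z Oz; have h2 := cmodB z a.
have : cmod (z - a) < cmod (z - a) by lra.
by rewrite ltxx.
Qed.

Lemma convex_gt t r x y : 0 <= t <= 1 -> r < x -> r < y -> r < x + t * (y - x).
Proof.
move=> /andP[t0 t1] rx ry; have [xy|/ltW yx] := leP x y.
  have : 0 <= t * (y - x) by rewrite mulr_ge0// subr_ge0.
  lra.
have : t * (x - y) <= x - y by rewrite ler_piMl// subr_ge0.
by rewrite -opprB mulrN; lra.
Qed.

Lemma convex_lt t r x y : 0 <= t <= 1 -> x < r -> y < r -> x + t * (y - x) < r.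
Proof.
move=> tt xr yr; have := @convex_gt t (- r) (- x) (- y) tt.
by rewrite !ltrN2 => /(_ xr yr) h; rewrite -ltrN2; apply: lt_le_trans h _; lra.
Qed.

Lemma segment_component (A : set C) z w :
  (forall t, 0 <= t <= 1 -> A (z + mkC t 0 * (w - z))) -> connected_component A z w.
Proof.
move=> H; pose p t : C := z + mkC t 0 * (w - z).
have cp : continuous p.
  move=> t; change {for t, continuous (fun s : R => z + mkC s 0 * (w - z))}.
  apply: contD; first exact: cont_cst.
  by apply: contM; [exact: cont_hline|exact: cont_cst].
have cI : connected (p @` `[0, 1]%classic).
  apply: connected_continuous_connected; first exact: segment_connected.
  exact: continuous_subspaceT.
have i0 : `[0, 1]%classic (0 : R) by rewrite /= in_itv /= lexx ler01.
have i1 : `[0, 1]%classic (1 : R) by rewrite /= in_itv /= lexx ler01.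
have pz : (p @` `[0, 1]%classic) z.
  by exists 0 => //; rewrite /p; have -> : mkC 0 0 = 0 :> C by []; rewrite mul0r addr0.
have pA : p @` `[0, 1]%classic `<=` A.
  by move=> _ [x xx <-]; apply: H; move: xx; rewrite /= in_itv.
apply: (connected_component_max pz pA cI); exists 1 => //.
rewrite /p; have -> : mkC 1 0 = 1 :> C by [].
by rewrite mul1r addrC subrK.
Qed.

Lemma ball_component (A : set C) z w r : (forall v, cmod (v - z) < r -> A v) ->
  cmod (w - z) < r -> connected_component A z w.
Proof.
move=> rA wz; apply: segment_component => t /andP[t0 t1]; apply: rA.
rewrite addrC addKr cmodM cmod_mkC0 ger0_norm//.
by apply: le_lt_trans wz; rewrite ler_piMl// cmod_ge0.
Qed.

Lemma open_component (A : set C) z : open A -> open (connected_component A z).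
Proof.
move=> /openC_cmodP oA; apply/openC_cmodP => w zw.
have [r r0 rA] := oA w (connected_component_sub zw).
by exists r => // v vw; apply: connected_component_trans zw (ball_component rA vw).
Qed.

(** The outside of a square rather than of a disc: it is a union of four half-planes, whose
    convexity gives connectedness by segments. *)
Definition exterior M : set C := [set z | M < `|Re z| \/ M < `|Im z|].

Lemma open_exterior M : open (exterior M).
Proof.
apply/openC_cmodP => z [h|h].
  exists (`|Re z| - M); first by rewrite subr_gt0.
  move=> w wz; left; have := Re_le_cmod (w - z); rewrite !ReImE.
  by have := lerB_dist (Re z) (Re w); rewrite distrC; lra.
exists (`|Im z| - M); first by rewrite subr_gt0.
move=> w wz; right; have := Im_le_cmod (w - z); rewrite !ReImE.
by have := lerB_dist (Im z) (Im w); rewrite distrC; lra.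
Qed.

Lemma connected_exterior M : 0 <= M -> connected (exterior M).
Proof.
move=> M0; pose z0 : C := mkC (M + 1) 0.
suff -> : exterior M = connected_component (exterior M) z0 by exact: component_connected.
apply/seteqP; split; last exact: connected_component_sub.
have out w : [|| M < Re w, Re w < - M, M < Im w | Im w < - M] -> exterior M w.
  by case/or4P => h; [left|left|right|right]; rewrite ltr_normr; apply/orP;
    [left|right|left|right]; lra.
have rgt v w : M < Re v -> M < Re w -> connected_component (exterior M) v w.
  move=> hv hw; apply: segment_component => t /andP[t0 t1]; apply: out.
  apply/or4P/Or41; rewrite !ReImE mul0r subr0.
  by apply: convex_gt; rewrite ?t0.
have igt v w : M < Im v -> M < Im w -> connected_component (exterior M) v w.
  move=> hv hw; apply: segment_component => t /andP[t0 t1]; apply: out.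
  apply/or4P/Or43; rewrite !ReImE mul0r addr0.
  by apply: convex_gt; rewrite ?t0.
have rlt v w : Re v < - M -> Re w < - M -> connected_component (exterior M) v w.
  move=> hv hw; apply: segment_component => t /andP[t0 t1]; apply: out.
  apply/or4P/Or42; rewrite !ReImE mul0r subr0.
  by apply: convex_lt; rewrite ?t0.
have ilt v w : Im v < - M -> Im w < - M -> connected_component (exterior M) v w.
  move=> hv hw; apply: segment_component => t /andP[t0 t1]; apply: out.
  apply/or4P/Or44; rewrite !ReImE mul0r addr0.
  by apply: convex_lt; rewrite ?t0.
have Up : connected_component (exterior M) z0 (mkC (M + 1) (M + 1)) by apply: rgt => /=; lra.
have Dn : connected_component (exterior M) z0 (mkC (M + 1) (- (M + 1))) by apply: rgt => /=; lra.
have Lf : connected_component (exterior M) z0 (mkC (- (M + 1)) (M + 1)).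
  by apply: connected_component_trans Up _; apply: igt => /=; lra.
move=> z [|]; rewrite ltr_normr => /orP[h|h].
- by apply: rgt => //=; lra.
- by apply: connected_component_trans Lf _; apply: rlt => //=; lra.
- by apply: connected_component_trans Up _; apply: igt => //=; lra.
- by apply: connected_component_trans Dn _; apply: ilt => //=; lra.
Qed.

(** [W] is the component at infinity. The remaining part of the complement has exactly the
    properties that [borsuk] asks of [O]. *)
Lemma unbounded_component Z : compact Z -> exists W : set C, exists M,
  [/\ open W, connected W, W `<=` ~` Z, (forall z, (~` Z `\` W) z -> cmod z <= M) &
      open (~` Z `\` W) /\ closure (~` Z `\` W) `<=` (~` Z `\` W) `|` Z].
Proof.
move=> cZ; have clZ := compactC_closed cZ; have oZ := closed_openC clZ.
have [M' HM'] := compactC_bounded cZ; pose M := `|M'|.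
have HM z : Z z -> cmod z <= M by move=> /HM' h; apply: le_trans h (ler_norm _).
have M0 : 0 <= M by exact: normr_ge0.
pose z0 : C := mkC (M + 1) 0; pose W := connected_component (~` Z) z0.
have oW : open W by exact: open_component.
exists W, (2 * M + 2); split => //.
- exact: component_connected.
- exact: connected_component_sub.
- move=> z [nZz nWz]; rewrite leNgt; apply/negP => zM; apply: nWz.
  have ext w : exterior M w -> (~` Z) w.
    move=> hw /HM wM; case: hw => h.
      by have := le_trans (Re_le_cmod w) wM; rewrite leNgt h.
    by have := le_trans (Im_le_cmod w) wM; rewrite leNgt h.
  have e0 : exterior M z0 by left => /=; rewrite ger0_norm; lra.
  apply: (connected_component_max e0 ext (connected_exterior M0)).
  have [h|h] := ltP M `|Re z|; first by left.
  right; have := cmod_le_ReIm z; lra.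
- split.
    apply/openC_cmodP => z [nZz nWz].
    have [r r0 rZ] := (openC_cmodP _).1 oZ z nZz; exists r => // w wz; split; first exact: rZ.
    move=> Ww; apply: nWz; apply: connected_component_trans Ww _.
    exact/connected_component_sym/(ball_component rZ).
  move=> z clz; have [Zz|nZz] := pselect (Z z); first by right.
  left; split => // Wz; have [w [[_ nw] /nw]] := clz W (open_nbhs_nbhs (conj oW Wz)).
  by [].
Qed.

(* A special case of Janiszewski's theorem, by the criteria of Eilenberg and Borsuk. *)
Lemma connected_complU K L : compact K -> compact L -> K `&` L = set0 ->
  connected (~` K) -> connected (~` L) -> connected (~` (K `|` L)).
Proof.
move=> cK cL KL coK coL; have cZ : compact (K `|` L) by exact: compactU.
have [W [M [oW coW WZ OM [oO clO]]]] := unbounded_component cZ.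
suff -> : ~` (K `|` L) = W by [].
apply/seteqP; split=> // a nZa; apply: contrapT => nWa.
apply: (borsuk cZ oO (conj nZa nWa) OM clO).
  by rewrite -subset0 => z [Zz [/(_ Zz)]].
apply: logatU => //; first exact: compactC_closed.
  by apply: logat_connected => // Ka; apply: nZa; left.
by apply: logat_connected => // La; apply: nZa; right.
Qed.

(** The filled set is the complement of the unbounded component. If it contained a point [a] off
    [Omega], then [a] would lie in a hole of [L], where Borsuk's criterion forbids the logarithm
    that is assumed. *)
Lemma fill_compact L Omega : compact L -> L `<=` Omega ->
  (forall a, ~ Omega a -> logat L a) ->
  exists L' : set C, [/\ compact L', L `<=` L', L' `<=` Omega & connected (~` L')].
Proof.
move=> cL LO lg; have [W [M [oW coW WZ OM [oO clO]]]] := unbounded_component cL.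
have LW : L `<=` ~` W by move=> z Lz Wz; exact: WZ Wz Lz.
have [N HN] := compactC_bounded cL.
exists (~` W); split => //.
- apply: (@compactC R (~` W) (Num.max N M)); first exact: open_closedC.
  move=> z nWz; rewrite le_max; have [Lz|nLz] := pselect (L z); first by rewrite HN.
  by rewrite (OM z (conj nLz nWz)) orbT.
- move=> a nWa; apply: contrapT => nOa; have nLa : ~ L a by move=> /LO.
  apply: (borsuk cL oO (conj nLa nWa) OM clO); last exact: lg.
  by rewrite -subset0 => z [Lz [/(_ Lz)]].
- by rewrite setCK.
Qed.

End PlaneTopology.

(** * Logarithms on simply connected domains and filling of holes *)

Section SimplyConnected.
Variable R : realType.
Local Notation C := (Cplx R).
Local Notation Re := (@complex.Re R).
Local Notation Im := (@complex.Im R).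
Implicit Types (z w v a b : C) (x y s t r e M : R) (f g : C -> C) (K L Z Omega : set C).

Lemma cont_within_comp (T U V : topologicalType) (A : set U) (f : U -> V) (g : T -> U) :
  {within A, continuous f} -> continuous g -> (forall p, A (g p)) -> continuous (f \o g).
Proof.
move=> /subspace_continuousP cf cg gA p B fB.
have := cf (g p) (gA p) B fB; rewrite /within /= => h.
have /= := cg p _ h; rewrite /nbhs /=.
by apply: filterS => q /=; apply; exact: gA.
Qed.

Lemma cont_clamp_affine (k m : R) : continuous (fun s : R => clamp (k * s + m)).
Proof.
move=> s; change {for s, continuous (fun s : R => clamp (k * s + m))}.
apply: (@cont_comp _ _ _ (fun s : R => k * s + m) (@clamp R)); last exact: cont_clamp.
by rcont.
Qed.

(* [u] is the end value of a continuous logarithm of [c - a] along a path [c] in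
   [Omega] from [z0] to [z], starting at the value [u0]. *)
Definition path_log Omega a z0 u0 z u := exists c v : R -> C,
  [/\ continuous c, continuous v, forall s, Omega (c s),
      (forall s, cexp (v s) * (z0 - a) = cexp u0 * (c s - a)) &
      [/\ c 0 = z0, c 1 = z, v 0 = u0 & v 1 = u]].

Section lifting.
Variables (Omega : set C) (a z0 u0 : C).
Hypotheses (nOa : ~ Omega a) (Oz0 : Omega z0).

Let z0a : z0 - a != 0.
Proof. by rewrite subr_eq0; apply/eqP => h; apply: nOa; rewrite -h. Qed.

Lemma path_log_refl : path_log Omega a z0 u0 z0 u0.
Proof.
exists (fun=> z0), (fun=> u0); split=> // [s|s]; exact: cont_cst.
Qed.

(** The ball misses [a], so along the segment from [z] to [w] the ratio [(p - a) / (z - a)] stays at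
    distance less than 1 from 1, and [clog] continues the logarithm. *)
Lemma path_log_ball z u w r : path_log Omega a z0 u0 z u ->
  (forall v, cmod (v - z) < r -> Omega v) -> cmod (w - z) < r ->
  path_log Omega a z0 u0 w (u + clog ((w - a) / (z - a))).
Proof.
move=> [c [v [cc cv Oc ev [c0 c1 v0 v1]]]] rO wz.
have r0 : 0 < r by apply: le_lt_trans wz; exact: cmod_ge0.
have Oz : Omega z by apply: rO; rewrite subrr cmod0.
have za : z - a != 0 by rewrite subr_eq0; apply/eqP => h; rewrite h in Oz.
have ra : r <= cmod (z - a) by rewrite cmodBC leNgt; apply/negP => h; apply: nOa; exact: rO.
pose p x : C := z + mkC x 0 * (w - z).
have pz x : 0 <= x <= 1 -> cmod (p x - z) < r.
  move=> /andP[x0 x1]; rewrite /p addrC addKr cmodM cmod_mkC0 ger0_norm//.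
  by apply: le_lt_trans wz; rewrite ler_piMl// cmod_ge0.
have near x : 0 <= x <= 1 -> 0 < Re ((p x - a) / (z - a)).
  move=> xx; apply: near1_Re; have -> : (p x - a) / (z - a) - 1 = (p x - z) / (z - a) by field.
  rewrite cmod_div ltr_pdivrMr ?cmod_gt0// mul1r.
  exact: lt_le_trans (pz x xx) ra.
(* Concatenation without a case split: only [k1] moves up to [s = 1 / 2] and only [k2] afterwards,
   so adding the two paths and subtracting the junction point runs through both and is visibly
   continuous. *)
pose k1 s := clamp (2 * s + 0); pose k2 s := clamp (2 * s + - 1).
have ck1 : continuous k1 by exact: cont_clamp_affine.
have ck2 : continuous k2 by exact: cont_clamp_affine.
have kk s : k2 s = 0 \/ k1 s = 1.
  have [h|h] := leP s (1 / 2); [left|right]; rewrite /k1 /k2.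
    by apply: clamp_le0; lra.
  by apply: clamp_ge1; lra.
have cp : continuous (fun s => p (k2 s)).
  move=> s; change {for s, continuous (fun s => z + mkC (k2 s) 0 * (w - z))}.
  apply: contD; first exact: cont_cst.
  by apply: contM; [apply: cont_mkC; [exact: ck2|exact: cont_cstr]|exact: cont_cst].
have cck : continuous (fun s => c (k1 s)).
  by move=> s; apply: (@cont_comp _ _ _ k1 c); [exact: ck1|exact: cc].
have cvk : continuous (fun s => v (k1 s)).
  by move=> s; apply: (@cont_comp _ _ _ k1 v); [exact: ck1|exact: cv].
have p0 : p 0 = z by rewrite /p; have -> : mkC 0 0 = 0 :> C by []; rewrite mul0r addr0.
have p1 : p 1 = w.
  by rewrite /p; have -> : mkC 1 0 = 1 :> C by []; rewrite mul1r addrC subrK.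
exists (fun s => c (k1 s) + (p (k2 s) - z)),
  (fun s => v (k1 s) + clog ((p (k2 s) - a) / (z - a))).
split.
- move=> s; change {for s, continuous (fun s => c (k1 s) + (p (k2 s) - z))}.
  apply: contD; first exact: cck.
  by apply: contD; [exact: cp|exact: cont_cst].
- move=> s; change {for s, continuous (fun s => v (k1 s) + clog ((p (k2 s) - a) / (z - a)))}.
  apply: contD; first exact: cvk.
  apply: (@cont_comp _ _ _ (fun s => (p (k2 s) - a) / (z - a)) (@clog R)); last first.
    by apply: cont_clog; apply: near; exact: clamp01.
  by apply: contM; [apply: contD; [exact: cp|exact: cont_cst]|exact: cont_cst].
- move=> s; case: (kk s) => ->; first by rewrite p0 subrr addr0; exact: Oc.
  by rewrite c1 addrC subrK; apply: rO; apply: pz; exact: clamp01.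
- move=> s; rewrite cexpD clogK; last by apply: near; exact: clamp01.
  rewrite mulrAC ev; case: (kk s) => ->.
    by rewrite p0 subrr addr0 mulfV// mulr1.
  by rewrite c1; field.
- have k10 : k1 0 = 0 by rewrite /k1 mulr0 addr0 clamp_le0.
  have k20 : k2 0 = 0 by rewrite /k2 mulr0 add0r clamp_le0// lerN10.
  have k11 : k1 1 = 1 by rewrite /k1 clamp_ge1; lra.
  have k21 : k2 1 = 1 by rewrite /k2 clamp_ge1; lra.
  by rewrite k10 k20 k11 k21 p0 p1 c0 c1 v0 v1 divff// clog1 subrr !addr0 addrC subrK.
Qed.

(** The endpoints of such paths form a nonempty subset of [Omega] that is open and closed in it, by
    extension inside balls. *)
Lemma path_log_exists z : open Omega -> connected Omega -> Omega z ->
  exists u, path_log Omega a z0 u0 z u.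
Proof.
move=> /openC_cmodP oO coO Oz.
pose S := [set w | Omega w /\ exists u, path_log Omega a z0 u0 w u].
suff E : S = Omega by have [] : S z by rewrite E.
apply: coO.
- by exists z0; split => //; exists u0; exact: path_log_refl.
- exists S; last by rewrite setIC; apply/esym/setIidl => b [].
  apply/openC_cmodP => b [Ob [u hu]]; have [r r0 rO] := oO b Ob.
  exists r => // w wb; split; first exact: rO.
  by eexists; exact: path_log_ball hu rO wb.
- exists (closure S); first exact: closed_closure.
  rewrite predeqE => b; split; first by move=> Sb; split; [case: Sb|exact: subset_closure].
  move=> [Ob clb]; split => //; have [r r0 rO] := oO b Ob.
  have r2 : 0 < r / 2 by rewrite divr_gt0.
  have [|w [[Ow [u hu]] /= wb]] := clb [set w | cmod (w - b) < r / 2].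
    by apply/nbhs_cmodP; exists (r / 2).
  have rw v : cmod (v - w) < r / 2 -> Omega v.
    by move=> vw; apply: rO; have := cmod_tri v b w; lra.
  by eexists; apply: (path_log_ball hu rw); rewrite cmodBC.
Qed.

(* Uniqueness: the two paths form a loop, and a logarithm over a null homotopy of
   the loop takes the same value at its two ends. *)
Lemma path_log_unique z u u' : simply_connected Omega ->
  path_log Omega a z0 u0 z u -> path_log Omega a z0 u0 z u' -> u = u'.
Proof.
move=> sc [c [v [cc cv Oc ev [c0 c1 v0 v1]]]] [d [w [cd cw Od ew [d0 d1 w0 w1]]]].
(* Here [k2] stays at 1 until [s = 1 / 2] and then runs backwards to 0: the loop goes out along [c]
   and returns along [d]. *)
pose k1 s := clamp (2 * s + 0); pose k2 s := clamp (- 2 * s + 2).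
have ck1 : continuous k1 by exact: cont_clamp_affine.
have ck2 : continuous k2 by exact: cont_clamp_affine.
have kk s : k2 s = 1 \/ k1 s = 1.
  have [h|h] := leP s (1 / 2); [left|right]; rewrite /k1 /k2; apply: clamp_ge1; lra.
pose l s := c (k1 s) + (d (k2 s) - z); pose m s := v (k1 s) + (w (k2 s) - u').
have cl : continuous l.
  move=> s; change {for s, continuous (fun s => c (k1 s) + (d (k2 s) - z))}.
  apply: contD; first by apply: (@cont_comp _ _ _ k1 c); [exact: ck1|exact: cc].
  apply: contD; last exact: cont_cst.
  by apply: (@cont_comp _ _ _ k2 d); [exact: ck2|exact: cd].
have cm : continuous m.
  move=> s; change {for s, continuous (fun s => v (k1 s) + (w (k2 s) - u'))}.
  apply: contD; first by apply: (@cont_comp _ _ _ k1 v); [exact: ck1|exact: cv].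
  apply: contD; last exact: cont_cst.
  by apply: (@cont_comp _ _ _ k2 w); [exact: ck2|exact: cw].
have Ol s : Omega (l s).
  rewrite /l; case: (kk s) => ->; first by rewrite d1 subrr addr0; exact: Oc.
  by rewrite c1 addrC subrK; exact: Od.
have em s : cexp (m s) * (z0 - a) = cexp u0 * (l s - a).
  rewrite /m /l; case: (kk s) => ->; first by rewrite w1 d1 !subrr !addr0; exact: ev.
  rewrite v1 addrA cexpB cexpD [c 1 + _]addrC c1 subrK.
  have := ev 1; rewrite c1 v1 => eu; have := ew 1; rewrite d1 w1 => eu'.
  have E : cexp u = cexp u' by apply: (mulIf z0a); rewrite eu eu'.
  rewrite E [cexp u' * _]mulrC (mulfK (cexp_neq0 u')); exact: ew.
have k10 : k1 0 = 0 by rewrite /k1 mulr0 addr0 clamp_le0.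
have k20 : k2 0 = 1 by rewrite /k2 mulr0 add0r clamp_ge1//; lra.
have k11 : k1 1 = 1 by rewrite /k1 clamp_ge1; lra.
have k21 : k2 1 = 0 by rewrite /k2 clamp_le0; lra.
have l0 : l 0 = z0 by rewrite /l k10 k20 c0 d1 subrr addr0.
have l1 : l 1 = z0 by rewrite /l k11 k21 c1 d0 addrC subrK.
have m0 : m 0 = u0 by rewrite /m k10 k20 v0 w1 subrr addr0.
have m1 : m 1 = u + (u0 - u') by rewrite /m k11 k21 v1 w0.
have [||H [cH OH H1 H2]] := sc l _ (fun s _ => Ol s).
- by apply: continuous_in_subspaceT => s _; exact: cl.
- by rewrite l0 l1.
have in01 t : clamp t \in `[0, 1] by rewrite in_itv /= clamp01.
have cpair : continuous (fun p : R * R => (clamp p.1, clamp p.2)).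
  move=> p.
  have c1' : {for p, continuous (fun p : R * R => clamp p.1)}.
    by apply: (@cont_comp _ _ _ fst (@clamp R)); [exact: cvg_fst|exact: cont_clamp].
  have c2' : {for p, continuous (fun p : R * R => clamp p.2)}.
    by apply: (@cont_comp _ _ _ snd (@clamp R)); [exact: cvg_snd|exact: cont_clamp].
  exact: (cvg_pair c1' c2').
pose G p := H (clamp p.1, clamp p.2) - a.
have cHc : continuous (H \o (fun p : R * R => (clamp p.1, clamp p.2))).
  apply: (cont_within_comp cH cpair) => p; split=> /=; exact: in01.
have cG : continuous G.
  move=> p; change {for p, continuous (fun p => H (clamp p.1, clamp p.2) - a)}.
  by apply: contD; [exact: cHc|exact: cont_cst].
have G0 p : G p != 0.
  rewrite /G subr_eq0; apply/eqP => h.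
  by apply: nOa; rewrite -h; apply: OH; exact: in01.
have [lg clg lgE] := square_log cG (fun p _ => G0 p).
have GK p : G (clamp p.1, clamp p.2) = G p by rewrite /G /= !clampK.
have u0i : (0 : R) \in `[0, 1] by rewrite in_itv /= lexx ler01.
have u1i : (1 : R) \in `[0, 1] by rewrite in_itv /= lexx ler01.
have cl0 : clamp (0 : R) = 0 by rewrite clamp_le0.
have cl1 : clamp (1 : R) = 1 by rewrite clamp_ge1.
have G00 : G (0, 0) = z0 - a by rewrite /G /= cl0; have [-> _] := H1 0 u0i; rewrite l0.
(* along any path on which [G] is known up to a constant factor *)
have lift (q : R -> R * R) (k : R -> C) : continuous q -> continuous k ->
    (exists h, h != 0 /\ forall t, G (q t) = h * cexp (k t)) ->
    forall s t, lg (q s) - k s = lg (q t) - k t.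
  move=> cq ck [h [h0 hh]] s t.
  pose g x := lg (q x) - k x - (lg (q s) - k s).
  have cg : continuous g.
    move=> x; have e1 : {for x, continuous (fun x => lg (q x))}.
      by apply: (@cont_comp _ _ _ q lg); [exact: cq|exact: clg].
    have e2 := ck x.
    change {for x, continuous (fun x => lg (q x) - k x - (lg (q s) - k s))}.
    by apply: contD; [apply: contD; [exact: e1|apply: contN; exact: e2]|exact: cont_cst].
  have g1 x : cexp (g x) = 1.
    have E y : cexp (lg (q y) - k y) = h / G (0, 0).
      rewrite cexpB; have := lgE (q y); rewrite GK hh => h3.
      have k0 := cexp_neq0 (k y).
      have -> : h = cexp (lg (q y)) * G (0, 0) / cexp (k y) by rewrite h3 mulfK.
      by have g0 := G0 (0, 0); field; rewrite g0 k0.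
    by rewrite /g cexpB !E divff// mulf_neq0 ?invr_neq0.
  have := cexp_kernel_cst cg g1 t s; rewrite /g => /eqP.
  by rewrite [X in _ == X]subrr subr_eq0 => /eqP ->.
have cpl t : continuous (fun s : R => (s, t)).
  by move=> s; exact: (cvg_pair (@cont_idr R s) (@cont_cstr R _ t s)).
have cpr s : continuous (fun t : R => (s, t)).
  by move=> t; exact: (cvg_pair (@cont_cstr R _ s t) (@cont_idr R t)).
have c0' : continuous (fun _ : R => 0 : C) by move=> ?; exact: cont_cst.
have Lleft : lg (0, 0) = lg (0, 1).
  have := lift (fun t => (0, t)) (fun=> 0) (cpr 0) c0' _ 0 1; rewrite !subr0; apply.
  exists (z0 - a); split => // t; rewrite cexp0 mulr1 /G /= cl0.
  by have [-> _] := H2 (clamp t) (in01 t); rewrite l0.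
have Lright : lg (1, 0) = lg (1, 1).
  have := lift (fun t => (1, t)) (fun=> 0) (cpr 1) c0' _ 0 1; rewrite !subr0; apply.
  exists (z0 - a); split => // t; rewrite cexp0 mulr1 /G /= cl1.
  by have [_ ->] := H2 (clamp t) (in01 t); rewrite l0.
have Ltop : lg (0, 1) = lg (1, 1).
  have := lift (fun s => (s, 1)) (fun=> 0) (cpl 1) c0' _ 0 1; rewrite !subr0; apply.
  exists (z0 - a); split => // s; rewrite cexp0 mulr1 /G /= cl1.
  by have [_ ->] := H1 (clamp s) (in01 s); rewrite l0.
(* On this side [H] is the loop itself, with logarithm [m] up to a constant. Along the other three
   sides [lg] is constant, so [m] must return to its initial value, which is [u = u']. *)
have Lbot : lg (0, 0) - m (clamp 0) = lg (1, 0) - m (clamp 1).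
  apply: (lift (fun s => (s, 0)) (fun s => m (clamp s)) (cpl 0)).
    by move=> s; apply: (@cont_comp _ _ _ (@clamp R) m); [exact: cont_clamp|exact: cm].
  have e0 := cexp_neq0 u0.
  exists ((z0 - a) / cexp u0); split; first by rewrite mulf_neq0// invr_neq0.
  move=> s; rewrite /G /= cl0; have [-> _] := H1 (clamp s) (in01 s).
  by rewrite mulrAC [_ * cexp (m _)]mulrC em mulrAC mulfV// mul1r.
move: Lbot; rewrite cl0 cl1 m0 m1 Lleft Ltop Lright => /eqP.
rewrite -subr_eq0 => /eqP h; apply/eqP; rewrite -subr_eq0 -h; apply/eqP.
by ring.
Qed.

End lifting.

(** The end value of the logarithm along paths is a well-defined function of [z]; by uniqueness it
    is given near [z] by the extension formula of [path_log_ball], hence it is continuous. *)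
Lemma logat_simply_connected Omega a : domain Omega -> simply_connected Omega ->
  ~ Omega a -> logat Omega a.
Proof.
move=> [[z0 Oz0] oO coO] sc nOa.
have lgx z : exists u, Omega z -> path_log Omega a z0 0 z u.
  have [Oz|nOz] := pselect (Omega z); last by exists 0.
  by have [u hu] := path_log_exists 0 nOa Oz0 oO coO Oz; exists u.
have [u hu] := choice lgx.
have z0a : z0 - a != 0 by rewrite subr_eq0; apply/eqP => h; rewrite h in Oz0.
have uE z : Omega z -> cexp (u z) * (z0 - a) = z - a.
  move=> /hu[c [v [_ _ _ ev [_ c1 _ v1]]]].
  by have := ev 1; rewrite c1 v1 cexp0 mul1r.
(* adjust by a logarithm of [z0 - a] *)
have [k kE] := cexp_surj z0a.
exists (fun z => u z + k); split=> z Oz; last by rewrite cexpD kE uE.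
apply: contD; last exact: cont_cst.
have [r r0 rO] := (openC_cmodP _).1 oO z Oz.
have za : z - a != 0 by rewrite subr_eq0; apply/eqP => h; rewrite h in Oz.
have cz : {for z, continuous (fun w => u z + clog ((w - a) / (z - a)))}.
  apply: contD; first exact: cont_cst.
  apply: (@cont_comp _ _ _ (fun w : C => (w - a) / (z - a)) (@clog R)); first by ccont.
  by rewrite divff//; apply: cont_clog; rewrite Re1 ltr01.
apply: cont_near_eq cz; apply/nbhs_cmodP; exists r => // w wz.
apply: (path_log_unique nOa Oz0 sc (path_log_ball nOa (hu z Oz) rO wz)).
exact: hu (rO w wz).
Qed.

Theorem simply_connected_fill Omega L : domain Omega -> simply_connected Omega ->
  compact L -> L `<=` Omega ->
  exists L' : set C, [/\ compact L', L `<=` L', L' `<=` Omega & connected (~` L')].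
Proof.
move=> dO sc cL LO; apply: fill_compact => // a nOa.
exact: logatS LO (logat_simply_connected dO sc nOa).
Qed.

End SimplyConnected.

(** * Simultaneous approximation and countable families of compact sets and polynomials *)

Section Approximation.
Variable R : realType.
Local Notation C := (Cplx R).
Local Notation Re := (@complex.Re R).
Local Notation Im := (@complex.Im R).
Implicit Types (z w v a b c : C) (x y s t r e M : R) (f g : C -> C) (K L Omega A : set C)
  (P h : {poly C}) (N : nat).

Lemma derivable_poly P z : derivable (fun w => P.[w]) z 1.
Proof.
elim/poly_ind: P => [|P c IH].
  have -> : (fun w => (0 : {poly C}).[w]) = cst 0 by apply/funext => w; rewrite horner0.
  exact: derivable_cst.
have -> : (fun w => (P * 'X + c%:P).[w]) = (fun w => P.[w]) * id + cst c.
  by apply/funext => w; rewrite !hornerE.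
apply: derivableD; last exact: derivable_cst.
by apply: derivableM; [exact: IH|exact: derivable_id].
Qed.

(** Runge's theorem approximates [f - h] on the filled [L] and [0] on [K]; adding [h] back gives
    both targets at once. *)
Lemma approx_pair Omega K L f h e : domain Omega -> simply_connected Omega ->
  compact L -> L `<=` Omega -> compact K -> K `<=` ~` Omega -> connected (~` K) ->
  holo_on Omega f -> 0 < e ->
  exists P, (forall z, L z -> cmod (P.[z] - f z) <= e) /\
    (forall z, K z -> cmod (P.[z] - h.[z]) <= e).
Proof.
move=> dO sc cL LO cK KO ccK hf e0.
have [L' [cL' LL' LO' ccL']] := simply_connected_fill dO sc cL LO.
have KL0 : K `&` L' = set0 by apply/seteqP; split=> // z [Kz Lz]; exact: KO Kz (LO' z Lz).
have [_ oO _] := dO.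
have hfh : holo_on Omega (f - (fun w => h.[w])).
  by move=> w Ow; apply: derivableB; [exact: hf|exact: derivable_poly].
have [P [PL PK]] := runge cK cL' oO KO LO' (connected_complU cK cL' KL0 ccK ccL') hfh e0.
exists (P + h); split=> z hz; rewrite hornerD.
  have := PL z (LL' z hz).
  by have -> : P.[z] - (f - (fun w => h.[w])) z = P.[z] + h.[z] - f z by rewrite !fctE; ring.
by rewrite addrK; exact: PK.
Qed.

Definition qpt (p : rat * rat) : C := mkC (ratr p.1) (ratr p.2).

Lemma qpt_dense z e : 0 < e -> exists p, cmod (qpt p - z) < e.
Proof.
move=> e0; have e2 : 0 < e / 2 by rewrite divr_gt0.
have [p] : exists p : rat, ratr p \in `](Re z), (Re z + e / 2)[.
  by apply: rat_in_itvoo; rewrite ltrDl.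
rewrite in_itv /= => /andP[p1 p2].
have [q] : exists q : rat, ratr q \in `](Im z), (Im z + e / 2)[.
  by apply: rat_in_itvoo; rewrite ltrDl.
rewrite in_itv /= => /andP[q1 q2].
exists (p, q); apply: le_lt_trans (cmod_le_ReIm _) _; rewrite /qpt !ReImE /=.
by rewrite !gtr0_norm ?subr_gt0//; lra.
Qed.

Lemma connected_cball a r : connected [set w | cmod (w - a) < r].
Proof.
have [r0|r0] := ltP 0 r; last first.
  have -> : [set w | cmod (w - a) < r] = set0.
    apply/seteqP; split=> // w /= /lt_le_trans/(_ r0).
    by rewrite ltNge cmod_ge0.
  exact: connected0.
set A := [set w | _].
have -> : A = connected_component A a.
  apply/seteqP; split; last exact: connected_component_sub.
  by move=> w Aw; apply: (@ball_component R A a w r).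
exact: component_connected.
Qed.

Lemma open_cball a r : open [set w : C | cmod (w - a) < r].
Proof.
apply/openC_cmodP => z /= zr; exists (r - cmod (z - a)); first by rewrite subr_gt0.
by move=> w ww; have := cmod_tri w a z; lra.
Qed.

Lemma connected_plane : connected [set: C].
Proof.
have -> : [set: C] = connected_component setT 0; last exact: component_connected.
by apply/seteqP; split=> // w _; exact: segment_component.
Qed.

Definition qball (p : (rat * rat) * rat) : set C :=
  [set w | cmod (w - qpt p.1) < ratr p.2].

Definition qext N (l : seq ((rat * rat) * rat)) : set C :=
  exterior N%:R `|` [set z | exists2 p, p \in l & qball p z].

(* A countable family absorbing every compact set with connected complement off
   [Omega]: the complement of [Omega `|` V], for [V] connected, meeting [Omega],
   and a finite union of rational balls near infinity. *)
Definition Kset Omega N l : set C :=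
  [set z | [/\ connected (qext N l), qext N l `&` Omega !=set0, ~ Omega z & ~ qext N l z]].

Lemma open_qext N l : open (qext N l).
Proof.
apply: openU; first exact: open_exterior.
apply/openC_cmodP => z [p pl pz].
have /openC_cmodP/(_ z pz)[e e0 he] := @open_cball (qpt p.1) (ratr p.2).
by exists e => // w wz; exists p => //; exact: he.
Qed.

Lemma Kset_sub Omega N l : Kset Omega N l `<=` ~` Omega.
Proof. by move=> z []. Qed.

Lemma compact_Kset Omega N l : open Omega -> compact (Kset Omega N l).
Proof.
move=> oO.
(* For an unsuitable index the set is empty, so every index gives an admissible compact set. *)
have [[c1 c2]|nc] := pselect (connected (qext N l) /\ qext N l `&` Omega !=set0); last first.
  have -> : Kset Omega N l = set0 by apply/seteqP; split=> // z [? ? _ _]; apply: nc.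
  exact: compact0.
apply: (@compactC R _ (N%:R + N%:R)).
  have -> : Kset Omega N l = ~` (Omega `|` qext N l).
    apply/seteqP; split=> [z [_ _ nO nq] []//|z /not_orP[nO nq]]; by split.
  by apply: open_closedC; apply: openU; [exact: oO|exact: open_qext].
move=> z [_ _ _ nq]; apply: le_trans (cmod_le_ReIm z) _.
by apply: lerD; rewrite leNgt; apply/negP => h; apply: nq; left; [left|right].
Qed.

Lemma connected_complKset Omega N l : connected Omega -> connected (~` Kset Omega N l).
Proof.
move=> cO.
have [[c1 c2]|nc] := pselect (connected (qext N l) /\ qext N l `&` Omega !=set0); last first.
  have -> : ~` Kset Omega N l = setT; last exact: connected_plane.
  by apply/seteqP; split=> // z _ [? ? _ _]; apply: nc.
have -> : ~` Kset Omega N l = qext N l `|` Omega; last exact: connectedU.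
apply/seteqP; split=> [z nK|z [h|h] [_ _ h1 h2]//].
by apply: contrapT => /not_orP[nO nq]; apply: nK.
Qed.

Lemma qext_cons N p l : qext N (p :: l) = qext N l `|` qball p.
Proof.
apply/seteqP; split=> z.
  move=> [h|[q]]; first by left; left.
  by rewrite in_cons => /orP[/eqP -> ?|ql qz]; [right|left; right; exists q].
move=> [[h|[q ql qz]]|h]; [by left|right; exists q => //|right; exists p => //].
  by rewrite in_cons ql orbT.
by rewrite in_cons eqxx.
Qed.

(** The points that can be joined to infinity by a connected finite chain of rational balls off [K]
    form an open and closed part of the connected complement of [K]. Hence some chain reaches a
    point of [Omega], and its index works. *)
Lemma Kset_cover Omega K : Omega !=set0 -> compact K -> K `<=` ~` Omega ->
  connected (~` K) -> exists N l, K `<=` Kset Omega N l.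
Proof.
move=> [z0 Oz0] cK KO ccK.
have [M KM] := compactC_bounded cK.
have /openC_cmodP oK : open (~` K) by apply: closed_openC; exact: compactC_closed cK.
pose N := (Num.truncn M).+1.
have MN : M < N%:R by exact: truncnS_gt.
have extK : exterior N%:R `<=` ~` K.
  move=> z ez Kz; have zM := KM z Kz.
  by case: ez => ?; [have := Re_le_cmod z|have := Im_le_cmod z]; lra.
pose W := [set z | exists l, [/\ qext N l `<=` ~` K, connected (qext N l) & qext N l z]].
have W0 : W !=set0.
  have eN : qext N [::] = exterior N%:R.
    by apply/seteqP; split=> z; [case=> // -[]|left].
  exists (mkC (N%:R + 1) 0), [::]; rewrite eN; split=> //.
    by apply: connected_exterior; rewrite ler0n.
  by left; rewrite ReImE; have := ler_norm (N%:R + 1 : R); lra.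
have WK : W `<=` ~` K by move=> z [l [h _ hz]]; exact: h.
suff WE : W = ~` K.
  have [l [h1 h2 h3]] : W z0 by rewrite WE => /KO.
  exists N, l => z Kz; split=> //; [by exists z0|exact: KO|].
  by move=> /h1.
apply: ccK => //.
  exists W; last by rewrite setIC; apply/esym/setIidl.
  apply/openC_cmodP => z [l [h1 h2 h3]].
  have /openC_cmodP/(_ z h3)[e e0 he] := @open_qext N l.
  by exists e => // w wz; exists l; split=> //; exact: he.
exists (closure W); first exact: closed_closure.
rewrite predeqE => b; split; first by move=> Wb; split; [exact: WK|exact: subset_closure].
move=> [nKb clb]; have [r r0 rK] := oK b nKb.
have r4 : 0 < r / 4 by rewrite divr_gt0.
have [p pb] := qpt_dense b r4.
(* The centre is within [r / 4] of [b]: a radius above [r / 4] makes the ball contain [b], and one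
   below [r / 2] keeps it within distance [r] of [b], off [K]. *)
have [q] : exists q : rat, ratr q \in `](r / 4), (r / 2)[ by apply: rat_in_itvoo; lra.
rewrite in_itv /= => /andP[q1 q2].
have bq : qball (p, q) b by rewrite /qball /= cmodBC; lra.
have qK : qball (p, q) `<=` ~` K.
  by move=> w; rewrite /qball /= => wp; apply: rK; have := cmod_tri w b (qpt p); lra.
have [|w [[l [h1 h2 h3]] wq]] := clb (qball (p, q)).
  apply/nbhs_cmodP; have /openC_cmodP := @open_cball (qpt p) (ratr q).
  by move=> /(_ b bq).
exists ((p, q) :: l); rewrite qext_cons; split.
- by move=> z [/h1|/qK].
- apply: connectedU; [by exists w|exact: h2|exact: connected_cball].
- by right.
Qed.

Definition qpoly (l : seq (rat * rat)) : {poly C} := Poly (map qpt l).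

(** Induction along Horner's scheme, the error of the inner polynomial being multiplied by at most
    [M] in modulus. *)
Lemma qpoly_dense P M e : 0 < e ->
  exists l, forall z, cmod z <= M -> cmod ((qpoly l).[z] - P.[z]) <= e.
Proof.
elim/poly_ind: P e => [|P c IH] e e0.
  by exists [::] => z _; rewrite /qpoly /= horner0 subrr cmod0 ltW.
have M0 : 0 < `|M| + 1 by rewrite ltr_pwDr.
have e2 : 0 < e / 2 by rewrite divr_gt0.
have [l hl] := IH _ (divr_gt0 e2 M0).
have [p hp] := qpt_dense c e2.
exists (p :: l) => z zM; rewrite /qpoly /= horner_cons -/(qpoly l) !hornerE.
have -> : (qpoly l).[z] * z + qpt p - (P.[z] * z + c) =
    ((qpoly l).[z] - P.[z]) * z + (qpt p - c) by ring.
apply: le_trans (cmodD _ _) _; rewrite cmodM.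
have zM1 : cmod z <= `|M| + 1 by have := ler_norm M; lra.
have : cmod ((qpoly l).[z] - P.[z]) * cmod z <= e / 2 / (`|M| + 1) * (`|M| + 1).
  by apply: ler_pM; rewrite ?cmod_ge0// hl.
by rewrite divfK ?gt_eqF//; lra.
Qed.

End Approximation.

(** * Pade approximants: the linear system, existence, uniqueness, regularity *)

Section Pade.
Variable R : realType.
Local Notation C := (Cplx R).
Implicit Types (z w v a b c : C) (x y s r e M : R) (f g : C -> C) (P Q A B : {poly C})
  (zeta : C) (N p q n k i j : nat).

Definition holo_near zeta f := exists2 r, 0 < r & holo_on [set w | cmod (w - zeta) < r] f.

(** The point [h = 0] is left out so that a factor [h] can be cancelled in the induction of
    [bigO_coef]. *)
Definition bigO n g := exists K r,
  [/\ 0 <= K, 0 < r & forall h : C, h != 0 -> cmod h < r -> cmod (g h) <= K * cmod h ^+ n].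

Lemma bigOD n f g : bigO n f -> bigO n g -> bigO n (fun h => f h + g h).
Proof.
move=> [K [r [K0 r0 hf]]] [L [s [L0 s0 hg]]].
exists (K + L), (Num.min r s); split; rewrite ?addr_ge0 ?lt_min ?r0//.
move=> h h0; rewrite lt_min => /andP[hr hs].
by apply: le_trans (cmodD _ _) _; rewrite mulrDl; apply: lerD; [exact: hf|exact: hg].
Qed.

Lemma bigON n f : bigO n f -> bigO n (fun h => - f h).
Proof.
move=> [K [r [K0 r0 hf]]]; exists K, r; split=> // h h0 hr.
by rewrite cmodN; exact: hf.
Qed.

Lemma bigOM n P g : bigO n g -> bigO n (fun h => P.[h] * g h).
Proof.
move=> [K [r [K0 r0 hg]]]; have [M M0 PM] := poly_bounded P 1.
exists (M * K), (Num.min r 1); split; rewrite ?mulr_ge0 ?lt_min ?r0 ?ltr01//.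
move=> h h0; rewrite lt_min => /andP[hr hs]; rewrite cmodM -(mulrA M).
by apply: ler_pM; rewrite ?cmod_ge0//; [apply: PM; exact: ltW|exact: hg].
Qed.

Lemma bigO_near n f g r : 0 < r -> (forall h, cmod h < r -> f h = g h) ->
  bigO n f -> bigO n g.
Proof.
move=> r0 fg [K [s [K0 s0 hf]]]; exists K, (Num.min r s); split; rewrite ?lt_min ?r0//.
by move=> h h0; rewrite lt_min => /andP[hr hs]; rewrite -fg//; exact: hf.
Qed.

Lemma bigO_coef0 P : bigO 1 (fun h => P.[h]) -> P`_0 = 0.
Proof.
elim/poly_ind: P => [|P c _]; first by rewrite coef0.
rewrite coefD coefMX coefC /= add0r => -[K [r [K0 r0 hP]]].
have [M M0 PM] := poly_bounded P 1.
apply: contrapT => /eqP c0.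
have c1 : 0 < cmod c by rewrite cmod_gt0.
have KM : 0 < K + M + 1 by rewrite ltr_pwDr// addr_ge0.
(* Small enough that both estimates apply and that [(K + M) * t], which would have to dominate the
   constant coefficient [c], is below its modulus. *)
pose t := Num.min (Num.min (r / 2) 1) (cmod c / (2 * (K + M + 1))).
have t0 : 0 < t by rewrite !lt_min !divr_gt0// ?ltr01// mulr_gt0.
have tr : t <= r / 2 by rewrite !ge_min lexx.
have t1 : t <= 1 by rewrite !ge_min lexx orbT.
have tc : t <= cmod c / (2 * (K + M + 1)) by rewrite !ge_min lexx orbT.
have ht : cmod (mkC t 0) = t by rewrite cmod_mkC0 gtr0_norm.
have h0 : mkC t 0 != 0 by rewrite -cmod_gt0 ht.
have := hP _ h0; rewrite ht expr1 !hornerE => h1.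
have {}h1 : cmod (P.[mkC t 0] * mkC t 0 + c) <= K * t by apply: h1; lra.
have h2 : cmod (P.[mkC t 0] * mkC t 0) <= M * t.
  by rewrite cmodM ht ler_wpM2r ?(ltW t0)//; apply: PM; rewrite ht.
have h3 : cmod c <= K * t + M * t.
  have -> : c = (P.[mkC t 0] * mkC t 0 + c) - P.[mkC t 0] * mkC t 0 by ring.
  by apply: le_trans (cmodB _ _) _; exact: lerD.
have h4 : (K + M + 1) * t <= cmod c / 2.
  move: tc; rewrite ler_pdivlMr ?mulr_gt0// => tc.
  by rewrite ler_pdivlMr//; move: tc; lra.
by have : cmod c < cmod c; [nra|rewrite ltxx].
Qed.

Lemma bigO_coef n P : bigO n (fun h => P.[h]) -> forall i, (i < n)%N -> P`_i = 0.
Proof.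
elim: n P => // n IH P hP.
have P0 : P`_0 = 0.
  apply: bigO_coef0; case: hP => K [r [K0 r0 hP]].
  exists K, (Num.min r 1); split; rewrite ?lt_min ?r0 ?ltr01//.
  move=> h h0; rewrite lt_min => /andP[hr h1]; apply: le_trans (hP h h0 hr) _.
  rewrite exprS expr1 mulrA; apply: ler_piMr; first by rewrite mulr_ge0 ?cmod_ge0.
  by rewrite exprn_ile1 ?cmod_ge0// ltW.
elim/poly_ind: P P0 hP => [|P c _]; first by move=> _ _ i _; rewrite coef0.
rewrite coefD coefMX coefC /= add0r => -> hP [|i]; first by rewrite coefD coefMX coefC addr0.
rewrite ltnS coefD coefMX coefC addr0 /=; apply: IH.
case: hP => K [r [K0 r0 hP]]; exists K, r; split=> // h h0 hr.
have := hP h h0 hr; rewrite !hornerE cmodM exprSr mulrA ler_pM2r//.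
by rewrite cmod_gt0.
Qed.

Definition taylor_poly f zeta N : {poly C} := \poly_(i < N) taylor_coef f zeta i.

Lemma taylor_bigO f zeta N : holo_near zeta f ->
  bigO N (fun h => f (zeta + h) - (taylor_poly f zeta N).[h]).
Proof.
move=> [r r0 hf]; have r3 : 0 < r / 3 by rewrite divr_gt0.
have hS : holo_on (onR (complex.Re zeta - r / 3) (complex.Re zeta + r / 3)
    (complex.Im zeta - r / 3) (complex.Im zeta + r / 3)) f.
  by move=> w /square_cmod ww; apply: hf => /=; lra.
have [K [s [K0 s0 h]]] := taylor_remainder N hS (square_in zeta r3).
by exists K, s; split=> // h' _ hs; rewrite horner_poly; exact: h.
Qed.

(** A polynomial is determined up to degree [N - 1] by its values modulo [O(h ^ N)]. Taylor
    coefficients are from here on computed by this characterization and not by derivatives. *)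
Lemma taylor_polyP f zeta N P : holo_near zeta f ->
  bigO N (fun h => f (zeta + h) - P.[h]) -> forall i, (i < N)%N -> taylor_coef f zeta i = P`_i.
Proof.
move=> hf hP i iN.
have h : bigO N (fun h => (P - taylor_poly f zeta N).[h]).
  apply: (bigO_near (r := 1) _ _ (bigOD (taylor_bigO N hf) (bigON hP))) => // h _.
  by rewrite !hornerE; ring.
have := bigO_coef h iN; rewrite coefB coef_poly iN => /eqP.
by rewrite subr_eq0 => /eqP ->.
Qed.

Lemma taylor_coef_near f g zeta r : 0 < r -> holo_near zeta f -> holo_near zeta g ->
  (forall w, cmod (w - zeta) < r -> f w = g w) -> taylor_coef f zeta = taylor_coef g zeta.
Proof.
move=> r0 hf hg fg; apply/funext => -[n|//].
rewrite (taylor_polyP hf _ (ltnSn n) (P := taylor_poly g zeta n.+1)).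
  by rewrite coef_poly ltnSn.
apply: (bigO_near r0 _ (taylor_bigO n.+1 hg)) => h hr.
by rewrite fg//; congr (cmod _ < _): hr; ring.
Qed.

(** Recentring at [zeta]: the coefficients of the shifted polynomial are the Taylor coefficients of
    [P] at [zeta]. *)
Definition shiftp zeta P : {poly C} := P \Po ('X + zeta%:P).
Definition unshiftp zeta P : {poly C} := P \Po ('X - zeta%:P).

Lemma shiftpK zeta : cancel (shiftp zeta) (unshiftp zeta).
Proof.
move=> P; rewrite /shiftp /unshiftp -comp_polyA comp_polyD comp_polyX comp_polyC.
by rewrite subrK comp_polyXr.
Qed.

Lemma unshiftpK zeta : cancel (unshiftp zeta) (shiftp zeta).
Proof.
move=> P; rewrite /shiftp /unshiftp -comp_polyA comp_polyB comp_polyX comp_polyC.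
by rewrite addrK comp_polyXr.
Qed.

Lemma size_shiftp zeta P : size (shiftp zeta P) = size P.
Proof. by rewrite size_comp_poly2 // size_XaddC. Qed.

Lemma size_unshiftp zeta P : size (unshiftp zeta P) = size P.
Proof. by rewrite size_comp_poly2 // size_XsubC. Qed.

Lemma horner_shiftp zeta P h : (shiftp zeta P).[h] = P.[zeta + h].
Proof. by rewrite horner_comp !hornerE addrC. Qed.

Lemma horner_unshiftp zeta P w : (unshiftp zeta P).[w] = P.[w - zeta].
Proof. by rewrite horner_comp !hornerE. Qed.

Lemma coef_mul_eq0 (b c : {poly C}) N : b`_0 != 0 ->
  (forall i, (i < N)%N -> (b * c)`_i = 0) -> forall i, (i < N)%N -> c`_i = 0.
Proof.
move=> b0 hbc; elim/ltn_ind => i IH iN.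
have := hbc i iN; rewrite coefM big_ord_recl subn0 big1 ?addr0.
  by move/eqP; rewrite mulf_eq0 (negPf b0) => /eqP.
move=> j _; rewrite lift0 IH ?mulr0//; last exact: leq_ltn_trans (leq_subr _ _) iN.
by rewrite -(ltn_add2r j.+1) subnK ?ltn_ord// -addSnnS leq_addr.
Qed.

Lemma holo_near_div zeta A B : B.[zeta] = 1 -> holo_near zeta (fun z => A.[z] / B.[z]) /\
  exists2 r, 0 < r & forall h, cmod h < r -> B.[zeta + h] != 0.
Proof.
move=> B1.
have cB : {for zeta, continuous (fun z => B.[z])}.
  by apply: derivable_cont; exact: derivable_poly.
have [r r0 hr] := (cont_cmodP _ _).1 cB 1 ltr01.
have Bn0 w : cmod (w - zeta) < r -> B.[w] != 0.
  move=> /hr; rewrite B1; apply: contraTneq => ->.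
  by rewrite sub0r cmodN cmod1 ltxx.
split.
  exists r; first exact: r0.
  move=> w wr; change (derivable ((fun z => A.[z]) * (fun z => (B.[z])^-1)) w 1).
  apply: derivableM; first exact: derivable_poly.
  by apply: derivableV; [exact: (Bn0 w wr)|exact: derivable_poly].
by exists r => // h hh; apply: Bn0; congr (cmod _ < _): hh; ring.
Qed.

(** The nonlinear condition on [A / B] becomes linear, [A = B f] modulo order [p + q + 1], because
    [B] takes the value 1 at [zeta] and so can be cancelled among truncated series. *)
Lemma is_padeP f zeta p q A B : holo_near zeta f ->
  is_pade f zeta p q (A, B) <->
  [/\ (size A <= p.+1)%N, (size B <= q.+1)%N, B.[zeta] = 1 &
    forall i, (i < (p + q).+1)%N ->
      (shiftp zeta A)`_i = (shiftp zeta B * taylor_poly f zeta (p + q).+1)`_i].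
Proof.
move=> hf; rewrite /is_pade [(A, B).1]/= [(A, B).2]/=; set N := (p + q).+1.
set a := shiftp zeta A; set b := shiftp zeta B.
suff key : B.[zeta] = 1 -> forall T : {poly C}, (size T <= N)%N ->
   (forall v : nat, (v < N)%N -> taylor_coef
 (fun z => A.[z] / B.[z]) zeta v = T`_v) <->
   (forall i, (i < N)%N -> a`_i = (b * T)`_i).
  have sT : (size (taylor_poly f zeta N) <= N)%N by exact: size_poly.
  split=> -[h1 h2 h3 h4]; split=> //.
    by apply/(key h3 _ sT) => v vN; rewrite coef_poly vN; exact: h4.
  by move=> v vN; rewrite (key h3 _ sT).2// coef_poly ltnS vN.
move=> B1 T _; have [hg [r r0 Bn0]] := holo_near_div A B1.
set g := (fun z => A.[z] / B.[z]) in hg *.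
have ag i : (i < N)%N -> a`_i = (b * taylor_poly g zeta N)`_i.
  move=> iN; apply/eqP; rewrite -subr_eq0 -coefB; apply/eqP; apply: bigO_coef i iN.
  apply: (bigO_near r0 _ (bigOM b (taylor_bigO N hg))) => h hr.
  rewrite /g !hornerE /a /b !horner_shiftp mulrBr; congr (_ - _).
  by rewrite mulrC divfK//; exact: Bn0.
have b0 : b`_0 != 0 by rewrite -horner_coef0 horner_shiftp addr0 B1 oner_eq0.
have gT i : (i < N)%N -> (taylor_poly g zeta N - T)`_i = taylor_coef g zeta i - T`_i.
  by move=> iN; rewrite coefB coef_poly iN.
split=> h i iN.
  rewrite ag//; apply/eqP; rewrite -subr_eq0 -coefB -mulrBr coefM big1// => j _.
  have jN : (i - j < N)%N by exact: leq_ltn_trans (leq_subr _ _) iN.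
  by rewrite gT// h// subrr mulr0.
apply/eqP; rewrite -subr_eq0 -gT//; apply/eqP; apply: (coef_mul_eq0 b0) iN => k kN.
by rewrite mulrBr coefB -ag// -h// subrr.
Qed.

(** In degrees [p + 1] to [p + q] the product [B f] must vanish. Listing the coefficients of [b] in
    reverse order, [b_q] first, makes the matrix of these equations the Hankel matrix. *)
Lemma coef_mul_taylor f zeta p q (b : {poly C}) (i : 'I_q) : (size b <= q.+1)%N ->
  (b * taylor_poly f zeta (p + q).+1)`_(p.+1 + i) =
  b`_0 * taylor_coef f zeta (p.+1 + i)%:Z + \sum_(k < q) hankel f zeta p q i k * b`_(q - k).
Proof.
move=> sb; set t := taylor_coef f zeta.
have iN : (p.+1 + i < (p + q).+1)%N by rewrite addSn ltnS ltn_add2l.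
have E : (b * taylor_poly f zeta (p + q).+1)`_(p.+1 + i) =
    \sum_(j < q.+1) b`_j * t ((p.+1 + i)%:Z - (j : nat)%:Z).
  (* Both sums are extended to one common range: beyond [p + 1 + i] the Taylor index is negative,
     and beyond [q] the coefficient of [b] is zero. *)
  pose F j := b`_j * t ((p.+1 + i)%:Z - j%:Z).
  have n1 : ((p.+1 + i).+1 <= (p + q).+2)%N by exact: leqW iN.
  have n2 : (q.+1 <= (p + q).+2)%N by rewrite ltnS leqW// leq_addl.
  rewrite coefM (eq_bigr (fun j : 'I_(p.+1 + i).+1 => F j)); last first.
    move=> j _; rewrite /F coef_poly (leq_ltn_trans (leq_subr _ _) iN).
    by rewrite -subzn// -ltnS.
  rewrite (big_ord_widen _ F n1) (big_ord_widen _ F n2).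
  rewrite big_mkcond [RHS]big_mkcond; apply: eq_bigr => j _; rewrite /F.
  case: ifPn => [j1|]; case: ifPn => [j2|] //.
    by rewrite -leqNgt => j2; rewrite nth_default ?mul0r//; exact: leq_trans sb j2.
  rewrite -leqNgt => j1; have -> : t ((p.+1 + i)%:Z - (j : nat)%:Z) = 0; last by rewrite mulr0.
  rewrite -opprB subzn//; last exact: ltnW.
  by have := j1; rewrite -subn_gt0; case: (j - (p.+1 + i))%N.
rewrite E big_ord_recl subr0; congr (_ + _).
rewrite (reindex_inj rev_ord_inj); apply: eq_bigr => k _.
have kq : (k < q)%N by exact: ltn_ord.
rewrite lift0 /= subnSK// mxE mulrC; congr (t _ * _).
by rewrite -subzn ?(ltnW kq)// !PoszD -!natz; ring.
Qed.

Section Solution.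
Variables (t : int -> C) (p q : nat).

Definition hankel_of : 'M[C]_q :=
  \matrix_(i < q, j < q) t (p%:Z - q%:Z + (i : nat)%:Z + (j : nat)%:Z + 1).

(* [hankel_of^-1] by Cramer's formula, without the case split of [invmx], so that
   its entries are visibly continuous in [t]. *)
Definition pade_den : {poly C} :=
  1 + \sum_(k < q)
    (- ((\det hankel_of)^-1 *: \adj hankel_of *m (\col_(i < q) t (p.+1 + i)%:Z))) k 0 *: 'X^(q - k).

Definition pade_num : {poly C} :=
  \poly_(i < p.+1) (pade_den * \poly_(j < (p + q).+1) t j)`_i.

Lemma size_pade_num : (size pade_num <= p.+1)%N. Proof. exact: size_poly. Qed.

Lemma size_pade_den : (size pade_den <= q.+1)%N.
Proof.
apply: leq_trans (size_polyD _ _) _; rewrite geq_max size_poly1 /=.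
apply: leq_trans (size_sum _ _ _) _; apply/bigmax_leqP => k _.
by apply: leq_trans (size_scale_leq _ _) _; rewrite size_polyXn ltnS leq_subr.
Qed.

Lemma coef_pade_den0 : pade_den`_0 = 1.
Proof.
rewrite coefD coefC eqxx coef_sum big1 ?addr0// => k _.
by rewrite coefZ coefXn eq_sym subn_eq0 leqNgt ltn_ord mulr0.
Qed.

Lemma coef_pade_den (k : 'I_q) : pade_den`_(q - k) =
  (- ((\det hankel_of)^-1 *: \adj hankel_of *m (\col_(i < q) t (p.+1 + i)%:Z))) k 0.
Proof.
rewrite coefD coefC subn_eq0 leqNgt ltn_ord add0r coef_sum (bigD1 k)//= big1 ?addr0.
  by rewrite coefZ coefXn eqxx mulr1.
move=> j jk; rewrite coefZ coefXn.
have -> : (q - k == q - j)%N = false; last by rewrite mulr0.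
apply: contraNF jk => /eqP h; apply/eqP/val_inj => /=.
by rewrite -(subKn (ltnW (ltn_ord j))) -h subKn// ltnW.
Qed.

End Solution.

Lemma adj_invmx n (H : 'M[C]_n) : \det H != 0 -> (\det H)^-1 *: \adj H = invmx H.
Proof. by move=> h; rewrite /invmx unitmxE unitfE h. Qed.

(** The equations in degrees [p + 1] to [p + q] determine the denominator through the invertible
    Hankel matrix, and those up to degree [p] then give the numerator. *)
Lemma pade_unique f zeta p q AB : holo_near zeta f -> pade_regular p q zeta f ->
  is_pade f zeta p q AB ->
  AB = (unshiftp zeta (pade_num (taylor_coef f zeta) p q),
        unshiftp zeta (pade_den (taylor_coef f zeta) p q)).
Proof.
case: AB => A B hf reg /(is_padeP _ _ _ _ hf) [sA sB B1 h].
set t := taylor_coef f zeta; set N := (p + q).+1 in h *.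
have b1 : (shiftp zeta B)`_0 = 1 by rewrite -horner_coef0 horner_shiftp addr0.
have sb : (size (shiftp zeta B) <= q.+1)%N by rewrite size_shiftp.
have sa : (size (shiftp zeta A) <= p.+1)%N by rewrite size_shiftp.
pose x : 'cV[C]_q := \col_k (shiftp zeta B)`_(q - k).
have Hx : hankel f zeta p q *m x = - \col_(i < q) t (p.+1 + i)%:Z.
  apply/matrixP => i j; rewrite !mxE.
  have iN : (p.+1 + i < N)%N by rewrite /N addSn ltnS ltn_add2l.
  have := h _ iN; rewrite (nth_default 0); last first.
    by apply: leq_trans sa _; exact: leq_addr.
  rewrite coef_mul_taylor// b1 mul1r => /esym/eqP; rewrite addrC addr_eq0 => /eqP <-.
  by apply: eq_bigr => k _; rewrite [x _ _]mxE.
have xE : x = - (invmx (hankel f zeta p q) *m (\col_(i < q) t (p.+1 + i)%:Z)).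
  by rewrite -mulmxN -Hx mulmxA mulVmx ?mul1mx// unitmxE unitfE.
have bE : shiftp zeta B = pade_den t p q.
  apply/polyP => j; have [jq|jq] := ltnP q j.
    by rewrite !nth_default//; [exact: leq_trans (size_pade_den _ _ _) jq|exact: leq_trans sb jq].
  case: j jq => [_|j jq]; first by rewrite b1 coef_pade_den0.
  have jE : j.+1 = (q - (rev_ord (Ordinal jq) : 'I_q))%N by rewrite /= subKn.
  by rewrite jE coef_pade_den -/(hankel f zeta p q) adj_invmx// -xE mxE.
have aE : shiftp zeta A = pade_num t p q.
  apply/polyP => j; rewrite /pade_num coef_poly; case: ltnP => jp.
    rewrite h; first by rewrite bE.
    by rewrite ltnS; apply: leq_trans (leq_addr _ _); rewrite -ltnS.
  by rewrite nth_default//; exact: leq_trans sa jp.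
by rewrite -aE -bE !shiftpK.
Qed.

Lemma pade_exists f zeta p q : holo_near zeta f -> pade_regular p q zeta f ->
  is_pade f zeta p q (unshiftp zeta (pade_num (taylor_coef f zeta) p q),
        unshiftp zeta (pade_den (taylor_coef f zeta) p q)).
Proof.
move=> hf reg; apply/is_padeP => //.
set t := taylor_coef f zeta; set N := (p + q).+1.
rewrite !size_unshiftp; split; rewrite ?size_pade_num ?size_pade_den//.
  by rewrite horner_unshiftp subrr horner_coef0 coef_pade_den0.
move=> i iN; rewrite !unshiftpK [in LHS]/pade_num coef_poly; case: ltnP => // pi.
have iq : (i - p.+1 < q)%N by rewrite ltn_subLR// addSn.
have -> : i = (p.+1 + Ordinal iq)%N by rewrite /= subnKC.
rewrite coef_mul_taylor ?size_pade_den// coef_pade_den0 mul1r.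
set x := - (invmx (hankel f zeta p q) *m (\col_(i < q) t (p.+1 + i)%:Z)).
have Hx : hankel f zeta p q *m x = - \col_(i < q) t (p.+1 + i)%:Z.
  by rewrite mulmxN mulmxA mulmxV ?mul1mx// unitmxE unitfE.
rewrite (eq_bigr (fun k : 'I_q => hankel f zeta p q (Ordinal iq) k * x k 0)); last first.
  by move=> k _; rewrite coef_pade_den adj_invmx.
by have /matrixP/(_ (Ordinal iq) 0) := Hx; rewrite !mxE => ->; rewrite subrr.
Qed.

Lemma padeE f zeta p q : holo_near zeta f -> pade_regular p q zeta f ->
  pade f zeta p q = (unshiftp zeta (pade_num (taylor_coef f zeta) p q),
        unshiftp zeta (pade_den (taylor_coef f zeta) p q)).
Proof.
move=> hf reg; apply: xget_unique; first exact: pade_exists.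
by move=> AB; exact: pade_unique.
Qed.

Lemma is_pade_eq f zeta p q AB : holo_near zeta f -> pade_regular p q zeta f ->
  is_pade f zeta p q AB -> pade f zeta p q = AB.
Proof. by move=> hf reg /(pade_unique hf reg) ->; exact: padeE. Qed.

(** A null vector of the Hankel matrix would give a second pair [a'], [b'] with [a' = b' f] modulo
    order [p + q + 1], with [b'] nonzero but vanishing at [0]. Then [a b' = b a'], so coprimality
    makes [b] divide [b'], and by size they are proportional; this contradicts the values 1 and 0 at
    the origin. *)
Lemma coprime_pade_regular f zeta p q (a b : {poly C}) : holo_near zeta f ->
  (size a <= p.+1)%N -> size b = q.+1 -> b`_0 = 1 -> coprimep b a ->
  (forall i, (i < (p + q).+1)%N -> a`_i = (b * taylor_poly f zeta (p + q).+1)`_i) ->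
  pade_regular p q zeta f.
Proof.
move=> hf sa sb b0 cop hab; apply/negP => /det0P[v v0 vH].
set T := taylor_poly f zeta (p + q).+1 in hab.
pose b' : {poly C} := \sum_(k < q) v 0 k *: 'X^(q - k).
have b'0 : b'`_0 = 0.
  rewrite coef_sum big1// => k _.
  by rewrite coefZ coefXn eq_sym subn_eq0 leqNgt ltn_ord mulr0.
have b'k (k : 'I_q) : b'`_(q - k) = v 0 k.
  rewrite coef_sum (bigD1 k)//= big1 ?addr0; first by rewrite coefZ coefXn eqxx mulr1.
  move=> j jk; rewrite coefZ coefXn.
  have -> : (q - k == q - j)%N = false; last by rewrite mulr0.
  apply: contraNF jk => /eqP h; apply/eqP/val_inj => /=.
  by rewrite -(subKn (ltnW (ltn_ord j))) -h subKn// ltnW.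
have sb' : (size b' <= q.+1)%N.
  apply: leq_trans (size_sum _ _ _) _; apply/bigmax_leqP => k _.
  by apply: leq_trans (size_scale_leq _ _) _; rewrite size_polyXn ltnS leq_subr.
pose a' : {poly C} := \poly_(i < p.+1) (b' * T)`_i.
have sa' : (size a' <= p.+1)%N by exact: size_poly.
have hab' i : (i < (p + q).+1)%N -> a'`_i = (b' * T)`_i.
  move=> iN; rewrite /a' coef_poly; case: ltnP => // pi.
  have iq : (i - p.+1 < q)%N by rewrite ltn_subLR// addSn.
  have -> : i = (p.+1 + Ordinal iq)%N by rewrite /= subnKC.
  rewrite coef_mul_taylor// b'0 mul0r add0r.
  (* [det0P] provides a left null vector, while the equations use the rows of the matrix; the Hankel
     matrix is symmetric. *)
  have /matrixP/(_ 0 (Ordinal iq)) := vH; rewrite !mxE => h.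
  rewrite -[LHS]h; apply: eq_bigr => k _; rewrite b'k mulrC !mxE; congr (taylor_coef _ _ _ * _).
  by rewrite -!natz; ring.
have ab i : (i < (p + q).+1)%N -> (a * b' - b * a')`_i = 0.
  move=> iN; have -> : a * b' - b * a' = (a - b * T) * b' - b * (a' - b' * T) by ring.
  rewrite coefB !coefM !big1 ?subrr// => j _.
    by rewrite coefB hab' ?subrr ?mulr0//; exact: leq_ltn_trans (leq_subr _ _) iN.
  have ji : (j <= i)%N by rewrite -ltnS.
  by rewrite coefB hab ?subrr ?mul0r//; exact: leq_ltn_trans ji iN.
(* Both products have degree at most [p + q], so the congruence modulo order [p + q + 1] is an
   equality. *)
have E : a * b' = b * a'.
  apply/eqP; rewrite -subr_eq0; apply/eqP/polyP => i; rewrite coef0.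
  case: (ltnP i (p + q).+1) => iN; first exact: ab.
  rewrite nth_default//; apply: leq_trans iN.
  apply: leq_trans (size_polyD _ _) _; rewrite size_polyN geq_max; apply/andP; split.
    apply: leq_trans (size_polyMleq _ _) _; rewrite -ltnS.
    have : (size a + size b' <= p.+1 + q.+1)%N by exact: leq_add.
    by rewrite addSn addnS; case: (size a + size b')%N.
  apply: leq_trans (size_polyMleq _ _) _; rewrite -ltnS sb.
  have : (q.+1 + size a' <= q.+1 + p.+1)%N by rewrite leq_add2l.
  by rewrite addSn /= => h; apply: leq_trans h _; rewrite addSn addnS addnC.

have bb' : b %| b' by rewrite -(Gauss_dvdpr _ cop) E dvdp_mulr.
have b'n0 : b' != 0.
  apply: contraNneq v0 => h; apply/eqP/matrixP => i k.
  by rewrite ord1 -b'k h coef0 mxE.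
have /eqP : size b = size b'.
  by apply/eqP; rewrite eqn_leq dvdp_leq// sb.
rewrite dvdp_size_eqp// => /eqp_root/(_ 0).
by rewrite /root !horner_coef0 b0 b'0 eqxx oner_eq0.
Qed.

End Pade.

(** * Polynomials with a regular approximant near a prescribed one *)

Section PadeExample.
Variable R : realType.
Local Notation C := (Cplx R).
Implicit Types (z w v c u : C) (x y s r e M : R) (f g : C -> C) (P Q A B F a b : {poly C})
  (zeta : C) (N p q n k i j : nat).

(** Only the jet of order [p + q] matters, so [F] can be a polynomial truncation of the series of
    [a / b]. *)
Lemma pade_jet zeta p q a b F : (size a <= p.+1)%N -> size b = q.+1 -> b`_0 = 1 ->
  coprimep b a -> (forall i, (i < (p + q).+1)%N -> a`_i = (b * F)`_i) ->
  pade_regular p q zeta (fun z => F.[z - zeta]) /\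
  pade (fun z => F.[z - zeta]) zeta p q = (unshiftp zeta a, unshiftp zeta b).
Proof.
move=> sa sb b0 cop hab; set f := fun z => F.[z - zeta]; set N := (p + q).+1 in hab.
have fE : f = fun z => (unshiftp zeta F).[z].
  by apply/funext => z; rewrite horner_unshiftp.
have hf : holo_near zeta f.
  by exists 1; [exact: ltr01|move=> w _; rewrite fE; exact: derivable_poly].
have TF i : (i < N)%N -> (taylor_poly f zeta N)`_i = F`_i.
  move=> iN; rewrite coef_poly iN; apply: (taylor_polyP hf _ iN).
  exists 0, 1; split; [exact: lexx|exact: ltr01|move=> h _ _].
  by rewrite /f [zeta + h]addrC addrK subrr cmod0 mul0r.
have hT i : (i < N)%N -> a`_i = (b * taylor_poly f zeta N)`_i.
  move=> iN; rewrite hab// !coefM; apply: eq_bigr => j _.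
  by rewrite TF//; exact: leq_ltn_trans (leq_subr _ _) iN.
have reg := coprime_pade_regular hf sa sb b0 cop hT.
split; first exact: reg.
apply: (is_pade_eq hf reg); apply/(is_padeP _ _ _ _ hf); rewrite !size_unshiftp !unshiftpK sb.
by split=> //; rewrite horner_unshiftp subrr horner_coef0.
Qed.

Lemma seq_cmod_bounded (l : seq C) : exists2 M, 0 <= M & forall z, z \in l -> cmod z <= M.
Proof.
elim: l => [|c l [M M0 IH]]; first by exists 0.
exists (M + cmod c); first by rewrite addr_ge0 ?cmod_ge0.
move=> z; rewrite in_cons => /orP[/eqP ->|/IH]; have := cmod_ge0 c; lra.
Qed.

Lemma roots_bounded P : P != 0 -> exists2 M, 0 <= M & forall z, root P z -> cmod z <= M.
Proof.
move=> P0; have [l E] := closed_field_poly_normal P.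
have [M M0 lM] := seq_cmod_bounded l; exists M => // z.
by rewrite E rootZ ?lead_coef_eq0// root_prod_XsubC; exact: lM.
Qed.

Lemma geometric_near1 u s N : 0 <= s <= 1 -> cmod u <= s ->
  cmod (\sum_(k < N.+1) u ^+ k - 1) <= N%:R * s.
Proof.
move=> /andP[s0 s1] us; have us1 := le_trans us s1; rewrite big_ord_recl expr0 addrC addKr.
apply: le_trans (cmod_sum _ _ _) _.
rewrite -[N in X in _ <= X]card_ord -sum1_card natr_sum mulr_suml; apply: ler_sum => k _.
rewrite lift0 exprS cmodM mul1r; apply: le_trans us.
by rewrite ler_piMr ?cmod_ge0// cmodX exprn_ile1 ?cmod_ge0.
Qed.

Lemma inv1B_near1 u s : s <= 1 / 2 -> cmod u <= s -> cmod ((1 - u)^-1 - 1) <= 2 * s.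
Proof.
move=> s2 us.
have h : 1 / 2 <= cmod (1 - u).
  have : cmod 1 <= cmod (1 - u) + cmod u by rewrite -[X in cmod X](subrK u); exact: cmodD.
  by rewrite cmod1; lra.
have u0 : 1 - u != 0 by rewrite -cmod_gt0; lra.
have -> : (1 - u)^-1 - 1 = u / (1 - u) by field.
rewrite cmod_div ler_pdivrMr; last by lra.
have s0 : 0 <= s := le_trans (cmod_ge0 u) us.
have : 0 <= s * (cmod (1 - u) - 1 / 2) by rewrite mulr_ge0// subr_ge0.
by move=> h1; apply: le_trans us _; lra.
Qed.

(* [P / (1 - e (z - zeta)^q)] for small [e], truncated to a polynomial. *)
Lemma pade_example zeta P p q M e : (size P <= p.+1)%N -> P != 0 -> 0 < e ->
  exists f A B, [/\ forall z, derivable f z 1,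
    pade_regular p q zeta f /\ pade f zeta p q = (A, B),
    forall z, cmod z <= M -> cmod (f z - P.[z]) <= e &
    forall z, cmod z <= M -> B.[z] != 0 /\ cmod (A.[z] / B.[z] - P.[z]) <= e].
Proof.
move=> sP P0 e0; pose a := shiftp zeta P.
have sa : (size a <= p.+1)%N by rewrite size_shiftp.
have dF F : forall z, derivable (fun z => F.[z - zeta]) z 1.
  move=> z; have -> : (fun z => F.[z - zeta]) = fun z => (unshiftp zeta F).[z].
    by apply/funext => w; rewrite horner_unshiftp.
  exact: derivable_poly.
have aP z : a.[z - zeta] = P.[z] by rewrite horner_shiftp addrC subrK.
have uaP : unshiftp zeta a = P by exact: shiftpK.
(* For [q = 0] the denominator used below would be the constant [1 - c], not normalized to 1; there
   [P] is its own approximant. *)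
have [q0|q0] := posnP q.
  have h i : (i < (p + 0).+1)%N -> a`_i = (1 * a)`_i by rewrite mul1r.
  have [reg E] := @pade_jet zeta p 0 a 1 a sa (size_poly1 _) (coefC 1 0) (coprime1p _) h.
  rewrite q0; exists (fun z => a.[z - zeta]), P, (unshiftp zeta 1); split=> //.
  - by split; rewrite ?E ?uaP.
  - by move=> z _; rewrite aP subrr cmod0 ltW.
  - by move=> z _; rewrite horner_unshiftp hornerE oner_eq0 divr1 subrr cmod0 ltW.
have a0 : a != 0 by rewrite -size_poly_eq0 size_shiftp size_poly_eq0.
have [M0 M00 rM] := roots_bounded a0.
have [Q0 Q00 PQ] := poly_bounded P M.
pose N := (p + q)%N.
(* The disc of radius [M1] contains all roots of [a] and all [z - zeta] with [cmod z <= M]. Keeping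
   [c * w ^+ q] at most [1 / 2] there gives both coprimality with [a] and a denominator without
   zeros on the set in question. *)
pose M1 := M0 + `|M| + cmod zeta + 1.
have M10 : 0 < M1 by have := cmod_ge0 zeta; have := normr_ge0 M; rewrite /M1; lra.
have D0 : 0 < 2 * (Q0 + 1) * (N%:R + 1) by rewrite !mulr_gt0// ltr_pwDr// ler0n.
(* The second term serves two errors at once: [Q0 * (N * s)] for the truncated series and
   [Q0 * (2 * s)] for the fraction. *)
pose s := Num.min (1 / 2) (e / (2 * (Q0 + 1) * (N%:R + 1))).
have s0 : 0 < s by rewrite lt_min !divr_gt0// ltr01.
have s2 : s <= 1 / 2 by rewrite ge_min lexx.
have se : s * (2 * (Q0 + 1) * (N%:R + 1)) <= e by rewrite -ler_pdivlMr// ge_min lexx orbT.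
have N0 : 0 <= (N%:R : R) by exact: ler0n.
have se1 : Q0 * (N%:R * s) <= e.
  have : 0 <= s * Q0 by rewrite mulr_ge0// ltW.
  have : 0 <= s * N%:R by rewrite mulr_ge0// ltW.
  have : 0 <= s * Q0 * N%:R by rewrite !mulr_ge0// ltW.
  by move: se; nra.
have se2 : Q0 * (2 * s) <= e.
  have : 0 <= s * Q0 by rewrite mulr_ge0// ltW.
  have : 0 <= s * N%:R by rewrite mulr_ge0// ltW.
  have : 0 <= s * Q0 * N%:R by rewrite !mulr_ge0// ltW.
  by move: se; nra.
pose t := s / M1 ^+ q; have M1q : 0 < M1 ^+ q by rewrite exprn_gt0.
have t0 : 0 < t by rewrite divr_gt0.
pose c : C := mkC t 0.
have c0 : c != 0 by rewrite -cmod_gt0 cmod_mkC0 gtr0_norm.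
have cw w : cmod w <= M1 -> cmod (c * w ^+ q) <= s.
  move=> wM; rewrite cmodM cmod_mkC0 gtr0_norm// cmodX /t mulrAC ler_pdivrMr//.
  rewrite ler_wpM2l ?(ltW s0)//; apply: lerXn2r => //; rewrite nnegrE ?cmod_ge0//.
  exact: ltW.
pose y : {poly C} := c *: 'X^q; pose b : {poly C} := 1 - y.
have sy : size y = q.+1 by rewrite size_scale// size_polyXn.
have sb : size b = q.+1.
  by rewrite /b addrC size_polyDl size_polyN sy// size_poly1.
have b0 : b`_0 = 1 by rewrite coefB coefC coefZ coefXn (ltn_eqF q0) mulr0 subr0.
have bE w : b.[w] = 1 - c * w ^+ q by rewrite /b /y !hornerE.
have cop : coprimep b a.
  rewrite coprimep_sym; apply: Pdiv.ClosedField.root_coprimep => w /rM wM.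
  rewrite bE -cmod_gt0; have wM1 : cmod w <= M1.
    by have := cmod_ge0 zeta; have := normr_ge0 M; rewrite /M1; lra.
  have : cmod 1 <= cmod (1 - c * w ^+ q) + cmod (c * w ^+ q).
    by rewrite -[X in cmod X](subrK (c * w ^+ q)); exact: cmodD.
  by have := cw w wM1; rewrite cmod1; lra.
(* Then [b * F = a - a * y ^+ N.+1], and since [q > 0] the last term has order at least [N + 1],
   beyond the jet. *)
pose F : {poly C} := a * \sum_(k < N.+1) y ^+ k.
have hab i : (i < N.+1)%N -> a`_i = (b * F)`_i.
  move=> iN; have -> : b * F = a - a * y ^+ N.+1.
    have := subrX1 y N.+1; set S := \sum_(k < N.+1) y ^+ k => E.
    rewrite /F -/S /b.
    have -> : (1 - y) * (a * S) = - (a * ((y - 1) * S)) by ring.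
    by rewrite -E; ring.
  rewrite coefB /y exprZn -exprM -scalerAr coefZ coefMXn.
  by rewrite (leq_trans iN) ?mulr0 ?subr0// leq_pmull.
have [reg E] := @pade_jet zeta p q a b F sa sb b0 cop hab.
exists (fun z => F.[z - zeta]), P, (unshiftp zeta b).
have wM z : cmod z <= M -> cmod (z - zeta) <= M1.
  move=> zM; apply: le_trans (cmodB _ _) _; have := ler_norm M.
  by rewrite /M1; lra.
split; [exact: dF|by split; [exact: reg|rewrite E uaP]|move=> z zM|move=> z zM].
  rewrite /F hornerM aP -[X in _ - X]mulr1 -mulrBr cmodM.
  have -> : (\sum_(k < N.+1) y ^+ k).[z - zeta] = \sum_(k < N.+1) (c * (z - zeta) ^+ q) ^+ k.
    by rewrite horner_sum; apply: eq_bigr => k _; rewrite horner_exp /y hornerZ hornerXn.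
  apply: le_trans se1; apply: ler_pM; rewrite ?cmod_ge0//; first exact: PQ.
  apply: geometric_near1; last exact: cw (wM z zM).
  by rewrite (ltW s0) /=; lra.
rewrite horner_unshiftp bE; have u := cw _ (wM z zM).
set k := c * _ in u *.
split.
  rewrite -cmod_gt0; have : cmod 1 <= cmod (1 - k) + cmod k.
    by rewrite -[X in cmod X](subrK k); exact: cmodD.
  by rewrite cmod1; lra.
rewrite -[X in _ - X]mulr1 -mulrBr cmodM; apply: le_trans se2.
by apply: ler_pM; rewrite ?cmod_ge0//; [exact: PQ|exact: inv1B_near1].
Qed.

End PadeExample.

(** * Continuity of Pade approximants in the Taylor coefficients *)

Section PadeContinuity.
Variable R : realType.
Local Notation C := (Cplx R).
Implicit Types (z w : C) (e M d : R) (A B P Q : {poly C}) (K : set C).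

Section Filters.
Variables (T : Type) (G : set_system T).
Hypothesis FG : Filter G.

Lemma cvgC_eqfun (f g : T -> C) (a : C) : (forall x, f x = g x) ->
  g x @[x --> G] --> a -> f x @[x --> G] --> a.
Proof. by move=> /funext ->. Qed.

Lemma cvgC_eq2 (f g : T -> C) (a b : C) : (forall x, f x = g x) -> a = b ->
  g x @[x --> G] --> b -> f x @[x --> G] --> a.
Proof. by move=> /funext -> ->. Qed.

Lemma cvgC_sum (I : Type) (l : seq I) (P : pred I) (f : I -> T -> C) (a : I -> C) :
  (forall i, P i -> f i x @[x --> G] --> a i) ->
  \sum_(i <- l | P i) f i x @[x --> G] --> \sum_(i <- l | P i) a i.
Proof.
move=> h; elim: l => [|i l IH].
  by rewrite big_nil; apply: cvgC_eqfun => [x|]; [rewrite big_nil|exact: cvg_cst].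
rewrite big_cons; apply: cvgC_eqfun => [x|]; first by rewrite big_cons.
case: ifPn => Pi; last exact: IH.
by apply: cvgD; [exact: h|exact: IH].
Qed.

Lemma cvgC_prod (I : Type) (l : seq I) (f : I -> T -> C) (a : I -> C) :
  (forall i, f i x @[x --> G] --> a i) ->
  \prod_(i <- l) f i x @[x --> G] --> \prod_(i <- l) a i.
Proof.
move=> h; elim: l => [|i l IH].
  by rewrite big_nil; apply: cvgC_eqfun => [x|]; [rewrite big_nil|exact: cvg_cst].
rewrite big_cons; apply: cvgC_eqfun => [x|]; first by rewrite big_cons.
by apply: cvgM; [exact: h|exact: IH].
Qed.

Lemma cvgC_det n (A : T -> 'M[C]_n) (B : 'M[C]_n) :
  (forall i j, A x i j @[x --> G] --> B i j) -> \det (A x) @[x --> G] --> \det B.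
Proof.
move=> h; apply: cvgC_sum => s _.
by apply: cvgM; [exact: cvg_cst|apply: cvgC_prod => i; exact: h].
Qed.

Lemma cvgC_adj n (A : T -> 'M[C]_n) (B : 'M[C]_n) i j :
  (forall i j, A x i j @[x --> G] --> B i j) ->
  (\adj (A x)) i j @[x --> G] --> (\adj B) i j.
Proof.
move=> h; rewrite mxE; apply: cvgC_eqfun => [x|]; first by rewrite mxE.
apply: cvgM; first exact: cvg_cst.
apply: cvgC_det => k l; rewrite !mxE.
apply: cvgC_eqfun => [x|]; first by rewrite !mxE.
exact: h.
Qed.

Section Coefficients.
Variables (t : T -> int -> C) (u : int -> C) (p q : nat).
Hypothesis tu : forall n, t x n @[x --> G] --> u n.

Lemma cvg_hankel_det : \det (hankel_of (t x) p q) @[x --> G] --> \det (hankel_of u p q).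
Proof.
apply: cvgC_det => i j; rewrite mxE.
by apply: cvgC_eqfun => [x|]; [rewrite mxE|exact: tu].
Qed.

Hypothesis reg : \det (hankel_of u p q) != 0.

Lemma cvg_pade_den i : (pade_den (t x) p q)`_i @[x --> G] --> (pade_den u p q)`_i.
Proof.
pose D (v : int -> C) := (1 : {poly C})`_i + \sum_(k < q)
    - (\sum_(j < q) (\det (hankel_of v p q))^-1 * (\adj (hankel_of v p q)) k j * v (p.+1 + j)%N)
    * ('X^(q - k))`_i.
have E (v : int -> C) : (pade_den v p q)`_i = D v.
  rewrite coefD coef_sum; congr (_ + _); apply: eq_bigr => k _.
  rewrite coefZ !mxE; congr (- _ * _); apply: eq_bigr => j _.
  by rewrite !mxE.
suff h : D (t x) @[x --> G] --> D u.
  by clearbody D; refine (cvgC_eq2 (fun x => E (t x)) (E u) h).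
apply: cvgD; first exact: cvg_cst.
apply: cvgC_sum => k _; apply: cvgM; last exact: cvg_cst.
apply: cvgN; apply: cvgC_sum => j _; apply: cvgM; last exact: tu.
apply: cvgM; first by apply: cvgV; [exact: reg|exact: cvg_hankel_det].
apply: cvgC_adj => i' j'; rewrite mxE.
by apply: cvgC_eqfun => [x|]; [rewrite mxE|exact: tu].
Qed.

Lemma cvg_pade_num i : (pade_num (t x) p q)`_i @[x --> G] --> (pade_num u p q)`_i.
Proof.
pose D (v : int -> C) := if (i < p.+1)%N then
    \sum_(j < i.+1) (pade_den v p q)`_j * (if (i - j < (p + q).+1)%N then v (i - j)%N else 0)
    else 0.
have E (v : int -> C) : (pade_num v p q)`_i = D v.
  rewrite coef_poly /D; case: ifP => // _.
  by rewrite coefM; apply: eq_bigr => j _; rewrite coef_poly.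
suff h : D (t x) @[x --> G] --> D u.
  by clearbody D; refine (cvgC_eq2 (fun x => E (t x)) (E u) h).
rewrite /D; case: ifP => _; last exact: cvg_cst.
apply: cvgC_sum => j _; apply: cvgM; first exact: cvg_pade_den.
by case: ifP => _; [exact: tu|exact: cvg_cst].
Qed.

End Coefficients.

Lemma cvg_poly_unif n (P : T -> {poly C}) Q M e : 0 < e ->
  (forall x, (size (P x) <= n)%N) -> (size Q <= n)%N ->
  (forall i, (P x)`_i @[x --> G] --> Q`_i) ->
  \forall x \near G, forall z, cmod z <= M -> cmod ((P x).[z] - Q.[z]) <= e.
Proof.
move=> e0 sP sQ PQ.
have M0 : 0 < `|M| + 1 by rewrite ltr_pwDr.
pose D := n%:R * (`|M| + 1) ^+ n + 1.
have D0 : 0 < D by rewrite /D ltr_pwDr// mulr_ge0// exprn_ge0// ltW.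
have eD : 0 < e / D by rewrite divr_gt0.
have H m : \forall x \near G, forall i, (i < m)%N -> cmod ((P x)`_i - Q`_i) < e / D.
  elim: m => [|m IH]; first by apply: filterE.
  have := (@cvg_cmodP _ _ G FG (fun x => (P x)`_m) _).1 (PQ m) _ eD.
  move=> IH'; apply: (@filterS _ G FG _ _ _ (filterI IH IH')) => x [h1 h2] i.
  by rewrite ltnS leq_eqVlt => /orP[/eqP ->|im]; [exact: h2|exact: h1].
apply: (@filterS _ G FG _ _ _ (H n)) => x h z zM.
rewrite (horner_coef_wide _ (sP x)) (horner_coef_wide _ sQ) -sumrB.
apply: le_trans (cmod_sum _ _ _) _.
apply: (@le_trans _ _ (\sum_(i < n) e / D * (`|M| + 1) ^+ n)).
  apply: ler_sum => i _; rewrite -mulrBl cmodM cmodX; apply: ler_pM; rewrite ?exprn_ge0 ?cmod_ge0//.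
    by apply/ltW/h.
  have zM1 : cmod z <= `|M| + 1 by have := ler_norm M; lra.
  apply: (@le_trans _ _ ((`|M| + 1) ^+ i)).
    by apply: lerXn2r => //; rewrite nnegrE ?cmod_ge0// ltW.
  by apply: ler_weXn2l; [rewrite lerDr normr_ge0|exact: ltnW].
rewrite sumr_const card_ord -mulr_natl mulrCA mulrAC ler_pdivrMr//.
by rewrite ler_wpM2l ?(ltW e0)// lerDl ler01.
Qed.

End Filters.

Lemma ratio_near K A B e : compact K -> (forall z, K z -> B.[z] != 0) -> 0 < e ->
  exists2 d, 0 < d & forall A' B' z, K z -> cmod (A'.[z] - A.[z]) <= d ->
    cmod (B'.[z] - B.[z]) <= d ->
    B'.[z] != 0 /\ cmod (A'.[z] / B'.[z] - A.[z] / B.[z]) <= e.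
Proof.
move=> cK B0 e0; have [M KM] := compactC_bounded cK.
have [a a0 aP] := poly_bounded A M; have [b b0 bP] := poly_bounded B M.
have cB z : K z -> {for z, continuous (fun z => cmod B.[z])}.
  move=> _; apply: (@cont_comp _ _ _ (fun z => B.[z]) (@cmod R)); last exact: continuous_cmod.
  by apply: derivable_cont; exact: derivable_poly.
have [|m m0 mP] := compact_pos_lower cK cB; first by move=> z Kz; rewrite cmod_gt0 B0.
have ab : 0 < a + b + 1 by rewrite ltr_pwDr// addr_ge0.
(* The first term keeps the modulus of [B'] above [m / 2], so the common denominator exceeds
   [m / 2 * m]; the second keeps the numerator, at most [(a + b) * d], below [e] times that. *)
exists (Num.min (m / 2) (e * (m * m) / (2 * (a + b + 1)))).
  by rewrite lt_min !divr_gt0// ?mulr_gt0.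
move=> A' B' z Kz; rewrite !le_min => /andP[_ hA] /andP[hB1 hB2].
have Bm := mP z Kz; have Bz := B0 z Kz.
have B'm : m / 2 <= cmod B'.[z].
  have : cmod B.[z] <= cmod (B.[z] - B'.[z]) + cmod B'.[z].
    by rewrite -[X in cmod X <= _](subrK B'.[z]); exact: cmodD.
  by rewrite cmodBC; lra.
have B'0 : B'.[z] != 0 by rewrite -cmod_gt0; lra.
split; first exact: B'0.
have -> : A'.[z] / B'.[z] - A.[z] / B.[z] =
    ((A'.[z] - A.[z]) * B.[z] - A.[z] * (B'.[z] - B.[z])) / (B'.[z] * B.[z]).
  by field; rewrite B'0 Bz.
have BB : m / 2 * m <= cmod (B'.[z] * B.[z]).
  by rewrite cmodM; apply: ler_pM => //; rewrite ?divr_ge0// ltW.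
rewrite cmod_div ler_pdivrMr; last by apply: lt_le_trans BB; rewrite mulr_gt0// divr_gt0.
apply: (@le_trans _ _ (e * (m / 2 * m))); last by rewrite ler_wpM2l// ltW.
set d := e * (m * m) / _ in hA hB2.
have dE : (a + b + 1) * d = e * (m / 2 * m).
  by rewrite /d; field; rewrite gt_eqF.
rewrite -dE; apply: le_trans (cmodB _ _) _; rewrite !cmodM.
have zM := KM z Kz.
have h1 : cmod (A'.[z] - A.[z]) * cmod B.[z] <= d * b.
  by apply: ler_pM; rewrite ?cmod_ge0//; exact: bP.
have h2 : cmod A.[z] * cmod (B'.[z] - B.[z]) <= a * d.
  by apply: ler_pM; rewrite ?cmod_ge0//; exact: aP.
have : 0 <= d by apply: le_trans hA; exact: cmod_ge0.
by move: h1 h2; lra.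
Qed.

End PadeContinuity.

(** * The space of holomorphic functions and its Baire property *)

Section HolomorphicSpace.
Variable R : realType.
Local Notation C := (Cplx R).
Variable Omega : set C.
Hypothesis oO : open Omega.
Local Notation X := (hol_space Omega).
Implicit Types (z w : C) (e d M r : R) (K L : set C) (g : C -> C) (n m s : nat).

Definition holval (f : X) : C -> C := \val f.

Lemma holval_holo f : holo_on Omega (holval f).
Proof. by have [] := set_valP f. Qed.

Lemma holval_exists g : holo_on Omega g -> (forall z, ~ Omega z -> g z = 0) ->
  exists f, holval f = g.
Proof.
move=> hg g0; have h : g \in (hol_space Omega) by apply/mem_set.
by exists (exist _ g h).
Qed.

(** One compact set and one error suffice, since finite unions of compact sets are compact: the sets
    on the right form a filter that converges to [f] uniformly on compact sets, so it contains all
    neighbourhoods. *)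
Lemma fam_nbhs_cmodP (f : {family compactly_in Omega, C -> C})
    (B : set {family compactly_in Omega, C -> C}) :
  nbhs f B <-> exists L e, [/\ compact L, L `<=` Omega, 0 < e &
    forall g : C -> C, (forall z, L z -> cmod (g z - f z) < e) -> B g].
Proof.
split; last first.
  move=> [L [e [cL LO e0 LB]]].
  have entE : entourage [set xy : C * C | cmod (xy.2 - xy.1) < e].
    rewrite -entourage_from_ballE; exists (mkC e 0) => /=.
      by rewrite -mkC00 ltC_mkC.
    by move=> xy; rewrite -ball_normE /ball_ /= normC_cmod ltC_mkC cmodBC.
  have := @fam_nbhs C C (compactly_in Omega) L _ f entE (conj LO cL).
  by apply: filterS => g hg; apply: LB => z Lz; exact: hg.
pose G : set_system (C -> C) := [set B | exists L e, [/\ compact L, L `<=` Omega, 0 < e &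
    forall g : C -> C, (forall z, L z -> cmod (g z - f z) < e) -> B g]].
have FG : Filter G.
  split.
  - by exists set0, 1; split=> //; exact: compact0.
  - move=> A A' [L [e [cL LO e0 hA]]] [L' [e' [cL' LO' e0' hA']]].
    exists (L `|` L'), (Num.min e e'); split.
    + exact: compactU.
    + by rewrite subUset.
    + by rewrite lt_min e0.
    + move=> g hg; split; [apply: hA|apply: hA'] => z Lz.
        by have := hg z (or_introl Lz); rewrite lt_min => /andP[].
      by have := hg z (or_intror Lz); rewrite lt_min => /andP[].
  - move=> A A' AA' [L [e [cL LO e0 hA]]]; exists L, e; split=> // g hg.
    by apply: AA'; exact: hA.
suff H : G `=>` nbhs f by exact: H.
apply/fam_cvgP => A [AO cA] P /uniform_nbhs[E [entE EP]].
move: entE; rewrite -entourage_from_ballE => -[e /= e0 eE].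
have ee : e = mkC (complex.Re e) 0.
  by apply: eq_ReIm => //=; apply/ger0_Im/ltW.
exists A, (complex.Re e); split=> //; first by move: e0; rewrite ltcE => /andP[].
move=> g hg; apply: EP => y Ay; apply: eE.
rewrite -ball_normE /ball_ /= ee normC_cmod ltC_mkC cmodBC.
exact: hg.
Qed.

Lemma hol_nbhsP (f : X) (A : set X) : nbhs f A <->
  exists L e, [/\ compact L, L `<=` Omega, 0 < e &
    forall g : X, (forall z, L z -> cmod (holval g z - holval f z) < e) -> A g].
Proof.
split.
  move=> [B [[B' oB' <-]] Bf BA].
  have /fam_nbhs_cmodP[L [e [cL LO e0 h]]] : nbhs (\val f) B' by exact: open_nbhs_nbhs.
  by exists L, e; split=> // g hg; apply: BA; exact: h.
move=> [L [e [cL LO e0 h]]].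
have fB : nbhs (\val f) [set g : {family compactly_in Omega, C -> C} |
    forall z, L z -> cmod (g z - holval f z) < e].
  by apply/fam_nbhs_cmodP; exists L, e; split.
have cv : continuous (\val : X -> _) by exact: initial_continuous.
by refine (@filterS _ (nbhs f) _ _ _ _ (cv f _ fB)) => g; exact: h.
Qed.

Lemma compact_cball z r : compact [set w : C | cmod (w - z) <= r].
Proof.
apply: (@compactC R _ (r + cmod z)).
  have -> : [set w : C | cmod (w - z) <= r] = ~` [set w | r < cmod (w - z)].
    by apply/seteqP; split=> w /=; [rewrite leNgt => /negP|move=> /negP; rewrite -leNgt].
  apply: open_closedC; apply/openC_cmodP => w /= wr.
  exists (cmod (w - z) - r); first by rewrite subr_gt0.
  by move=> v vw; have := cmod_tri w z v; rewrite (cmodBC w v); lra.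
move=> w /= wr; have : cmod w <= cmod (w - z) + cmod z.
  by rewrite -[X in cmod X <= _](subrK z); exact: cmodD.
lra.
Qed.

Definition exhaust s : set C :=
  [set z | cmod z <= s%:R /\ forall w, ~ Omega w -> s.+1%:R^-1 <= cmod (z - w)].

Lemma exhaust_sub s : exhaust s `<=` Omega.
Proof.
move=> z [_ h]; apply: contrapT => /h; rewrite subrr cmod0 leNgt.
by rewrite invr_gt0 ltr0n.
Qed.

Lemma compact_exhaust s : compact (exhaust s).
Proof.
apply: (@compactC R _ s%:R); last by move=> z [].
move=> z clz; split.
  rewrite leNgt; apply/negP => zs.
  have d0 : 0 < cmod z - s%:R by rewrite subr_gt0.
  have [|w [[ws _] /= wz]] := clz [set w | cmod (w - z) < cmod z - s%:R].
    by apply/nbhs_cmodP; exists (cmod z - s%:R).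
  have : cmod z <= cmod (z - w) + cmod w by rewrite -[X in cmod X <= _](subrK w); exact: cmodD.
  by rewrite cmodBC; lra.
move=> v nOv; rewrite leNgt; apply/negP => zs.
have d0 : 0 < s.+1%:R^-1 - cmod (z - v) by rewrite subr_gt0.
have [|w [[_ /(_ v nOv) wv] /= wz]] := clz [set w | cmod (w - z) < s.+1%:R^-1 - cmod (z - v)].
  by apply/nbhs_cmodP; exists (s.+1%:R^-1 - cmod (z - v)).
move: wz; rewrite ltrBrDr => wz.
by have := le_lt_trans (cmod_tri w v z) wz; rewrite ltNge wv.
Qed.

Lemma inv_nat_lt e : 0 < e -> exists n, forall m, (n <= m)%N -> (m.+1%:R^-1 : R) < e.
Proof.
move=> e0; exists (Num.truncn e^-1) => m nm.
rewrite invf_plt ?posrE ?ltr0n//; apply: lt_le_trans (truncnS_gt _) _.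
by rewrite ler_nat ltnS.
Qed.

Lemma exhaust_cover L : compact L -> L `<=` Omega ->
  exists n, forall m, (n <= m)%N -> L `<=` exhaust m.
Proof.
move=> cL LO; have [M LM] := compactC_bounded cL.
have LO0 : L `&` ~` Omega = set0 by apply/seteqP; split=> // z [/LO].
have [d d0 Ld] := compact_closed_dist cL (open_closedC oO) LO0.
have [n hn] := inv_nat_lt d0.
exists (maxn n (Num.truncn M).+1) => m; rewrite geq_max => /andP[nm Mm] z Lz; split.
  apply: le_trans (LM z Lz) _; apply/ltW/(lt_le_trans (truncnS_gt _)).
  by rewrite ler_nat.
by move=> w nOw; apply: le_trans (Ld z w Lz nOw); apply/ltW/hn.
Qed.

(** The tails lie in compact discs, and a cluster point lies in all of them. [P n] will say that the
    point considered already belongs to the [n]-th compact set, since no bound is available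
    before. *)
Lemma nested_limit (u : nat -> C) (P : nat -> Prop) (e : nat -> R) : (exists n, P n) ->
  (forall n m, P n -> (n <= m)%N -> cmod (u m - u n) <= e n) ->
  exists l, forall n, P n -> cmod (l - u n) <= e n.
Proof.
move=> [n0 Pn0] h.
have FD n : P n -> \forall m \near \oo, cmod (u m - u n) <= e n.
  by move=> Pn; exists n => // m nm; exact: h.
have [l [_ cl]] := @compact_cball (u n0) (e n0) _
  (fmap_proper_filter u eventually_filter) (FD n0 Pn0).
exists l => n Pn.
have : closure [set w : C | cmod (w - u n) <= e n] l.
  move=> B nB; have [w [Dw Bw]] := cl [set w : C | cmod (w - u n) <= e n] B (FD n Pn) nB.
  by exists w.
by apply: compactC_closed; exact: compact_cball.
Qed.

(* A decreasing sequence of closed basic neighbourhoods inside the [U n]; the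
   limit is holomorphic by Weierstrass' theorem. *)
Lemma hol_baire (U : nat -> set X) : (forall n, open (U n)) -> (forall n, dense (U n)) ->
  dense (\bigcap_n U n).
Proof.
move=> oU dU W [f0 Wf0] oW.
pose S := (X * set C * R)%type.
pose valid (a : S) := [/\ compact a.1.2, a.1.2 `<=` Omega & 0 < a.2].
pose cball (a : S) (g : X) := forall z, a.1.2 z -> cmod (holval g z - holval a.1.1 z) <= a.2.
have shrink (V : set X) (f : X) : open V -> V f -> exists L e,
    [/\ compact L, L `<=` Omega, 0 < e & forall g : X, cball (f, L, e) g -> V g].
  move=> oV Vf; have /hol_nbhsP[L [e [cL LO e0 h]]] : nbhs f V by exact: open_nbhs_nbhs.
  exists L, (e / 2); split=> //; first by rewrite divr_gt0.
  move=> g hg; apply: h => z Lz; apply: le_lt_trans (hg z Lz) _.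
  by rewrite /= ltr_pdivrMr// ltr_pMr// ltr1n.
have step (ns : nat * S) : exists b : S, valid ns.2 ->
    [/\ valid b, forall g : X, cball b g -> U ns.1 g /\ cball ns.2 g,
        ns.2.1.2 `<=` b.1.2, exhaust ns.1 `<=` b.1.2 & b.2 <= ns.1.+1%:R^-1].
  case: ns => n a /=; have [va|nva] := pselect (valid a); last by exists a.
  case: a va => [[f L] e] [/= cL LO e0].
  pose V := [set g : X | forall z, L z -> cmod (holval g z - holval f z) < e].
  have /hol_nbhsP : exists L e, [/\ compact L, L `<=` Omega, 0 < e &
    forall g : X, (forall z, L z -> cmod (holval g z - holval f z) < e) -> V g].
    by exists L, e; split.
  rewrite nbhsE => -[V' [oV' V'f] V'V].
  have [g [V'g Ug]] := dU n V' (ex_intro _ f V'f) oV'.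
  have oVU : open (V' `&` U n) by apply: openI.
  have [L1 [e1 [cL1 LO1 e10 h1]]] := shrink _ g oVU (conj V'g Ug).
  have n0 : 0 < (n.+1%:R^-1 : R) by rewrite invr_gt0 ltr0n.
  (* [L1] and [e1] keep the new ball inside the previous one and inside [U n]; [L] makes the compact
     sets increase; [exhaust n] and the radius [1 / (n + 1)] force uniform convergence on every
     compact set. *)
  exists (g, L1 `|` L `|` exhaust n, Num.min e1 n.+1%:R^-1) => _; split=> /=.
  - split=> /=; last by rewrite lt_min e10.
      by apply: compactU; [apply: compactU|exact: compact_exhaust].
    by rewrite !subUset; split; [split|exact: exhaust_sub].
  - move=> k hk; have [|V'k Uk] := h1 k.
      move=> z L1z; have := hk z (or_introl (or_introl L1z)).
      by rewrite /= le_min => /andP[].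
    split; first exact: Uk.
    by move=> z Lz; apply/ltW; exact: (V'V k V'k).
  - by move=> z Lz; left; right.
  - by move=> z Lz; right.
  - by rewrite ge_min lexx orbT.
have [nxt hnxt] := choice step.
have [L0 [e0 [cL0 LO0 e00 h0]]] := shrink W f0 oW Wf0.
pose a := fix a n : S := if n is m.+1 then nxt (m, a m) else (f0, L0, e0).
have va n : valid (a n).
  elim: n => [|n IH]; first by split.
  by have [] := hnxt (n, a n) IH.
have aS n := hnxt (n, a n) (va n).
have Lmono n m : (n <= m)%N -> (a n).1.2 `<=` (a m).1.2.
  move=> nm; rewrite -(subnKC nm); elim: (m - n)%N => [|k IH]; first by rewrite addn0.
  by rewrite addnS; apply: subset_trans IH _; have [] := aS (n + k)%N.
have bmono n m (g : X) : (n
 <= m)%N -> cball (a m) g -> cball (a n) g.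
  move=> nm; rewrite -(subnKC nm); elim: (m - n)%N => [|k IH]; first by rewrite addn0.
  by rewrite addnS => h; apply: IH; have [_ /(_ g h)[]] := aS (n + k)%N.
have self n : cball (a n) (a n).1.1.
  by move=> z _; rewrite subrr cmod0; have [_ _ /ltW] := va n.
have cauchy z n m : (a n).1.2 z -> (n <= m)%N ->
    cmod (holval (a m).1.1 z - holval (a n).1.1 z) <= (a n).2.
  by move=> Lz nm; exact: (bmono n m _ nm (self m)).
have lim z : exists l, (~ Omega z -> l = 0) /\
    (Omega z -> forall n, (a n).1.2 z -> cmod (l - holval (a n).1.1 z) <= (a n).2).
  have [Oz|nOz] := pselect (Omega z); last by exists 0; split.
  have zO : [set z] `<=` Omega by move=> w ->.
  have [n hn] := exhaust_cover (@compact_set1 _ z) zO.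

  have Ln : exists n, (a n).1.2 z.
    by exists n.+1; have [_ _ _ ex _] := aS n; apply: ex; apply: (hn n).
  have [l hl] := nested_limit (u := fun n => holval (a n).1.1 z) Ln (cauchy z).
  by exists l; split.

have [l hl] := choice lim.
have lE n z : (a n).1.2 z -> cmod (l z - holval (a n).1.1 z) <= (a n).2.
  by move=> Lz; apply: (hl z).2 => //; have [_ LO _] := va n; exact: LO.
have hlol : holo_on Omega l.
  move=> z Oz; have [r r0 rO] := (openC_cmodP _).1 oO z Oz.
  have r2 : 0 < r / 2 by rewrite divr_gt0.
  have r2O w : cmod (w - z) <= r / 2 -> Omega w by move=> wz; apply: rO; lra.
  have [n hn] := exhaust_cover (compact_cball (z := z) (r := r / 2)) r2O.
  apply: (holo_uniform_limit (A := Omega) r2) => [w wz|e e0'].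
    by apply: r2O; exact: ltW.
  have [k hk] := inv_nat_lt e0'.
  have nm : (n <= maxn n k)%N by exact: leq_maxl.
  have km : (k <= maxn n k)%N by exact: leq_maxr.
  have [_ _ _ ex em] := aS (maxn n k).
  exists (holval (a (maxn n k).+1).1.1); first exact: holval_holo.
  move=> w wz; apply: le_trans (lE _ w _) _.
    by apply: ex; apply: (hn _ nm); exact: ltW.
  by apply: le_trans em _; apply/ltW/hk.
have [f fE] := holval_exists hlol (fun z => (hl z).1).
have fb n : cball (a n) f by move=> z Lz; rewrite fE; exact: lE.
exists f; split; first by apply: h0; exact: (fb 0%N).
by move=> n _; have [_ /(_ f (fb n.+1))[]] := aS n.
Qed.

End HolomorphicSpace.

(** * Universal functions as a countable intersection of dense open sets *)

Section Universality.
Variable R : realType.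
Local Notation C := (Cplx R).
Implicit Types (z w : C) (e d M r : R) (K L : set C) (A B P h : {poly C}) (n m s N p q : nat)
  (AB : {poly C} * {poly C}).

(** The supremum itself serves as [d]; being finite, it excludes poles on [K]. *)
Lemma sup_dist_lt K AB (g : C -> C) e : (sup_dist K AB g < e%:E)%E ->
  exists2 d, d < e & forall z, K z -> AB.2.[z] != 0 /\ cmod (AB.1.[z] / AB.2.[z] - g z) <= d.
Proof.
rewrite /sup_dist; set S := (X in ereal_sup X) => lt.
have ub x : S x -> (x <= ereal_sup S)%E by move=> Sx; exact: ereal_sup_ubound.
have s0 : (0 <= ereal_sup S)%E by apply: ub; left.
case E : (ereal_sup S) s0 lt ub => [d| |] // _; rewrite lte_fin => lt ub.
exists d => // z Kz.
have : S (if root AB.2 z then +oo%E else (cmod (AB.1.[z] / AB.2.[z] - g z))%:E).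
  by right; exists z.
by move=> /ub; case: ifPn => // r; rewrite lee_fin; split.
Qed.

Lemma sup_dist_cvg K (AB : nat -> {poly C} * {poly C}) (g : C -> C) :
  (forall e, 0 < e -> exists N, forall n, (N <= n)%N -> forall z, K z ->
    (AB n).2.[z] != 0 /\ cmod ((AB n).1.[z] / (AB n).2.[z] - g z) <= e) ->
  sup_dist K (AB n) g @[n --> \oo] --> 0%E.
Proof.
move=> h B; rewrite /nbhs /= /ereal_nbhs /= => /nbhs_ballP[e /= e0 eB].
have e2 : 0 < e / 2 by rewrite divr_gt0.
have [N hN] := h _ e2; exists N => // n /= /hN{}hN.
apply: (_ : forall x : \bar R, (0 <= x)%E -> (x <= (e / 2)%:E)%E -> B x).
- case=> [x| |] //; rewrite !lee_fin => x0 xe; apply: eB.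
  rewrite -ball_normE /ball_ /= sub0r normrN ger0_norm//; lra.
- by apply: ereal_sup_ubound; left.
- apply: ge_ereal_sup => x [->|[z Kz <-]]; first by rewrite lee_fin ltW.
  by have [r0 hz] := hN z Kz; rewrite /root (negPf r0) lee_fin.
Qed.

Lemma pade_congr (f g : C -> C) zeta p q : taylor_coef f zeta = taylor_coef g zeta ->
  pade_regular p q zeta f -> pade_regular p q zeta g /\ pade f zeta p q = pade g zeta p q.
Proof. by move=> E; rewrite /pade_regular /hankel /pade /is_pade E. Qed.

Lemma unshiftp_dist zeta A B z : cmod ((unshiftp zeta A).[z] - (unshiftp zeta B).[z]) =
  cmod (A.[z - zeta] - B.[z - zeta]).
Proof. by rewrite !horner_unshiftp. Qed.

Section Target.
Variables (F : set (nat * nat)) (Omega : set C) (zeta : C).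
Hypotheses (oO : open Omega) (Oz : Omega zeta).
Local Notation X := (hol_space Omega).
Implicit Types (f g : X).

Lemma holo_near_holval f : holo_near zeta (holval f).
Proof.
have [r r0 rO] := (openC_cmodP _).1 oO zeta Oz.
by exists r => // w wz; apply: holval_holo; exact: rO.
Qed.

Lemma cvg_taylor_coef f (n : int) :
  taylor_coef (holval g) zeta n @[g --> f] --> taylor_coef (holval f) zeta n.
Proof.
apply/(@cvg_cmodP _ _ (nbhs f) _) => e e0.
case: n => n; last by apply: filterE => g; rewrite subrr cmod0.
have [r r0 rO] := (openC_cmodP _).1 oO zeta Oz.
have r3 : 0 < r / 3 by rewrite divr_gt0.
have [K K0 hK] := taylor_coef_dist n (square_in zeta r3).
pose L := [set w : C | cmod (w - zeta) <= 2 * (r / 3)].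
have LO : L `<=` Omega by move=> w /= wz; apply: rO; rewrite /L /= in wz; lra.
have onL w : onR (complex.Re zeta - r / 3) (complex.Re zeta + r / 3)
    (complex.Im zeta - r / 3) (complex.Im zeta + r / 3) w -> L w by exact: square_cmod.
have K1 : 0 < K + 1 by rewrite ltr_pwDr.
apply/hol_nbhsP; exists L, (e / (K + 1)); split.
- exact: compact_cball.
- exact: LO.
- by rewrite divr_gt0.
- move=> g hg; have := hK (holval g) (holval f) (e / (K + 1)).
  move=> /(_ (fun w hw => holval_holo (LO w (onL w hw)))).
  move=> /(_ (fun w hw => holval_holo (LO w (onL w hw)))).
  move=> /(_ (fun w hw => ltW (hg w (onL w hw)))) h; apply: le_lt_trans h _.
  by rewrite mulrCA gtr_pMr// ltr_pdivrMr// mul1r ltrDl.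
Qed.

(** Numerator and denominator have bounded degree and coefficients depending continuously on
    finitely many Taylor coefficients, so they vary uniformly little on [K], even though [K] may lie
    off [Omega]. *)
Lemma pade_near f p q K e : pade_regular p q zeta (holval f) -> compact K ->
  (forall z, K z -> (pade (holval f) zeta p q).2.[z] != 0) -> 0 < e ->
  \forall g \near f, pade_regular p q zeta (holval g) /\
    forall z, K z -> let AB := pade (holval g) zeta p q in
    let AB0 := pade (holval f) zeta p q in
    AB.2.[z] != 0 /\ cmod (AB.1.[z] / AB.2.[z] - AB0.1.[z] / AB0.2.[z]) <= e.
Proof.
move=> reg cK; rewrite (padeE (holo_near_holval f) reg) /= => B0 e0.
set A := unshiftp zeta _; set B := unshiftp zeta _ in B0 *.
have [d d0 hd] := ratio_near A cK B0 e0.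
have [M KM] := compactC_bounded cK.
have FF : Filter (nbhs f) by exact: nbhs_filter.
have cvt (n : int) : taylor_coef (holval g) zeta n @[g --> f] --> taylor_coef (holval f) zeta n.
  exact: cvg_taylor_coef.
have cA i : (pade_num (taylor_coef (holval g) zeta) p q)`_i @[g --> f] -->
    (pade_num (taylor_coef (holval f) zeta) p q)`_i by exact: (cvg_pade_num FF cvt reg).
have cB i : (pade_den (taylor_coef (holval g) zeta) p q)`_i @[g --> f] -->
    (pade_den (taylor_coef (holval f) zeta) p q)`_i by exact: (cvg_pade_den FF cvt reg).
have cD : \det (hankel_of (taylor_coef (holval g) zeta) p q) @[g --> f] -->
    \det (hankel_of (taylor_coef (holval f) zeta) p q) by exact: (cvg_hankel_det FF cvt).

have nA := cvg_poly_unif FF (M + cmod zeta) d0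
  (fun g => size_pade_num (taylor_coef (holval g) zeta) p q) (size_pade_num _ p q) cA.
have nB := cvg_poly_unif FF (M + cmod zeta) d0
  (fun g => size_pade_den (taylor_coef (holval g) zeta) p q) (size_pade_den _ p q) cB.
have r0 : 0 < cmod (\det (hankel_of (taylor_coef (holval f) zeta) p q)) by rewrite cmod_gt0.
have nD := (@cvg_cmodP _ _ (nbhs f) FF _ _).1 cD _ r0.
apply: (@filterS _ (nbhs f) FF _ _ _ (filterI (filterI nA nB) nD)) => g [[gA gB] gD].
have greg : pade_regular p q zeta (holval g).
  apply/negP => /eqP h; move: gD.
  by rewrite -[hankel_of (taylor_coef (holval g) zeta) p q]/(hankel (holval g) zeta p q) h
    sub0r cmodN ltxx.
split; first exact: greg.
move=> z Kz; rewrite (padeE (holo_near_holval g) greg) /=.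
have zM : cmod (z - zeta) <= M + cmod zeta.
  by apply: le_trans (cmodB _ _) _; rewrite lerD2r; exact: KM.
apply: hd; first exact: Kz.
  by have := gA _ zM; rewrite -unshiftp_dist.
by have := gB _ zM; rewrite -unshiftp_dist.
Qed.

(** The bounds [d < e] are uniform over [K] and [L]; this margin is what makes the condition
    open. *)
Definition target K h L e : set X := [set f | exists p q,
  [/\ F (p, q), pade_regular p q zeta (holval f),
    exists2 d, d < e & forall z, K z -> let AB := pade (holval f) zeta p q in
      AB.2.[z] != 0 /\ cmod (AB.1.[z] / AB.2.[z] - h.[z]) <= d &
    exists2 d, d < e & forall z, L z -> let AB := pade (holval f) zeta p q in
      AB.2.[z] != 0 /\ cmod (AB.1.[z] / AB.2.[z] - holval f z) <= d]].

Lemma open_target K h L e : compact K -> compact L -> L `<=` Omega ->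
  open (target K h L e).
Proof.
move=> cK cL LO; rewrite openE => f [p [q [Fpq reg [d de Kd] [d' de' Ld]]]].
rewrite /interior.
have a0 : 0 < (e - d) / 2 by rewrite divr_gt0// subr_gt0.
(* On [L] both the approximant and the function itself move, so each gets a third of the margin. *)
have b0 : 0 < (e - d') / 3 by rewrite divr_gt0// subr_gt0.
have nK := pade_near reg cK (fun z Kz => (Kd z Kz).1) a0.
have nL := pade_near reg cL (fun z Lz => (Ld z Lz).1) b0.
have nf : nbhs f [set g : X | forall z, L z -> cmod (holval g z - holval f z) < (e - d') / 3].
  by apply/hol_nbhsP; exists L, ((e - d') / 3); split.
apply: (@filterS _ (nbhs f) _ _ _ _ (filterI (filterI nK nL) nf)).
move=> g [[[greg gK] [_ gL]] gf]; exists p, q; split.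
- exact: Fpq.
- exact: greg.
- exists (d + (e - d) / 2); first lra.
  move=> z Kz; have [g1 g2] := gK z Kz; split; first exact: g1.
  apply: le_trans (cmod_tri _ _ _) _; rewrite addrC; apply: lerD; last exact: g2.
  exact: (Kd z Kz).2.
- exists (d' + (e - d') / 3 + (e - d') / 3); first lra.
  move=> z Lz; have [g1 g2] := gL z Lz; split; first exact: g1.
  have h1 := gf z Lz; have h2 := (Ld z Lz).2; rewrite cmodBC in h1.
  have := cmod_tri ((pade (holval g) zeta p q).1.[z] / (pade (holval g) zeta p q).2.[z])
    (holval g z) (holval f z).
  have := cmod_tri ((pade (holval g) zeta p q).1.[z] / (pade (holval g) zeta p q).2.[z])
    (holval f z) ((pade (holval f) zeta p q).1.[z] / (pade (holval f) zeta p q).2.[z]).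
  by move: h1 h2 g2 => /=; lra.
Qed.

Hypotheses (dO : domain Omega) (sc : simply_connected Omega).
Hypothesis hF : exists p q : nat -> nat,
  (forall n, F (p n, q n)) /\ p n @[n --> \oo] --> \oo.

Lemma dense_target K h L e : compact K -> K `<=` ~` Omega -> connected (~` K) ->
  compact L -> L `<=` Omega -> 0 < e -> dense (target K h L e).
Proof.
move=> cK KO ccK cL LO e0 W [f Wf] oW.
have /hol_nbhsP[L1 [e1 [cL1 LO1 e10 hW]]] := open_nbhs_nbhs (conj oW Wf).
pose LL := L `|` L1; have cLL : compact LL by exact: compactU.
have LLO : LL `<=` Omega by rewrite subUset.
(* The polynomial costs [2 * t], the passage to the fraction and the truncation [t] each; every
   total stays at most [4 * t], strictly below both tolerances. *)
pose t := Num.min e e1 / 8.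
have t0 : 0 < t by rewrite divr_gt0// lt_min e0.
have te : 8 * t <= e by rewrite /t mulrC divfK// ge_min lexx.
have te1 : 8 * t <= e1 by rewrite /t mulrC divfK// ge_min lexx orbT.
(* [pade_example] needs a nonzero polynomial; if Runge's theorem returns [0], the constant [t]
   replaces it, at the price of doubling the error. *)
have [P [P0 PL PK]] : exists P, [/\ P != 0,
    forall z, LL z -> cmod (P.[z] - holval f z) <= 2 * t &
    forall z, K z -> cmod (P.[z] - h.[z]) <= 2 * t].
  have [P [PL PK]] := approx_pair h dO sc cLL LLO cK KO ccK (holval_holo (f := f)) t0.
  have [P0|P0] := eqVneq P 0; last first.
    exists P; split=> // z hz; [apply: le_trans (PL z hz) _|apply: le_trans (PK z hz) _]; lra.
  exists ((mkC t 0 : C)%:P); split.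
  - by rewrite polyC_eq0 -cmod_gt0 cmod_mkC0 gtr0_norm.
  - move=> z hz; have := PL z hz; rewrite P0 horner0 hornerC => h1.
    have := cmodD (mkC t 0 : C) (0 - holval f z).
    by rewrite add0r cmod_mkC0 gtr0_norm//; rewrite add0r in h1; lra.
  - move=> z hz; have := PK z hz; rewrite P0 horner0 hornerC => h1.
    have := cmodD (mkC t 0 : C) (0 - h.[z]).
    by rewrite add0r cmod_mkC0 gtr0_norm//; rewrite add0r in h1; lra.
have [p [q [Fpq sP]]] : exists p q, F (p, q) /\ (size P <= p.+1)%N.
  have [p [q [Fpq /cvgnyPge/(_ (size P))]]] := hF.
  by move=> [N _ /(_ N (leqnn N)) hN]; exists (p N), (q N); split=> //; exact: leqW.
have [M hM] := compactC_bounded (compactU cLL cK).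
have [u [A [B [du [ureg uE] uP uAB]]]] := pade_example zeta q M sP P0 t0.
(* Elements of [hol_space] vanish off [Omega]; cutting [u] off there does not change its jet at
   [zeta], hence neither its approximant. *)
pose v z : C := if `[< Omega z >] then u z else 0.
have vu z : Omega z -> v z = u z by move=> Oz'; rewrite /v asboolT.
have v0 z : ~ Omega z -> v z = 0 by move=> nOz; rewrite /v asboolF.
have hv : holo_on Omega v.
  move=> z Oz'; have [r r0 rO] := (openC_cmodP _).1 oO z Oz'.
  apply: (holo_uniform_limit (A := setT) r0) => [//|e' e'0].
  exists u; first by move=> w _; exact: du.
  by move=> w wz; rewrite vu ?subrr ?cmod0 ?ltW//; exact: rO.
have [g gv] := holval_exists hv v0.
have [r r0 rO] := (openC_cmodP _).1 oO zeta Oz.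
have tc : taylor_coef u zeta = taylor_coef (holval g) zeta.
  apply: (taylor_coef_near r0).
  - by exists 1; [exact: ltr01|move=> w _; exact: du].
  - exact: holo_near_holval.
  - by move=> w wz; rewrite gv vu//; exact: rO.
have [greg gE] := pade_congr tc ureg.
have LLM z : LL z -> cmod z <= M by move=> Lz; apply: hM; left.
exists g; split.
  apply: hW => z Lz; have Lz' : LL z by right.
  rewrite gv vu; last exact: LLO.
  have := uP z (LLM z Lz'); have := PL z Lz'; have := cmod_tri (u z) (holval f z) P.[z].
  by lra.
exists p, q; rewrite -gE uE; split.
- exact: Fpq.
- exact: greg.
- exists (4 * t); first lra.
  move=> z Kz; have [b0 bP] := uAB z (hM z (or_intror Kz)); split; first exact: b0.
  by have := PK z Kz; have := cmod_tri (A.[z] / B.[z]) h.[z] P.[z]; lra.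
- exists (4 * t); first lra.
  move=> z Lz; have Lz' : LL z by left.
  have [b0 bP] := uAB z (LLM z Lz'); split; first exact: b0.
  rewrite gv vu; last exact: LLO.
  have := uP z (LLM z Lz'); have := cmod_tri (A.[z] / B.[z]) (u z) P.[z].
  by rewrite (cmodBC P.[z] (u z)); lra.
Qed.

Definition targets (k : nat * seq ((rat * rat) * rat) * seq (rat * rat) * nat) : set X :=
  target (Kset Omega k.1.1.1 k.1.1.2) (qpoly R k.1.2) (exhaust Omega k.2) k.2.+1%:R^-1.

(** Rational data suffice: every [K] lies in some [Kset], every [h] is close on [K] to some [qpoly],
    and one index [s] governs both the compact set [exhaust s] and the tolerance. *)
Lemma pade_universalE :
  [set f : X | pade_universal F Omega zeta (\val f)] = \bigcap_k targets k.
Proof.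
have Onn : Omega !=set0 by exists zeta.
have [_ _ cO] := dO.
apply/seteqP; split=> f.
  move=> uf [[[N l] hl] s] _.
  have [p [q [Fpq reg cvK cvL]]] := uf (qpoly R hl) (Kset Omega N l)
    (compact_Kset (l := l) (N := N) oO) (@Kset_sub R Omega N l) (connected_complKset (l := l) (N := N) cO).
  have s0 : 0 < (s.+1%:R^-1 : R) by rewrite invr_gt0 ltr0n.
  have lim (u : nat -> \bar R) : u n @[n --> \oo] --> 0%E ->
      \forall n \near \oo, (u n < (s.+1%:R^-1)%:E)%E.
    by move=> cu; exact: cu _ (nbhs_open_ereal_lt (f := fun=> s.+1%:R^-1) s0).
  have cvE := cvL (exhaust Omega s) ltac:(exact: compact_exhaust) (@exhaust_sub R Omega s).
  have [n [nK nL]] := filter_ex (filterI (lim _ cvK) (lim _ cvE)).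

  exists (p n), (q n); split.
  - exact: Fpq.
  - exact: reg.
  - exact: sup_dist_lt nK.
  - exact: sup_dist_lt nL.
(* A single sequence must serve every compact subset of [Omega], so its [n]-th term is taken from
   the target with [exhaust n], tolerance [1 / (n + 1)], and a rational polynomial that close to [h]
   on [K]. *)
move=> tf h K cK KO ccK.
have [N [l KNl]] := Kset_cover Onn cK KO ccK.
have [M KM] := compactC_bounded cK.
have [hl hhl] : exists hl : nat -> seq (rat * rat), forall n z, cmod z <= M ->
    cmod ((qpoly R (hl n)).[z] - h.[z]) <= n.+1%:R^-1.
  have H n : exists hl, forall z, cmod z <= M -> cmod ((qpoly R hl).[z] - h.[z]) <= n.+1%:R^-1.
    by apply: qpoly_dense; rewrite invr_gt0 ltr0n.
  by have [hl hhl] := choice H; exists hl.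
have step n : exists pq : nat * nat, [/\ F pq, pade_regular pq.1 pq.2 zeta (holval f),
    forall z, K z -> let AB := pade (holval f) zeta pq.1 pq.2 in
      AB.2.[z] != 0 /\ cmod (AB.1.[z] / AB.2.[z] - h.[z]) <= n.+1%:R^-1 + n.+1%:R^-1 &
    forall z, exhaust Omega n z -> let AB := pade (holval f) zeta pq.1 pq.2 in
      AB.2.[z] != 0 /\ cmod (AB.1.[z] / AB.2.[z] - holval f z) <= n.+1%:R^-1].
  have [p [q [Fpq reg [d dn hK] [d' dn' hL]]]] := tf (N, l, hl n, n) I.
  exists (p, q); split=> // z hz.
    have [b0 bh] := hK z (KNl z hz); split; first exact: b0.
    apply: le_trans (cmod_tri _ h.[z] (qpoly R (hl n)).[z]) _.
    by apply: lerD; [exact: le_trans bh (ltW dn)|exact: hhl n z (KM z hz)].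

  have [b0 bh] := hL z hz; split; first exact: b0.
  by apply: le_trans bh _; exact: ltW.
have [pq hpq] := choice step.
exists (fun n => (pq n).1), (fun n => (pq n).2); split.
- by move=> n; have [Fn _ _ _] := hpq n; rewrite -surjective_pairing.
- by move=> n; have [_ rn _ _] := hpq n.
- apply: sup_dist_cvg => e e0; have e2 : 0 < e / 2 by rewrite divr_gt0.
  have [n0 hn0] := inv_nat_lt e2; exists n0 => n nn z Kz.
  have [_ _ /(_ z Kz)[b0 bh] _] := hpq n; split; first exact: b0.
  apply: le_trans bh _; rewrite (splitr e).
  by apply: lerD; apply/ltW; exact: hn0.

- move=> L cL LO; apply: sup_dist_cvg => e e0.
  have [n0 hn0] := inv_nat_lt e0; have [n1 hn1] := exhaust_cover oO cL LO.
  exists (maxn n0 n1) => n; rewrite geq_max => /andP[nn0 nn1] z Lz.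
  have [_ _ _ /(_ z (hn1 n nn1 z Lz))[b0 bh]] := hpq n; split; first exact: b0.
  by apply: le_trans bh _; apply/ltW; exact: hn0.
Qed.

Lemma universal_Gdelta_dense :
  dense [set f : X | pade_universal F Omega zeta (\val f)] /\
  Gdelta [set f : X | pade_universal F Omega zeta (\val f)].
Proof.
have [_ _ cO] := dO.
pose U n : set X := if @unpickle (nat * seq ((rat * rat) * rat) * seq (rat * rat) * nat)%type n
  is Some k then targets k else setT.
have E : [set f : X | pade_universal F Omega zeta (\val f)] = \bigcap_n U n.
  rewrite pade_universalE; apply/seteqP; split=> f h.
    by move=> n _; rewrite /U; case: unpickle => // k; exact: h.
  by move=> k _; have := h (pickle k) I; rewrite /U pickleK.
have oU n : open (U n).
  rewrite /U; case: unpickle => [[[[N l] hl] s]|]; last exact: openT.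
  apply: open_target; [exact: compact_Kset|exact: compact_exhaust|exact: exhaust_sub].
have dU n : dense (U n).
  rewrite /U; case: unpickle => [[[[N l] hl] s]|]; last first.
    by move=> W [f Wf] _; exists f.
  apply: dense_target; [exact: compact_Kset|exact: Kset_sub|exact: connected_complKset| | |].
  - exact: compact_exhaust.
  - exact: exhaust_sub.
  - by rewrite invr_gt0 ltr0n.
by rewrite E; split; [exact: hol_baire|exists U].
Qed.

End Target.

End Universality.

Theorem theorem3p3 (R : realType) (F : set (nat * nat))
    (hF : exists p q : nat -> nat,
        (forall n, F (p n, q n)) /\ p n @[n --> \oo] --> \oo)
    (Omega : set (Cplx R)) (hdom : domain Omega)
    (hsc : simply_connected Omega)
    (zeta : Cplx R) (hzeta : Omega zeta) :
  (exists f : hol_space Omega, pade_universal F Omega zeta (\val f)) /\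
  dense [set f : hol_space Omega | pade_universal F Omega zeta (\val f)] /\
  Gdelta [set f : hol_space Omega | pade_universal F Omega zeta (\val f)].
Proof.
have [_ oO _] := hdom.
have [hd hG] := universal_Gdelta_dense oO hzeta hdom hsc hF.
split; last by split.
(* Density yields an element only when the space itself is nonempty. *)
have [f0 _] : exists f : hol_space Omega, holval f = fun=> 0.
  by apply: holval_exists => // z _; exact: derivable_cst.
have [f [_ hf]] := hd setT (ex_intro _ f0 I) openT.
by exists f.
Qed.
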